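(* Given $T>0$, $R>0$, there are constants $\tau_R>0$ and $c_{R,T}>0$ ($c_{R,T}$ depending on $R,T$ but not on $\tau$) such that the following holds for all $\tau\in(0,\tau_R)$. Let $v(t)$ be the exact solution of the twisted KdV equation on $[0,T]$ with $v(0)=u_0$, let $v^n$, $n\ge0$, be the iterates of the resonance-based midpoint rule in the twisted variable with $v^0=u_0$, and let $t_n=n\tau$. If $\sup_{t\in[0,T]}\|v(t)\|_{H^3}<R/2$, then $$\|v(t_n)-v^n\|_{H^1}\le c_{R,T}\,\tau\qquad\text{for all }0\le n\le\lfloor T/\tau\rfloor .$$
   Context: $\mathbb{T}=\mathbb{R}/(2\pi\mathbb{Z})$; $H^r=H^r(\mathbb{T})$ is the periodic Sobolev space with norm $\|u\|_{H^r}^2=\sum_{m}\langle m\rangle^{2r}|\hat u_m|^2$, $\langle m\rangle=|m|$ ($m\neq0$), $\langle0\rangle=1$. All functions are real-valued with zero mean. $\partial_x^{-1}$ is the Fourier multiplier $\widehat{(\partial_x^{-1}v)}_k=\hat v_k/(ik)$ for $k\ne0$ and $0$ for $k=0$. Twisted KdV equation: $\partial_tv=\frac12e^{t\partial_x^3}\partial_x\big(e^{-t\partial_x^3}v\big)^2$, $v(0)=u_0$ (equivalently $v(t)=e^{t\partial_x^3}u(t)$ with $\partial_tu+\partial_x^3u=\frac12\partial_x(u^2)$, $u(0)=u_0$). Resonance-based midpoint rule (twisted variable), step size $\tau$, $t_n=n\tau$: $$v^{n+1}=v^n+\tfrac1{24}e^{(t_n+\tau)\partial_x^3}\Big(e^{-(t_n+\tau)\partial_x^3}\partial_x^{-1}(v^{n+1}+v^n)\Big)^2-\tfrac1{24}e^{t_n\partial_x^3}\Big(e^{-t_n\partial_x^3}\partial_x^{-1}(v^{n+1}+v^n)\Big)^2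 .$$ The implicit equation is solved by fixed-point iteration: $v^{n+1}$ is the limit of the iteration $w\mapsto v^n+\frac1{24}e^{(t_n+\tau)\partial_x^3}(e^{-(t_n+\tau)\partial_x^3}\partial_x^{-1}(w+v^n))^2-\frac1{24}e^{t_n\partial_x^3}(e^{-t_n\partial_x^3}\partial_x^{-1}(w+v^n))^2$ started at $w=v^n$ (which exists for sufficiently small $\tau$). *)

(* Defs.v *)
From HB Require Import structures.
From mathcomp Require Import all_boot all_order all_algebra.
From mathcomp Require Import complex.
From mathcomp Require Import all_classical all_reals all_analysis.

Set Implicit Arguments.
Unset Strict Implicit.
Unset Printing Implicit Defensive.

Import Order.TTheory GRing.Theory Num.Theory.
Import numFieldNormedType.Exports.

Local Open Scope classical_set_scope.
Local Open Scope complex_scope.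
Local Open Scope ring_scope.

(* Real-valued functions on R / 2 pi Z are 2 pi-periodic functions R -> R.
   They stand for their classes modulo a.e. equality: norms, multipliers and
   limits are all expressed through Fourier coefficients, so the choice of
   representative is immaterial. *)

Section Fourier.
Context {R : realType}.
Implicit Types (u w : R -> R) (k : int).

Definition expi (a : R) : R[i] := cos a +i* sin a.

Definition torus_mean u : R :=
  (pi *+ 2)^-1 * \int[lebesgue_measure]_(x in `[0, pi *+ 2]) u x.

(* The mean of u(x) e^{-ikx}, split into real and imaginary part. *)
Definition fourier u k : R[i] :=
  torus_mean (fun x => u x * cos (k%:~R * x))
    -i* torus_mean (fun x => u x * sin (k%:~R * x)).

Definition jbracket k : R := if k == 0 then 1 else `|k%:~R|.

(* The H^r norm, with value +oo when the series diverges. *)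
Definition Hnorm (r : R) u : \bar R :=
  sqrte (\esum_(k in [set: int])
    (jbracket k `^ (2 * r) * ComplexField.Normc.normc (fourier u k) ^+ 2)%:E).

(* u is a function on the torus in H^r with zero mean; r >= 0 is intended. *)
Definition in_Hdot (r : R) u : Prop :=
  [/\ periodic u (pi *+ 2),
      measurable_fun [set: R] u,
      lebesgue_measure.-integrable `[0, pi *+ 2] (fun x => (u x ^+ 2)%:E),
      fourier u 0 = 0
    & (Hnorm r u < +oo)%E].

(* The function x |-> \sum_k sigma k * fourier u k * e^{ikx} (symmetric partial
   sums). Its value is meaningful where the series converges, in particular
   whenever k |-> sigma k * fourier u k is absolutely summable, and it is real
   when sigma (- k) is the conjugate of sigma k, as for all symbols below. *)
Definition fmult (sigma : int -> R[i]) u : R -> R := fun x =>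
  lim ((fun N : nat => complex.Re (\sum_(j < N.*2.+1)
          (let k := j%:Z - N%:Z in
           sigma k * fourier u k * expi (k%:~R * x)))) @ \oo).

Definition dx : (R -> R) -> R -> R := fmult (fun k => 0 +i* k%:~R).

Definition dx_inv : (R -> R) -> R -> R :=
  fmult (fun k => if k == 0 then 0 else (0 +i* k%:~R)^-1).

(* exp(t dx^3), since (ik)^3 = - i k^3. *)
Definition airy (t : R) : (R -> R) -> R -> R :=
  fmult (fun k => expi (- (t * k%:~R ^+ 3))).

End Fourier.

Section TwistedKdV.
Context {R : realType}.

Definition twisted_rhs (t : R) (w : R -> R) : R -> R := fun x =>
  2^-1 * airy t (dx (fun y => airy (- t) w y ^+ 2)) x.

(* v takes values in zero-mean H^3 on [0, T], v(0) = u0, and the equation holds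
   at every t in [0, T], the time derivative being the limit in L^2 = H^0 of
   difference quotients (one-sided at 0 and T). *)
Definition twisted_kdv_solution (T : R) (u0 : R -> R) (v : R -> R -> R) : Prop :=
  [/\ forall t, 0 <= t <= T -> in_Hdot 3 (v t),
      v 0 = u0
    & forall t, 0 <= t <= T ->
        (fun s => Hnorm 0 (fun x => (s - t)^-1 * (v s x - v t x)
                                    - twisted_rhs t (v t) x))
          @ within `[0, T] t^' --> 0%E].

(* The map whose fixed point is v^{n+1}, where vn = v^n and t = t_n. *)
Definition midpoint_map (tau t : R) (vn w : R -> R) : R -> R := fun x =>
  vn x
  + 24^-1 * airy (t + tau)
      (fun y => airy (- (t + tau)) (dx_inv (w \+ vn)) y ^+ 2) x
  - 24^-1 * airy t
      (fun y => airy (- t) (dx_inv (w \+ vn)) y ^+ 2) x.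

(* v^{n+1} is the limit, in H^1, of the fixed-point iteration started at v^n. *)
Definition midpoint_iterates (tau : R) (u0 : R -> R) (vn : nat -> R -> R) : Prop :=
  vn 0%N = u0 /\
  forall n, in_Hdot 1 (vn n.+1) /\
    (fun j => Hnorm 1 (iter j (midpoint_map tau (n%:R * tau) (vn n)) (vn n)
                       \- vn n.+1)) @ \oo --> 0%E.

End TwistedKdV.

(* Main.v *)
Require Import Defs.
From mathcomp Require Import all_boot all_order all_algebra.
From mathcomp Require Import all_classical all_reals all_analysis.
From mathcomp Require Import complex zify ring lra measurable_realfun.

(* Everything takes place on Fourier coefficients. With k = i + j one has
   k^3 - i^3 - j^3 = 3 i j k, so the increment of the midpoint rule is the bilinear
   multiplier mB(i, j) = - (e^{-3 i (t + tau) i j k} - e^{-3 i t i j k}) / (24 i j) applied to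
   v^{n+1} + v^n; it satisfies |mB| <= 1/|i j| and |mB| <= tau |k|. The first bound
   gives smoothing from L^2 to H^1, interpolation gives smallness for small tau.
   Symmetrizing the trilinear form over i + j + l = 0, with weight 1/(i j) +
   1/(j l) + 1/(l i) = 0, shows that the L^2 norm of v^n is conserved; hence the
   fixed-point iteration contracts in L^2 at every step, for tau below a threshold
   depending on the radius only. For the error e^n = v(t_n) - v^n in H^1, the same symmetrization
   with weight l^2/(i j) + i^2/(l j) = (j^2 - 3 i l)/(- i l) compensates the loss of a
   derivative in the linear term, the quadratic term is O(sqrt tau) |E|^2 with
   E = e^n + e^{n+1} = O(sqrt tau), and the local error is O(tau^2), whence
   |e^{n+1}| <= (1 + C tau) |e^n| + C tau^2 as long as |e^n| <= sqrt tau. For tau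
   bounded below (in terms of T), smoothing alone bounds the boundedly many steps. *)

Set Implicit Arguments.
Unset Strict Implicit.
Unset Printing Implicit Defensive.

Import Order.TTheory GRing.Theory Num.Theory.
Import numFieldNormedType.Exports.

Local Open Scope classical_set_scope.
Local Open Scope ring_scope.

Local Notation normc := ComplexField.Normc.normc.

(** * Sums over the symmetric range of frequencies *)

(** The order of the quantifiers shapes the proof: the threshold for tau precedes T, so the
    existence of all iterates cannot be drawn from their closeness to the exact solution. A bound on
    v^n independent of n is needed in the space where the iteration contracts, and l^2 is such a
    space. It says nothing about h^1 directly, but the h^1 size of an increment depends on l^2 radii
    only, so the h^1 norm grows at most linearly in n. Symmetrization is carried out on finite sums
    with all three frequencies in [-N, N], a set of triples stable under permutations; no infinite
    series is rearranged. The increment is the coefficientwise limit N --> oo, with bounds uniform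
    in N: norm bounds pass to the limit as in Fatou's lemma, pairings by control of tails. In the
    error equation a difference of two squares becomes a bilinear term in E and V - E, where V is
    twice the sum of two exact values. Symmetrization moves up to three derivatives onto V, and the
    local error spends one derivative on the Lipschitz continuity of v in time and one on the
    equation itself: both use H^3. *)

Definition zrange (N : nat) : seq int := [seq j%:Z - N%:Z | j <- iota 0 N.*2.+1].

Lemma mem_zrange N (k : int) : (k \in zrange N) = (`|k| <= N)%N.
Proof.
apply/mapP/idP => [[j]|kN].
  by rewrite mem_iota => jN ->; lia.
by exists (absz (k + N%:Z)); [rewrite mem_iota; lia | lia].
Qed.

Lemma zrange_uniq N : uniq (zrange N).
Proof. by rewrite map_inj_uniq ?iota_uniq// => i j; lia. Qed.

Lemma zrange_oppr N : perm_eq [seq - k | k <- zrange N] (zrange N).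
Proof.
apply: uniq_perm; [|exact: zrange_uniq|].
  by rewrite map_inj_uniq ?zrange_uniq//; exact: oppr_inj.
move=> k; rewrite mem_zrange; apply/mapP/idP => [[j]|kN].
  by rewrite mem_zrange => jN ->; lia.
by exists (- k); [rewrite mem_zrange; lia | rewrite opprK].
Qed.

Lemma zrange_sub (V : nmodType) N M (F : int -> V) : (N <= M)%N ->
  \sum_(k <- zrange N) F k = \sum_(k <- zrange M | (`|k| <= N)%N) F k.
Proof.
move=> NM; rewrite -[RHS]big_filter; apply: perm_big; apply: uniq_perm.
- exact: zrange_uniq.
- by rewrite filter_uniq// zrange_uniq.
- by move=> k; rewrite mem_filter !mem_zrange; lia.
Qed.

Lemma zrange_diff (V : zmodType) N M (F : int -> V) : (N <= M)%N ->
  \sum_(k <- zrange M) F k - \sum_(k <- zrange N) F k =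
  \sum_(k <- zrange M | ~~ (`|k| <= N)%N) F k.
Proof.
move=> NM; rewrite (zrange_sub _ NM) [X in X - _](bigID (fun k => `|k| <= N)%N)/=.
by rewrite addrAC subrr add0r.
Qed.

Lemma sum_zrange_opp (V : nmodType) N (F : int -> V) :
  \sum_(k <- zrange N) F k = \sum_(k <- zrange N) F (- k).
Proof. by rewrite -(perm_big _ (zrange_oppr N)) big_map. Qed.

Lemma sum_zrangeS (V : nmodType) N (F : int -> V) :
  \sum_(k <- zrange N.+1) F k =
  \sum_(k <- zrange N) F k + (F N.+1%:Z + F (- N.+1%:Z)).
Proof.
have p : perm_eq (zrange N.+1) (zrange N ++ [:: N.+1%:Z; - N.+1%:Z]).
  apply: uniq_perm; first exact: zrange_uniq.
    rewrite cat_uniq zrange_uniq /= !mem_zrange.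
    by lia.
  by move=> k; rewrite mem_cat !mem_zrange !inE; lia.
by rewrite (perm_big _ p) big_cat !big_cons big_nil/= addr0.
Qed.

Lemma sum_uniq_delta (I : eqType) (V : nmodType) (s : seq I) (l : I) (F : I -> V) :
  uniq s ->
  \sum_(k <- s) (if k == l then F k else 0) = if l \in s then F l else 0.
Proof.
move=> us; case: ifPn => ls.
  rewrite (bigD1_seq l)//= eqxx big1 ?addr0// => i /negPf ->//.
by rewrite big1_seq// => i /andP[_ si]; case: eqP => // il; rewrite -il si in ls.
Qed.

Section Real.
Context {R : realType}.
Implicit Types (A B C F : int -> R).

Lemma le_sum_zrange N M F : (forall k, 0 <= F k) -> (N <= M)%N ->
  \sum_(k <- zrange N) F k <= \sum_(k <- zrange M) F k.
Proof.
move=> F0 NM; rewrite (zrange_sub _ NM) [leRHS](bigID (fun k => `|k| <= N)%N)/=.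
by rewrite lerDl sumr_ge0.
Qed.

(** Induction on the list: the tail sums are written as squares p^2 and q^2, and the planar
    inequality remains, whose defect is the square of [x i * q - p * y i]. *)
Lemma CauchySchwarz_seq (I : Type) (s : seq I) (x y : I -> R) a b :
  0 <= a -> 0 <= b ->
  \sum_(i <- s) x i ^+ 2 <= a ^+ 2 -> \sum_(i <- s) y i ^+ 2 <= b ^+ 2 ->
  \sum_(i <- s) x i * y i <= a * b.
Proof.
elim: s a b => [|i s IH] a b a0 b0; first by rewrite !big_nil => _ _; exact: mulr_ge0.
rewrite !big_cons => ha hb.
have X0 : 0 <= \sum_(j <- s) x j ^+ 2 by apply: sumr_ge0 => j _; exact: sqr_ge0.
have Y0 : 0 <= \sum_(j <- s) y j ^+ 2 by apply: sumr_ge0 => j _; exact: sqr_ge0.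
have hX : \sum_(j <- s) x j ^+ 2 <= Num.sqrt (\sum_(j <- s) x j ^+ 2) ^+ 2.
  by rewrite sqr_sqrtr.
have hY : \sum_(j <- s) y j ^+ 2 <= Num.sqrt (\sum_(j <- s) y j ^+ 2) ^+ 2.
  by rewrite sqr_sqrtr.
have hs := IH _ _ (sqrtr_ge0 _) (sqrtr_ge0 _) hX hY.
rewrite -(sqr_sqrtr X0) in ha; rewrite -(sqr_sqrtr Y0) in hb.
move: hs ha hb (sqrtr_ge0 (\sum_(j <- s) x j ^+ 2)) (sqrtr_ge0 (\sum_(j <- s) y j ^+ 2)).
set p := Num.sqrt _; set q := Num.sqrt _ => hs ha hb p0 q0.
apply: (le_trans (lerD (lexx _) hs)).
apply: le_trans (ler_norm _) _; rewrite -ler_sqr ?nnegrE ?mulr_ge0// real_normK ?num_real//.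
have h1 : (x i ^+ 2 + p ^+ 2) * (y i ^+ 2 + q ^+ 2) <= (a * b) ^+ 2.
  by rewrite exprMn; apply: ler_pM => //; apply: addr_ge0; exact: sqr_ge0.
apply: le_trans h1; rewrite -subr_ge0.
rewrite [X in 0 <= X](_ : _ = (x i * q - p * y i) ^+ 2) ?sqr_ge0//; ring.
Qed.

(* Young's convolution inequality l1 * l2 -> l2, paired with a third sequence *)
Lemma conv_bound r s t A B C a b c : uniq r -> uniq s -> uniq t ->
  0 <= b -> 0 <= c ->
  (forall k, 0 <= A k) -> (forall k, 0 <= B k) -> (forall k, 0 <= C k) ->
  \sum_(k <- r) A k <= a ->
  \sum_(k <- s) B k ^+ 2 <= b ^+ 2 -> \sum_(k <- t) C k ^+ 2 <= c ^+ 2 ->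
  \sum_(i <- r) \sum_(j <- s) \sum_(l <- t)
    (if l == i + j then A i * B j * C l else 0) <= a * b * c.
Proof.
move=> ur us ut b0 c0 A0 B0 C0 hA hB hC.
apply: (@le_trans _ _ (\sum_(i <- r) A i * (b * c))); last first.
  by rewrite -mulr_suml -mulrA ler_wpM2r// mulr_ge0.
apply: ler_sum => i _.
under eq_bigr => j _ do rewrite sum_uniq_delta//.
have -> : \sum_(j <- s) (if i + j \in t then A i * B j * C (i + j) else 0) =
    A i * \sum_(j <- s) B j * (if i + j \in t then C (i + j) else 0).
  rewrite mulr_sumr; apply: eq_bigr => j _; case: ifP => _; first by rewrite mulrA.
  by rewrite !mulr0.
rewrite ler_wpM2l//; apply: CauchySchwarz_seq => //.
apply: le_trans hC.
have -> : \sum_(j <- s) (if i + j \in t then C (i + j) else 0) ^+ 2 =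
   \sum_(j <- s) \sum_(l <- t) (if l == i + j then C l ^+ 2 else 0).
  apply: eq_bigr => j _; rewrite sum_uniq_delta//.
  by case: ifP => // _; rewrite expr0n.
rewrite exchange_big/=; apply: ler_sum => l _.
have -> : \sum_(j <- s) (if l == i + j then C l ^+ 2 else 0) =
    \sum_(j <- s) (if j == l - i then C l ^+ 2 else 0).
  by apply: eq_bigr => j _; congr (if _ then _ else _); apply/eqP/eqP; lia.
by rewrite (sum_uniq_delta _ (fun=> C l ^+ 2))//; case: ifP => // _; exact: sqr_ge0.
Qed.

(* The frequency k = 0 contributes 0 since 0^-1 = 0. *)
Lemma sum_inv_sqr N : \sum_(k <- zrange N) (`|k%:~R|^-1 : R) ^+ 2 <= 2 ^+ 2.
Proof.
(* The bound is strengthened to a telescoping one: 2 / (x + 1)^2 <= 2 / x - 2 / (x + 1). *)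
suff h n : \sum_(k <- zrange n.+1) (`|k%:~R|^-1 : R) ^+ 2 <= 4 - 2 / n.+1%:R.
  apply: le_trans (le_sum_zrange (M := N.+1) _ (leqnSn N)) _ => [k|]; first exact: sqr_ge0.
  by apply: le_trans (h N) _; rewrite expr2 -natrM lerBlDr lerDl.
elim: n => [|n IH].
  rewrite sum_zrangeS /zrange /= big_cons big_nil subrr mulrNz normrN !mulr0z.
  rewrite normr0 normr1 invr0 invr1 expr0n expr1n/=; lra.
rewrite sum_zrangeS; apply: le_trans (lerD IH (lexx _)) _.
rewrite mulrNz normrN -pmulrn normr_nat.
have -> : n.+2%:R = n.+1%:R + 1 :> R by rewrite -natr1.
have : 1 <= n.+1%:R :> R by rewrite ler1n.
move: (n.+1%:R : R) => x x1.
have x0 : 0 < x by lra.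
rewrite -subr_ge0.
have -> : 4 - 2 / (x + 1) - (4 - 2 / x + ((x + 1)^-1 ^+ 2 + (x + 1)^-1 ^+ 2)) =
   2 / (x * (x + 1) ^+ 2).
  by field; rewrite !lt0r_neq0//; lra.
by rewrite divr_ge0// mulr_ge0// ?sqr_ge0// ltW.
Qed.

Lemma sum_inv_bound F N c : 0 <= c -> \sum_(k <- zrange N) F k ^+ 2 <= c ^+ 2 ->
  \sum_(k <- zrange N) `|k%:~R|^-1 * F k <= 2 * c.
Proof. by move=> c0 hF; apply: CauchySchwarz_seq => //; exact: sum_inv_sqr. Qed.

End Real.


(** * Complex numbers *)

Section Complex.
Context {R : realType}.
Implicit Types (x y z : R[i]).

Lemma normc_ge0 x : 0 <= normc x.
Proof. by case: x => a b; exact: sqrtr_ge0. Qed.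

Lemma normcD x y : normc (x + y) <= normc x + normc y.
Proof. exact: (@le_normcD R x y). Qed.

Lemma normcN x : normc (- x) = normc x.
Proof. exact: (@normcN R x). Qed.

Lemma normcM x y : normc (x * y) = normc x * normc y.
Proof. exact: (ComplexField.Normc.normcM x y). Qed.

Lemma normcV x : normc x^-1 = (normc x)^-1.
Proof. exact: (ComplexField.Normc.normcV x). Qed.

Lemma normc0 : normc (0 : R[i]) = 0.
Proof. exact: ComplexField.Normc.normc0. Qed.

Lemma normc_eq0 x : normc x = 0 -> x = 0.
Proof. exact: ComplexField.Normc.eq0_normc. Qed.

Lemma normcB x y : normc (x - y) <= normc x + normc y.
Proof. by rewrite -(normcN y); exact: normcD. Qed.

Lemma normcR (a : R) : normc (a%:C)%C = `|a|.
Proof. by rewrite /= expr0n addr0 sqrtr_sqr. Qed.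

Lemma realCD (a b : R) : ((a + b)%:C = a%:C + b%:C)%C.
Proof. by rewrite rmorphD. Qed.

Lemma realCM (a b : R) : ((a * b)%:C = a%:C * b%:C)%C.
Proof. by rewrite rmorphM. Qed.

Lemma normcJ x : normc (x^*)%C = normc x.
Proof. by case: x => a b /=; rewrite sqrrN. Qed.

Lemma sqr_normc x : normc x ^+ 2 = complex.Re x ^+ 2 + complex.Im x ^+ 2.
Proof. by case: x => a b; rewrite sqr_sqrtr ?addr_ge0 ?sqr_ge0. Qed.

Lemma Re_le_normc x : `|complex.Re x| <= normc x.
Proof.
rewrite -ler_sqr ?nnegrE ?normc_ge0// real_normK ?num_real// sqr_normc.
by rewrite lerDl sqr_ge0.
Qed.

Lemma Im_le_normc x : `|complex.Im x| <= normc x.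
Proof.
rewrite -ler_sqr ?nnegrE ?normc_ge0// real_normK ?num_real// sqr_normc.
by rewrite lerDr sqr_ge0.
Qed.

Lemma normc_le_ReIm x : normc x <= `|complex.Re x| + `|complex.Im x|.
Proof.
rewrite -ler_sqr ?nnegrE ?normc_ge0 ?addr_ge0// sqr_normc sqrrD !real_normK ?num_real//.
by rewrite -addrA [_ *+ 2 + _]addrC addrA lerDl mulrn_wge0// mulr_ge0.
Qed.

Lemma normc_sum (I : Type) (s : seq I) (F : I -> R[i]) :
  normc (\sum_(i <- s) F i) <= \sum_(i <- s) normc (F i).
Proof.
elim: s => [|i s IH]; first by rewrite !big_nil normc0.
by rewrite !big_cons; apply: le_trans (normcD _ _) _; rewrite lerD2l.
Qed.

Lemma conjM x y : (x * y)^*%C = x^*%C * y^*%C.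
Proof. by rewrite rmorphM. Qed.

Lemma conj_sum (I : Type) (s : seq I) (F : I -> R[i]) :
  (\sum_(i <- s) F i)^*%C = \sum_(i <- s) (F i)^*%C.
Proof. by rewrite rmorph_sum. Qed.

Lemma ReD x y : complex.Re (x + y) = complex.Re x + complex.Re y.
Proof. by case: x y => [a b] [c d]. Qed.

Lemma ReB x y : complex.Re (x - y) = complex.Re x - complex.Re y.
Proof. by case: x y => [a b] [c d]. Qed.

Lemma ReM_real (a : R) x : complex.Re ((a%:C)%C * x) = a * complex.Re x.
Proof. by case: x => b c /=; rewrite mul0r subr0. Qed.

Lemma Re_sum (I : Type) (s : seq I) (F : I -> R[i]) :
  complex.Re (\sum_(i <- s) F i) = \sum_(i <- s) complex.Re (F i).
Proof. by apply: (big_morph _ ReD). Qed.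

(** Source of both energy identities: an increment y - x is paired with the sum y + x, which is
    exactly the argument of the bilinear term in the midpoint rule. *)
Lemma sqr_normcB x y :
  normc y ^+ 2 - normc x ^+ 2 = complex.Re ((y - x) * (y + x)^*%C).
Proof. by rewrite !sqr_normc; case: x y => [a b] [c d] /=; ring. Qed.

Lemma Re_mulJ x : complex.Re (x * x^*%C) = normc x ^+ 2.
Proof. by rewrite sqr_normc; case: x => a b /=; ring. Qed.

End Complex.

(** * Limits of complex sequences, through the real-valued modulus *)

Section ComplexLimits.
Context {R : realType}.
Implicit Types (x y : nat -> R[i]) (c l m : R[i]) (e : nat -> R).

Definition cvgC x l := normc (x n - l) @[n --> \oo] --> (0 : R).

Lemma cvgC_squeeze (x : nat -> R[i]) l (e : nat -> R) :
  (forall n, normc (x n - l) <= e n) -> e @ \oo --> (0 : R) -> cvgC x l.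
Proof.
move=> xe e0; apply: (squeeze_cvgr _ (cvg_cst 0) e0).
by apply: nearW => n; rewrite normc_ge0 xe.
Qed.

Lemma cvgC_cst l : cvgC (fun=> l) l.
Proof. by rewrite /cvgC subrr normc0; exact: cvg_cst. Qed.

Lemma cvgCD x y l m : cvgC x l -> cvgC y m -> cvgC (fun n => x n + y n) (l + m).
Proof.
move=> xl ym.
apply: (@cvgC_squeeze _ _ (fun n => normc (x n - l) + normc (y n - m))).
  move=> n.
  have -> : x n + y n - (l + m) = x n - l + (y n - m) by ring.
  exact: normcD.
by rewrite -[X in _ --> X](addr0 0); exact: cvgD.
Qed.

Lemma cvgCM c x l : cvgC x l -> cvgC (fun n => c * x n) (c * l).
Proof.
move=> xl; apply: (@cvgC_squeeze _ _ (fun n => normc c * normc (x n - l))).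
  by move=> n; rewrite -mulrBr normcM.
by rewrite -[X in _ --> X](mulr0 (normc c)); apply: cvgM => //; exact: cvg_cst.
Qed.

Lemma cvgCN x l : cvgC x l -> cvgC (fun n => - x n) (- l).
Proof.
move=> /(@cvgCM (-1)); rewrite mulN1r /cvgC.
by under eq_fun do rewrite mulN1r.
Qed.

Lemma cvgCB x y l m : cvgC x l -> cvgC y m -> cvgC (fun n => x n - y n) (l - m).
Proof. by move=> xl ym; apply: cvgCD => //; exact: cvgCN. Qed.

Lemma cvgC_Re x l : cvgC x l -> complex.Re (x n) @[n --> \oo] --> complex.Re l.
Proof.
move=> xl; apply/cvgrPdist_lt => e e0.
have /cvgrPdist_lt/(_ e e0) := xl; apply: filterS => n.
rewrite sub0r normrN ger0_norm ?normc_ge0// => h.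
by rewrite distrC -ReB; apply: le_lt_trans (Re_le_normc _) _.
Qed.

Lemma cvgC_normc x l : cvgC x l -> normc (x n) @[n --> \oo] --> normc l.
Proof.
move=> xl; apply/cvgrPdist_lt => e e0.
have /cvgrPdist_lt/(_ e e0) := xl; apply: filterS => n.
rewrite sub0r normrN ger0_norm ?normc_ge0// => h.
apply: le_lt_trans h; have h1 := normcB (x n) (x n - l); have h2 := normcD l (x n - l).
rewrite distrC ler_norml; move: h1 h2; rewrite subKr (addrC l) subrK.
by move=> h1 h2; apply/andP; split; lra.
Qed.

Lemma cvgC_unique x l m : cvgC x l -> cvgC x m -> l = m.
Proof.
move=> xl xm; apply/eqP; rewrite -subr_eq0; apply/eqP/normc_eq0.
have h : cvgC (fun=> 0 : R[i]) (l - m).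
  have := cvgCB xl xm; rewrite /cvgC.
  by under eq_fun do rewrite subrr.
have := cvg_unique _ (cvgC_normc h) (cvg_cst (normc 0)); rewrite normc0.
by apply; exact: norm_hausdorff.
Qed.

End ComplexLimits.


(** * Weighted norms of Fourier coefficients *)

Section Norms.
Context {R : realType}.
Implicit Types (a b f g h : int -> R[i]) (r s M N : nat) (K L : R).

Lemma cvg_sum_seq (I : Type) (t : seq I) (F : nat -> I -> R) (G : I -> R) :
  (forall i, F n i @[n --> \oo] --> G i) ->
  (\sum_(i <- t) F n i) @[n --> \oo] --> \sum_(i <- t) G i.
Proof.
move=> FG; elim: t => [|i t IH].
  by rewrite big_nil; under eq_fun do rewrite big_nil; exact: cvg_cst.
by rewrite big_cons; under eq_fun do rewrite big_cons; exact: cvgD.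
Qed.

(* Truncated square of the H^r norm; for r > 0 the weight |k|^r ignores the mean. *)
Definition hs r a M : R := \sum_(k <- zrange M) (`|k%:~R| ^+ r * normc (a k)) ^+ 2.

(** Norms are handled by explicit upper bounds: uniformity in the truncation replaces convergence of
    the series, and K >= 0 allows squares to be compared. *)
Definition bnd r a K : Prop := 0 <= K /\ forall M, hs r a M <= K ^+ 2.

Definition pr r a h M : R :=
  \sum_(k <- zrange M) `|k%:~R| ^+ r.*2 * complex.Re (a k * (h k)^*%C).

Lemma term_ge0 r (k : int) (z : R[i]) : 0 <= `|k%:~R : R| ^+ r * normc z.
Proof. by rewrite mulr_ge0 ?exprn_ge0 ?normc_ge0. Qed.

Lemma hs_ge0 r a M : 0 <= hs r a M.
Proof. by apply: sumr_ge0 => k _; exact: sqr_ge0. Qed.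

Lemma le_hs r a M N : (M <= N)%N -> hs r a M <= hs r a N.
Proof. by apply: le_sum_zrange => k; exact: sqr_ge0. Qed.

Lemma bndW r a K L : K <= L -> bnd r a K -> bnd r a L.
Proof.
move=> KL [K0 h]; split; first exact: le_trans KL.
by move=> M; apply: le_trans (h M) _; rewrite ler_sqr ?nnegrE// (le_trans K0).
Qed.

Lemma bnd_le r s a b K :
  (forall k : int, `|k%:~R : R| ^+ r * normc (b k) <= `|k%:~R| ^+ s * normc (a k)) ->
  bnd s a K -> bnd r b K.
Proof.
move=> ba [K0 h]; split=> // M; apply: le_trans (h M).
apply: ler_sum => k _; rewrite ler_sqr ?nnegrE ?term_ge0//; exact: ba.
Qed.

(** Nonzero integers have modulus at least 1. The mean must vanish because the weight at 0 is 1 for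
    exponent 0 and 0 for positive exponents. *)
Lemma bnd_lower r s a K : (r <= s)%N -> a 0 = 0 -> bnd s a K -> bnd r a K.
Proof.
move=> rs a0; apply: bnd_le => k; have [->|k0] := eqVneq k 0.
  by rewrite a0 normc0 !mulr0.
rewrite ler_wpM2r ?normc_ge0// ler_weXn2l// -intr_norm ler1z; lia.
Qed.

Lemma bnd_ext r a b K : (forall k, a k = b k) -> bnd r a K -> bnd r b K.
Proof. by move=> ab; apply: bnd_le => k; rewrite ab. Qed.

Lemma bndD r a b K L : bnd r a K -> bnd r b L -> bnd r (fun k => a k + b k) (K + L).
Proof.
move=> [K0 hK] [L0 hL]; split=> [|M]; first exact: addr_ge0.
apply: (@le_trans _ _ (\sum_(k <- zrange M)
   (`|k%:~R| ^+ r * normc (a k) + `|k%:~R| ^+ r * normc (b k)) ^+ 2)).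
  apply: ler_sum => k _; rewrite ler_sqr ?nnegrE ?addr_ge0 ?term_ge0//.
  by rewrite -mulrDr ler_wpM2l ?exprn_ge0// normcD.
under eq_bigr => k _ do rewrite sqrrD.
rewrite big_split big_split/= sumrMnl sqrrD.
apply: lerD (hL M); apply: lerD (hK M) _; rewrite lerMn2r/=.
exact: CauchySchwarz_seq K0 L0 (hK M) (hL M).
Qed.

Lemma bndZ r c a K : bnd r a K -> bnd r (fun k => c * a k) (normc c * K).
Proof.
move=> [K0 h]; split=> [|M]; first by rewrite mulr_ge0 ?normc_ge0.
rewrite exprMn; apply: le_trans (ler_wpM2l (sqr_ge0 _) (h M)).
by rewrite mulr_sumr; apply: ler_sum => k _; rewrite normcM mulrCA exprMn.
Qed.

Lemma bndN r a K : bnd r a K -> bnd r (fun k => - a k) K.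
Proof. by apply: bnd_le => k; rewrite normcN. Qed.

Lemma bndB r a b K L : bnd r a K -> bnd r b L -> bnd r (fun k => a k - b k) (K + L).
Proof. by move=> hK /bndN; exact: bndD. Qed.

Lemma bnd_pt r a K (k : int) : bnd r a K -> `|k%:~R| ^+ r * normc (a k) <= K.
Proof.
move=> [K0 h]; rewrite -ler_sqr ?nnegrE ?term_ge0//; apply: le_trans (h `|k|%N).
rewrite /hs (bigD1_seq k) ?zrange_uniq//= ?mem_zrange//.
by rewrite lerDl sumr_ge0// => i _; exact: sqr_ge0.
Qed.

Lemma bnd0_normc a K k : bnd 0 a K -> normc (a k) <= K.
Proof. by move=> /(bnd_pt k); rewrite expr0 mul1r. Qed.

(** Sobolev embedding on the coefficient side: one power of |k| is traded for the square summable
    1/|k|. *)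
Lemma bnd_sum r a K N : a 0 = 0 -> bnd r.+1 a K ->
  \sum_(k <- zrange N) `|k%:~R| ^+ r * normc (a k) <= 2 * K.
Proof.
move=> a0 [K0 h]; apply: le_trans (sum_inv_bound K0 (h N)).
apply: ler_sum => k _; have [->|k0] := eqVneq k 0.
  by rewrite a0 normc0 !mulr0.
by rewrite exprS -mulrA mulKf// normr_eq0 intr_eq0.
Qed.

Lemma bnd_sum_inv a K N : bnd 0 a K ->
  \sum_(k <- zrange N) `|k%:~R|^-1 * normc (a k) <= 2 * K.
Proof.
move=> [K0 h]; apply: (sum_inv_bound K0); apply: le_trans (h N).
by apply: ler_sum => k _; rewrite expr0 mul1r.
Qed.

(** A form of Fatou's lemma: each truncated norm is a finite sum, hence continuous under
    coefficientwise convergence. *)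
Lemma bnd_lim r (Q : nat -> int -> R[i]) b K :
  (forall k, cvgC (Q ^~ k) (b k)) -> (forall N, bnd r (Q N) K) -> bnd r b K.
Proof.
move=> Qb h; split=> [|M]; first by have [] := h 0%N.
have c : hs r (Q N) M @[N --> \oo] --> hs r b M.
  apply: cvg_sum_seq => k; apply: cvgM; apply: cvgM;
    by [exact: cvg_cst | exact: cvgC_normc].
apply: (@cvgr_to_le _ _ _ _ _ _ _ c).
by apply: nearW => N; have [_] := h N; exact.
Qed.

Lemma hsB r a b M : hs r b M - hs r a M = pr r (fun k => b k - a k) (fun k => b k + a k) M.
Proof.
rewrite /hs /pr -sumrB; apply: eq_bigr => k _.
by rewrite !exprMn -mulrBr sqr_normcB -exprM muln2.
Qed.

Lemma pr_self r a M : pr r a a M = hs r a M.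
Proof.
by apply: eq_bigr => k _; rewrite exprMn Re_mulJ -exprM muln2.
Qed.

Lemma prDl r a b h M : pr r (fun k => a k + b k) h M = pr r a h M + pr r b h M.
Proof.
by rewrite /pr -big_split; apply: eq_bigr => k _; rewrite mulrDl ReD mulrDr.
Qed.

Lemma prBl r a b h M : pr r (fun k => a k - b k) h M = pr r a h M - pr r b h M.
Proof.
by rewrite /pr -sumrB; apply: eq_bigr => k _; rewrite mulrBl ReB mulrBr.
Qed.

Lemma eq_pr r a b h g M : (forall k, a k = b k) -> (forall k, h k = g k) ->
  pr r a h M = pr r b g M.
Proof. by move=> ab hg; apply: eq_bigr => k _; rewrite ab hg. Qed.

Lemma pr_le_seq (t : seq int) r a h K L : 0 <= K -> 0 <= L ->
  \sum_(k <- t) (`|k%:~R| ^+ r * normc (a k)) ^+ 2 <= K ^+ 2 ->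
  \sum_(k <- t) (`|k%:~R| ^+ r * normc (h k)) ^+ 2 <= L ^+ 2 ->
  \sum_(k <- t) `|k%:~R| ^+ r.*2 * complex.Re (a k * (h k)^*%C) <= K * L.
Proof.
move=> K0 L0 hK hL; apply: le_trans (CauchySchwarz_seq K0 L0 hK hL).
apply: ler_sum => k _; rewrite -addnn exprD mulrACA ler_wpM2l ?mulr_ge0 ?exprn_ge0//.
by apply: le_trans (ler_norm _) _; apply: le_trans (Re_le_normc _) _; rewrite normcM normcJ.
Qed.

Lemma pr_le r a h K L M : bnd r a K -> bnd r h L -> pr r a h M <= K * L.
Proof. by move=> [K0 hK] [L0 hL]; exact: (pr_le_seq K0 L0 (hK M) (hL M)). Qed.

(** From s^2 <= K s follows s <= K. A norm bound is thereby reduced to a bound on the pairing of [a]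
    with itself, where trilinear estimates apply. *)
Lemma bnd_dual r a K : 0 <= K -> (forall M, hs r a M <= K * Num.sqrt (hs r a M)) -> bnd r a K.
Proof.
move=> K0 h; split=> // M; have := h M; have := sqr_sqrtr (hs_ge0 r a M).
move: (Num.sqrt _) (sqrtr_ge0 (hs r a M)) => s s0 <-.
have [->|sn0] := eqVneq s 0; first by move=> _; rewrite expr0n sqr_ge0.
by rewrite expr2 ler_pM2r ?lt_def ?sn0// => sK; rewrite expr2; apply: ler_pM.
Qed.

Lemma bnd_tail r h L (d : R) : bnd r h L -> 0 < d ->
  exists M0, forall M N, (M0 <= M)%N -> (M <= N)%N -> hs r h N - hs r h M <= d.
Proof.
move=> [L0 hL] d0.
pose S := range (hs r h).
have hS : has_sup S.
  split; first by exists (hs r h 0), 0%N.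
  by exists (L ^+ 2) => _ [M _ <-]; exact: hL.
have [_ [M0 _ <-] hM0] := sup_adherent d0 hS.
exists M0 => M N M0M MN; rewrite lerBlDl -lerBlDr.
have hN : hs r h N <= sup S by apply: sup_upper_bound => //; exists N.
have := le_hs r h M0M; move: hM0 hN; rewrite -/S; lra.
Qed.

(* The pairing of the limit b with h is controlled although Q N --> b only
   coefficientwise: the tail of h absorbs the lack of uniformity. *)
Lemma pairing_lim r (Q : nat -> int -> R[i]) b h K L X (e : R) :
  (forall k, cvgC (Q ^~ k) (b k)) -> (forall N, bnd r (Q N) K) -> bnd r h L ->
  (forall N, pr r (Q N) h N <= X) -> 0 < e ->
  exists M0, forall M, (M0 <= M)%N -> pr r b h M <= X + e.
Proof.
move=> Qb hQ hh hX e0.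
have K0 : 0 <= K by have [] := hQ 0%N.
(* The tail of h beyond M will have norm at most d and cost at most K d <= e; the added 1 covers K =
   0. *)
pose d := e / (K + 1).
have d0 : 0 < d by rewrite divr_gt0// ltr_wpDl.
have [M0 hM0] := bnd_tail hh (exprn_gt0 2 d0).
exists M0 => M M0M.
have c : pr r (Q N) h M @[N --> \oo] --> pr r b h M.
  apply: cvg_sum_seq => k; apply: cvgM; first exact: cvg_cst.
  apply: cvgC_Re; rewrite /cvgC.
  under eq_fun => n do rewrite mulrC [b k * _]mulrC.
  exact: cvgCM.
apply: (@cvgr_to_le _ _ _ _ _ _ _ c).
exists M => // N /= MN.
(* For N >= M the fixed truncation M is the full pairing at level N, bounded by X, minus the
   frequencies between M and N, which meet only the tail of h. *)
have -> : pr r (Q N) h M = pr r (Q N) h N -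
    \sum_(k <- zrange N | ~~ (`|k| <= M)%N) `|k%:~R| ^+ r.*2 * complex.Re (Q N k * (h k)^*%C).
  by rewrite /pr (zrange_sub _ MN) [X in X - _](bigID (fun k => `|k| <= M)%N)/= addrK.
apply: lerD (hX N) _; rewrite lerNl.
apply: (@le_trans _ _ (- (K * d))).
  rewrite lerN2 /d mulrA ler_pdivrMr ?ltr_wpDl//.
  by rewrite mulrDr mulr1 mulrC lerDl ltW.
rewrite lerNl -sumrN -big_filter.
have -> : \sum_(k <- [seq k <- zrange N | ~~ (`|k| <= M)%N])
    - (`|k%:~R| ^+ r.*2 * complex.Re (Q N k * (h k)^*%C)) =
    \sum_(k <- [seq k <- zrange N | ~~ (`|k| <= M)%N])
    `|k%:~R| ^+ r.*2 * complex.Re (- Q N k * (h k)^*%C).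
  apply: eq_bigr => k _; rewrite -mulrN mulNr.
  by congr (_ * _); case: (Q N k * _).
apply: pr_le_seq (ltW d0) _ _ => //.
  rewrite big_filter; have [_ /(_ N)] := hQ N; apply: le_trans.
  rewrite /hs [leRHS](bigID (fun k => `|k| <= M)%N)/=.
  under [X in _ <= _ + X]eq_bigr do rewrite -normcN.
  by rewrite lerDr sumr_ge0// => i _; exact: sqr_ge0.
rewrite big_filter; apply: le_trans (hM0 M N M0M MN).
by rewrite /hs (zrange_sub _ MN) [X in _ <= X - _](bigID (fun k => `|k| <= M)%N)/= addrAC subrr add0r.
Qed.

End Norms.

(** * The phase factors *)

Section Phase.
Context {R : realType}.
Implicit Types (a b : R).

Lemma expiD a b : expi (a + b) = expi a * expi b.
Proof.
rewrite /expi cosD sinD; apply/eqP; rewrite eq_complex /= eqxx/= .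
by rewrite addrC.
Qed.

Lemma expiJ a : (expi a)^*%C = expi (- a).
Proof. by rewrite /expi cosN sinN. Qed.

Lemma normc_expi a : normc (expi a) = 1.
Proof. by rewrite /= cos2Dsin2 sqrtr1. Qed.

Lemma lip_of_derive (f df : R -> R) a b :
  (forall x : R, is_derive x 1 f (df x)) -> (forall x, `|df x| <= 1) ->
  `|f b - f a| <= `|b - a|.
Proof.
move=> hf hd; wlog ab : a b / a <= b.
  move=> H; have [/H//|/ltW /H] := leP a b.
  by rewrite distrC [`|b - a|]distrC.
have cf : {within `[a, b], continuous f}.
  by apply: derivable_within_continuous => x _; have [] := hf x.
have [c _ ->] := MVT_segment ab (fun x _ => hf x) cf.
by rewrite normrM ler_piMl.
Qed.

Lemma cos_lip a b : `|cos b - cos a| <= `|b - a|.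
Proof.
by apply: (@lip_of_derive _ (fun x => - sin x)) => x; rewrite normrN sin_max.
Qed.

Lemma sin_lip a b : `|sin b - sin a| <= `|b - a|.
Proof. by apply: (@lip_of_derive _ cos) => x; rewrite cos_max. Qed.

Lemma normc_expiB a b : normc (expi b - expi a) <= 2 * `|b - a|.
Proof.
apply: le_trans (normc_le_ReIm _) _; rewrite mulr_natl mulr2n.
by apply: lerD; [exact: cos_lip | exact: sin_lip].
Qed.

Lemma normc_expiB_le2 a b : normc (expi b - expi a) <= 2.
Proof. by apply: le_trans (normcB _ _) _; rewrite !normc_expi. Qed.

(** Evenness reduces to b >= 0; the mean value theorem gives a factor b, and the Lipschitz bound on
    the derivative a second one. *)
Lemma cos_taylor a : `|cos a - 1| <= a ^+ 2.
Proof.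
suff h b : 0 <= b -> `|cos b - 1| <= b ^+ 2.
  by rewrite -cos_norm -real_normK ?num_real//; exact: h.
rewrite le_eqVlt => /predU1P[<-|b0]; first by rewrite cos0 subrr normr0 expr0n.
have cf : {within `[0, b], continuous (@cos R)}.
  by apply: continuous_subspaceT; exact: continuous_cos.
have [c] := MVT b0 (fun x _ => is_derive_cos x) cf.
rewrite in_itv/= => /andP[c0 cb]; rewrite cos0 subr0 => ->.
rewrite normrM normrN (gtr0_norm b0) expr2 ler_wpM2r ?(ltW b0)//.
have := sin_lip 0 c; rewrite sin0 !subr0 (gtr0_norm c0); lra.
Qed.

Lemma sin_taylor a : `|sin a - a| <= a ^+ 2.
Proof.
suff h b : 0 <= b -> `|sin b - b| <= b ^+ 2.
  have [/h//|/ltW a0] := leP 0 a.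
  have := h (- a); rewrite sqrrN sinN oppr_ge0 -opprB normrN opprK addrC.
  by apply.
rewrite le_eqVlt => /predU1P[<-|b0]; first by rewrite sin0 subrr normr0 expr0n.
have hf (x : R) : is_derive x 1 (sin - id) (cos x - 1) by exact: is_deriveB.
have cf : {within `[0, b], continuous (@sin R - id)}.
  by apply: derivable_within_continuous => x _; have [] := hf x.
have [c] := MVT b0 (fun x _ => hf x) cf.
rewrite in_itv/= !fctE sin0 !subr0 => /andP[c0 cb] ->.
rewrite normrM (gtr0_norm b0) expr2 ler_wpM2r ?(ltW b0)//.
have := cos_lip 0 c; rewrite cos0 !subr0 (gtr0_norm c0); lra.
Qed.

Lemma expi_taylor a : normc (expi a - 1 - (0 +i* a)%C) <= 2 * a ^+ 2.
Proof.
apply: le_trans (normc_le_ReIm _) _; rewrite mulr_natl mulr2n /= !subr0.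
by apply: lerD; [exact: cos_taylor | exact: sin_taylor].
Qed.

End Phase.

(** * Bilinear Fourier multipliers *)

Section Bilinear.
Context {R : realType}.
Implicit Types (f g h : int -> R[i]) (m : int -> int -> R[i]) (r N M : nat) (F G : R).

(* Truncated to frequencies at most N; the operators of the paper are the
   coefficientwise limits as N --> oo. *)
Definition Qb N m f g (k : int) : R[i] :=
  \sum_(i <- zrange N) \sum_(j <- zrange N)
    (if k == i + j then m i j * f i * g j else 0).

Lemma QbBr N m f g g' k :
  Qb N m f (fun i => g i - g' i) k = Qb N m f g k - Qb N m f g' k.
Proof.
rewrite /Qb -sumrB; apply: eq_bigr => i _; rewrite -sumrB; apply: eq_bigr => j _.
by case: eqP => _; [rewrite mulrBr | rewrite subr0].
Qed.

Lemma QbBm N m m' f g k :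
  Qb N (fun i j => m i j - m' i j) f g k = Qb N m f g k - Qb N m' f g k.
Proof.
rewrite /Qb -sumrB; apply: eq_bigr => i _; rewrite -sumrB; apply: eq_bigr => j _.
by case: eqP => _; [rewrite !mulrBl | rewrite subr0].
Qed.

Lemma Qb_ext N m m' f f' g g' k :
  (forall i j, k = i + j -> m i j * f i * g j = m' i j * f' i * g' j) ->
  Qb N m f g k = Qb N m' f' g' k.
Proof.
move=> H; apply: eq_bigr => i _; apply: eq_bigr => j _.
by case: eqP => // /H ->.
Qed.

Lemma QbZ N (c : R[i]) m f g k : c * Qb N m f g k = Qb N (fun i j => c * m i j) f g k.
Proof.
rewrite mulr_sumr; apply: eq_bigr => i _; rewrite mulr_sumr; apply: eq_bigr => j _.
by case: eqP => _; rewrite ?mulr0// !mulrA.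
Qed.

(** The cross terms cancel by symmetry of m. Every difference of two increments is estimated in this
    factored form. *)
Lemma Qb_polar N m f g k : (forall i j, m i j = m j i) ->
  Qb N m f f k - Qb N m g g k = Qb N m (fun i => f i - g i) (fun i => f i + g i) k.
Proof.
move=> msym.
have sw : Qb N m f g k = Qb N m g f k.
  rewrite /Qb exchange_big; apply: eq_bigr => i _; apply: eq_bigr => j _ /=.
  by rewrite addrC; case: eqP => // _; rewrite msym mulrAC.
have -> : Qb N m f f k - Qb N m g g k =
  (Qb N m f f k + Qb N m f g k) - (Qb N m g f k + Qb N m g g k) by rewrite sw; ring.
rewrite /Qb -!big_split -sumrB; apply: eq_bigr => i _ /=.
rewrite -!big_split -sumrB; apply: eq_bigr => j _ /=.
by case: eqP => _; [ring | rewrite !addr0 subr0].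
Qed.

(** Common source of the bilinear bounds. By duality the norm becomes a trilinear sum; the two
    summands of the majorant correspond to the two ways of putting one factor in l^1 and the other
    in l^2. *)
Lemma Qb_bound r m f g N (A B A' B' : int -> R) a b a' b' :
  (forall k, 0 <= A k) -> (forall k, 0 <= B k) ->
  (forall k, 0 <= A' k) -> (forall k, 0 <= B' k) ->
  0 <= a -> 0 <= b -> 0 <= a' -> 0 <= b' ->
  (\sum_(k <- zrange N) A k <= a) -> (\sum_(k <- zrange N) B k ^+ 2 <= b ^+ 2) ->
  (\sum_(k <- zrange N) A' k <= a') -> (\sum_(k <- zrange N) B' k ^+ 2 <= b' ^+ 2) ->
  (forall i j, `|(i + j)%:~R| ^+ r * (normc (m i j) * normc (f i) * normc (g j)) <=
     A i * B j + B' i * A' j) ->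
  bnd r (Qb N m f g) (a * b + a' * b').
Proof.
move=> A0 B0 A'0 B'0 a0 b0 a'0 b'0 hA hB hA' hB' H.
apply: bnd_dual => [|M]; first by rewrite addr_ge0// mulr_ge0.
set c := Num.sqrt _.
have hc : hs r (Qb N m f g) M <= c ^+ 2 by rewrite sqr_sqrtr// hs_ge0.
pose C l := `|l%:~R| ^+ r * normc (Qb N m f g l).
have C0 l : 0 <= C l by exact: term_ge0.
have c0 : 0 <= c by exact: sqrtr_ge0.
have u := zrange_uniq.
have h1 := conv_bound (u N) (u N) (u M) b0 c0 A0 B0 C0 hA hB hc.
have h2 := conv_bound (u N) (u N) (u M) b'0 c0 A'0 B'0 C0 hA' hB' hc.
rewrite mulrDl; apply: le_trans (lerD h1 h2).
rewrite [X in _ <= _ + X]exchange_big -big_split/=.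
under [leRHS]eq_bigr => i _.
  rewrite -big_split/=; under eq_bigr => j _.
    rewrite -big_split/=.
    under eq_bigr => l _ do rewrite [j + i]addrC.
    over.
  over.
under [leRHS]eq_bigr do rewrite exchange_big.
rewrite exchange_big /hs; apply: ler_sum => l _ /=.
have hC : C l <= \sum_(i <- zrange N) \sum_(j <- zrange N)
    (if l == i + j then A i * B j + B' i * A' j else 0).
  rewrite /C; apply: le_trans (ler_wpM2l (exprn_ge0 _ (normr_ge0 _)) (normc_sum _ _)) _.
  rewrite mulr_sumr; apply: ler_sum => i _.
  apply: le_trans (ler_wpM2l (exprn_ge0 _ (normr_ge0 _)) (normc_sum _ _)) _.
  rewrite mulr_sumr; apply: ler_sum => j _.
  case: eqP => [->|_]; last by rewrite normc0 mulr0.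
  by rewrite !normcM; exact: H.
rewrite expr2; apply: le_trans (ler_wpM2r (C0 l) hC) _.
rewrite mulr_suml; apply: ler_sum => i _.
rewrite mulr_suml; apply: ler_sum => j _.
case: eqP => _; last by rewrite mul0r addr0.
by rewrite mulrDl [A' j * _]mulrC.
Qed.

End Bilinear.

(** * Estimates for the multipliers of the scheme *)

Section Multipliers.
Context {R : realType}.
Implicit Types (f g h : int -> R[i]) (r p N M : nat) (F G s t tau eps : R) (i j l : int).

Local Notation za k := (`|k%:~R : R|).

(* mG s is the multiplier of w |-> (1/24) e^{s dx^3} (e^{-s dx^3} dx^-1 w)^2, and
   mP s that of the right-hand side (1/2) e^{s dx^3} dx (e^{-s dx^3} w)^2. *)
Definition ph s i j : R[i] := expi (- (s * (3 * (i%:~R * j%:~R * (i + j)%:~R)))).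

Definition mG s i j : R[i] := ((- (24 * (i%:~R * j%:~R))^-1)%:C)%C * ph s i j.

Definition mB t tau i j : R[i] := mG (t + tau) i j - mG t i j.

Definition mP s i j : R[i] := (0 +i* ((i + j)%:~R / 2))%C * ph s i j.

Lemma za_ge1 i : i != 0 -> 1 <= za i.
Proof. by move=> i0; rewrite -intr_norm ler1z; lia. Qed.

Lemma zaD i j : za (i + j) <= za i + za j.
Proof. by rewrite intrD ler_normD. Qed.

Lemma ph_sym s i j : ph s i j = ph s j i.
Proof. by rewrite /ph addrC [X in 3 * (X * _)]mulrC. Qed.

Lemma mG_sym s i j : mG s i j = mG s j i.
Proof. by rewrite /mG ph_sym mulrC [_ * i%:~R]mulrC mulrC. Qed.

Lemma mB_sym t tau i j : mB t tau i j = mB t tau j i.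
Proof. by rewrite /mB !(mG_sym _ i j). Qed.

Lemma mP_sym s i j : mP s i j = mP s j i.
Proof. by rewrite /mP ph_sym addrC. Qed.

Lemma normc_phB s t i j : normc (ph s i j - ph t i j) <= 6 * `|s - t| * (za i * za j * za (i + j)).
Proof.
apply: le_trans (normc_expiB _ _) _; rewrite le_eqVlt; apply/orP; left; apply/eqP.
rewrite -!normrM -[6]ger0_norm// -[2]ger0_norm// -!normrM.
rewrite -normrN; congr (`|_|); ring.
Qed.

Lemma mBE t tau i j : mB t tau i j =
  ((- (24 * (i%:~R * j%:~R))^-1)%:C)%C * (ph (t + tau) i j - ph t i j).
Proof. by rewrite /mB /mG mulrBr. Qed.

Lemma normc_mB t tau i j : normc (mB t tau i j) =
  24^-1 * (za i)^-1 * (za j)^-1 * normc (ph (t + tau) i j - ph t i j).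
Proof.
rewrite mBE normcM normcR normrN normfV !normrM ger0_norm// !invfM.
by rewrite !mulrA.
Qed.

Lemma mB_le1 t tau i j : normc (mB t tau i j) <= (za i)^-1 * (za j)^-1.
Proof.
rewrite normc_mB; have := normc_expiB_le2 (- (t * (3 * (i%:~R * j%:~R * (i + j)%:~R))))
  (- ((t + tau) * (3 * (i%:~R * j%:~R * (i + j)%:~R)))).
rewrite -/(ph _ _ _) -/(ph _ _ _).
have : 0 <= (za i)^-1 * (za j)^-1 by rewrite mulr_ge0 ?invr_ge0.
rewrite -[24^-1 * _ * _]mulrA; move: (_ / _) (normc _) => x y x0 y2.
have : x * y <= x * 2 by rewrite ler_wpM2l.
have -> : 24^-1 * x * y = 24^-1 * (x * y) by ring.
lra.
Qed.

Lemma mB_le2 t tau i j : 0 <= tau -> normc (mB t tau i j) <= tau * za (i + j).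
Proof.
move=> tau0; rewrite normc_mB.
have := normc_phB (t + tau) t i j; rewrite [t + tau - t]addrC addKr ger0_norm//.
(* Since 0^-1 = 0, the multiplier vanishes as soon as one input frequency is 0. *)
have [->|i0] := eqVneq i 0.
  by move=> _; rewrite mulr0z normr0 invr0 mulr0 !mul0r mulr_ge0.
have [->|j0] := eqVneq j 0.
  by move=> _; rewrite mulr0z normr0 invr0 mulr0 !mul0r mulr_ge0.
have x0 : 0 < za i by apply: lt_le_trans (za_ge1 i0).
have y0 : 0 < za j by apply: lt_le_trans (za_ge1 j0).
move=> H; apply: (@le_trans _ _ (24^-1 * (za i)^-1 * (za j)^-1 *
   (6 * tau * (za i * za j * za (i + j))))).
  by rewrite ler_wpM2l// !mulr_ge0// invr_ge0.
have -> : 24^-1 * (za i)^-1 * (za j)^-1 * (6 * tau * (za i * za j * za (i + j))) =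
   4^-1 * (tau * za (i + j)) by field; rewrite !lt0r_neq0.
by rewrite ler_piMl ?mulr_ge0//; lra.
Qed.

(** From |i + j| / |i j| <= 1/|i| + 1/|j|: one derivative is gained, uniformly in tau. *)
Lemma mB_smoothing t tau i j : za (i + j) ^+ 1 * normc (mB t tau i j) <= 1 * ((za i)^-1 + (za j)^-1).
Proof.
rewrite expr1 mul1r.
have [->|i0] := eqVneq i 0.
  by rewrite normc_mB mulr0z normr0 invr0 mulr0 !mul0r mulr0 addr_ge0 ?invr_ge0.
have [->|j0] := eqVneq j 0.
  by rewrite normc_mB mulr0z normr0 invr0 mulr0 !mul0r mulr0 addr_ge0 ?invr_ge0.
have x0 : 0 < za i by apply: lt_le_trans (za_ge1 i0).
have y0 : 0 < za j by apply: lt_le_trans (za_ge1 j0).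
apply: (@le_trans _ _ ((za i + za j) * ((za i)^-1 * (za j)^-1))).
  by apply: ler_pM => //; [exact: normc_ge0 | exact: zaD | exact: mB_le1].
by rewrite le_eqVlt; apply/orP; left; apply/eqP; field; rewrite !lt0r_neq0.
Qed.

(** Geometric mean of [mB_le1] and [mB_le2]: as |i + j| <= 2 |i j|, the product of the two bounds is
    at most 2 tau. *)
Lemma mB_le_sqrt t tau i j : 0 <= tau ->
  za (i + j) ^+ 1 * normc (mB t tau i j) <= (2 * Num.sqrt tau) * (za i ^+ 1 + za j ^+ 1).
Proof.
move=> tau0; rewrite !expr1 mulrC; apply: ler_pM => //; [exact: normc_ge0| |exact: zaD].
have [->|i0] := eqVneq i 0.
  by rewrite normc_mB mulr0z normr0 invr0 mulr0 !mul0r mulr_ge0 ?sqrtr_ge0.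
have [->|j0] := eqVneq j 0.
  by rewrite normc_mB mulr0z normr0 invr0 mulr0 !mul0r mulr_ge0 ?sqrtr_ge0.
have x1 := za_ge1 i0; have y1 := za_ge1 j0.
have xy1 : 1 <= za i * za j by exact: mulr_ege1.
rewrite -ler_sqr ?nnegrE ?normc_ge0 ?mulr_ge0 ?sqrtr_ge0// exprMn [Num.sqrt tau ^+ 2]sqr_sqrtr//.
apply: (@le_trans _ _ ((za i * za j)^-1 * (tau * (2 * (za i * za j))))).
  rewrite expr2; apply: ler_pM; rewrite ?normc_ge0//; first by rewrite invfM mB_le1.
  apply: le_trans (mB_le2 _ _ _ tau0) _; rewrite ler_wpM2l//.
  apply: le_trans (zaD _ _) _; nra.
move: xy1; move: (za i * za j) => x xy1.
have -> : x^-1 * (tau * (2 * x)) = 2 * tau by field; rewrite lt0r_neq0//; lra.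
by rewrite ler_wpM2r// expr2; lra.
Qed.

(* If max(|i|, |j|) is large, so is |i j|; otherwise the phase difference is O(tau). *)
Lemma mB_small t tau eps i j : 0 < eps -> 0 <= tau -> 2 * tau <= eps ^+ 4 ->
  za (i + j) ^+ 0 * normc (mB t tau i j) <= eps * ((za i)^-1 + (za j)^-1).
Proof.
move=> e0 tau0 te; rewrite expr0 mul1r.
have [->|i0] := eqVneq i 0.
  by rewrite normc_mB mulr0z normr0 invr0 mulr0 !mul0r mulr_ge0 ?addr_ge0 ?invr_ge0 ?(ltW e0).
have [->|j0] := eqVneq j 0.
  by rewrite normc_mB mulr0z normr0 invr0 mulr0 !mul0r mulr_ge0 ?addr_ge0 ?invr_ge0 ?(ltW e0).
have h1 := mB_le1 t tau i j; have h2 := mB_le2 t i j tau0.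
have hz := zaD i j.
have x1 := za_ge1 i0; have y1 := za_ge1 j0.
have x0 : 0 < za i by apply: lt_le_trans x1.
have y0 : 0 < za j by apply: lt_le_trans y1.
have u0 : 0 < (za i)^-1 by rewrite invr_gt0.
have v0 : 0 < (za j)^-1 by rewrite invr_gt0.
have xu : za i * (za i)^-1 = 1 by rewrite divff ?lt0r_neq0.
have yv : za j * (za j)^-1 = 1 by rewrite divff ?lt0r_neq0.
move: x1 y1 x0 y0 u0 v0 xu yv h1 h2 hz.
move: (za i) (za j) (za (i + j)) (normc _) => x y z n; move: x^-1 y^-1 => u v.
move=> x1 y1 x0 y0 u0 v0 xu yv h1 h2 hz.
(* Here u = 1/|i| and v = 1/|j|: if one of them is at most eps, the bound u v already suffices. *)
have [ue|eu] := leP u eps.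
  apply: le_trans h1 _; rewrite mulrDr; apply: ler_wpDl; first by rewrite mulr_ge0 ?ltW.
  by rewrite ler_wpM2r// ltW.
have [ve|ev] := leP v eps.
  apply: le_trans h1 _; rewrite mulrDr; apply: ler_wpDr; first by rewrite mulr_ge0 ?ltW.
  by rewrite mulrC ler_wpM2r// ltW.
apply: (@le_trans _ _ (eps * u)); last by rewrite ler_wpM2l ?(ltW e0)// lerDl ltW.
have hx : eps * x <= 1 by rewrite -xu mulrC ler_wpM2l// ltW.
have hy : eps * y <= 1 by rewrite -yv mulrC ler_wpM2l// ltW.
have hxy : z <= 2 * (x * y) by apply: le_trans hz _; nra.
apply: le_trans h2 _.
apply: (@le_trans _ _ (tau * (2 * (x * y)))); first by rewrite ler_wpM2l.
apply: (@le_trans _ _ (eps ^+ 4 * (x * y))).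
  have -> : tau * (2 * (x * y)) = 2 * tau * (x * y) by ring.
  by rewrite ler_wpM2r// mulr_ge0// ltW.
(* Both frequencies are now below 1/eps. One eps is kept and the other three are spent on x, x and
   y, the second x coming from x u = 1; this accounts for the fourth power. *)
have -> : eps ^+ 4 * (x * y) = eps * ((eps * x) * (eps * x) * (eps * y)) * u + eps ^+ 4 * x * y * (1 - x * u).
  ring.
rewrite xu subrr mulr0 addr0 mulrAC ler_piMr//; first by rewrite mulr_ge0 ?ltW.
have px : 0 <= eps * x by rewrite mulr_ge0 ?ltW.
have py : 0 <= eps * y by rewrite mulr_ge0 ?ltW.
have pxx : eps * x * (eps * x) <= 1 by exact: mulr_ile1.
by apply: mulr_ile1 => //; rewrite mulr_ge0.
Qed.

Lemma normc_mP s i j : normc (mP s i j) = za (i + j) / 2.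
Proof.
rewrite /mP normcM normc_expi mulr1 /= expr0n add0r sqrtr_sqr normrM.
by rewrite [`|2^-1|]ger0_norm// invr_ge0.
Qed.

Lemma sqrD_le (x y z : R) : 0 <= x -> 0 <= y -> 0 <= z -> z <= x + y ->
  z ^+ 2 <= 2 * (x ^+ 2 + y ^+ 2).
Proof.
move=> x0 y0 z0 h; have h2 : z ^+ 2 <= (x + y) ^+ 2 by rewrite ler_sqr ?nnegrE ?addr_ge0.
have := sqr_ge0 (x - y); rewrite sqrrB; rewrite sqrrD in h2; lra.
Qed.

Lemma mP_loss1 s i j : za (i + j) ^+ 1 * normc (mP s i j) <= 1 * (za i ^+ 2 + za j ^+ 2).
Proof.
rewrite normc_mP expr1 mul1r; have := zaD i j; have : 0 <= za (i + j) by [].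
have : 0 <= za i by []; have : 0 <= za j by [].
move: (za i) (za j) (za (i + j)) => x y z y0 x0 z0 /(sqrD_le x0 y0 z0).
by rewrite mulrA -expr2 ler_pdivrMr// mulrC.
Qed.

(** Convexity of the cube, (x + y)^3 <= 4 (x^3 + y^3), extracted from (x + y) (x - y)^2 >= 0. The
    right-hand side of the equation thus maps H^3 to H^2. *)
Lemma mP_loss2 s i j : za (i + j) ^+ 2 * normc (mP s i j) <= 2 * (za i ^+ 3 + za j ^+ 3).
Proof.
rewrite normc_mP; have := zaD i j; have : 0 <= za (i + j) by [].
have : 0 <= za i by []; have : 0 <= za j by [].
move: (za i) (za j) (za (i + j)) => x y z y0 x0 z0 h.
have h3 : z ^+ 3 <= (x + y) ^+ 3 by apply: lerXn2r => //; rewrite nnegrE; lra.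
have -> : z ^+ 2 * (z / 2) = z ^+ 3 / 2 by rewrite mulrA -exprSr.
have : 0 <= (x + y) * (x - y) ^+ 2 by rewrite mulr_ge0 ?addr_ge0 ?sqr_ge0.
have -> : (x + y) * (x - y) ^+ 2 = x ^+ 3 + y ^+ 3 - (x ^+ 2 * y + x * y ^+ 2) by ring.
rewrite (_ : (x + y) ^+ 3 = x ^+ 3 + y ^+ 3 + 3 * (x ^+ 2 * y + x * y ^+ 2)) in h3; last by ring.
have -> : 2 * (x ^+ 3 + y ^+ 3) = (x ^+ 3 + y ^+ 3) * 2 by ring.
lra.
Qed.

(** The factor 1/|i| or 1/|j| turns one l^2 input into an l^1 one at the price of a factor 2; the
    two summands add up to 4. *)
Lemma Qb_bound_inv r (m : int -> int -> R[i]) c f g F G N : 0 <= c ->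
  (forall i j, za (i + j) ^+ r * normc (m i j) <= c * ((za i)^-1 + (za j)^-1)) ->
  bnd 0 f F -> bnd 0 g G -> bnd r (Qb N m f g) (4 * c * F * G).
Proof.
move=> c0 hm hf hg; have [F0 hF] := hf; have [G0 hG] := hg.
have -> : 4 * c * F * G = (2 * (c * F)) * G + 2 * G * (c * F) by ring.
apply: (@Qb_bound _ _ _ _ _ _ (fun k => c * ((za k)^-1 * normc (f k))) (fun k => normc (g k))
   (fun k => (za k)^-1 * normc (g k)) (fun k => c * normc (f k))).
- by move=> k; rewrite !mulr_ge0 ?invr_ge0 ?normc_ge0.
- by move=> k; exact: normc_ge0.
- by move=> k; rewrite !mulr_ge0 ?invr_ge0 ?normc_ge0.
- by move=> k; rewrite !mulr_ge0 ?normc_ge0.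
- by rewrite !mulr_ge0.
- by [].
- by rewrite !mulr_ge0.
- by rewrite !mulr_ge0.
- by rewrite -mulr_sumr mulrCA ler_wpM2l//; exact: bnd_sum_inv.
- by apply: le_trans (hG N); apply: ler_sum => k _; rewrite expr0 mul1r.
- exact: bnd_sum_inv.
- rewrite exprMn; apply: le_trans (ler_wpM2l (sqr_ge0 c) (hF N)).
  by rewrite mulr_sumr; apply: ler_sum => k _; rewrite expr0 mul1r exprMn.
move=> i j; have := ler_wpM2r (mulr_ge0 (normc_ge0 (f i)) (normc_ge0 (g j))) (hm i j).
by congr (_ <= _); ring.
Qed.

(** The p derivatives fall on one input; the other one is put in l^1, which takes one derivative and
    zero mean, hence p > 0. *)
Lemma Qb_bound_pow r p (m : int -> int -> R[i]) c f g F G N : 0 <= c -> (0 < p)%N ->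
  (forall i j, za (i + j) ^+ r * normc (m i j) <= c * (za i ^+ p + za j ^+ p)) ->
  f 0 = 0 -> g 0 = 0 ->
  bnd p f F -> bnd p g G -> bnd r (Qb N m f g) (4 * c * F * G).
Proof.
move=> c0 p0 hm f0 g0 hf hg; have [F0 hF] := hf; have [G0 hG] := hg.
have hf1 := bnd_sum N f0 (bnd_lower p0 f0 hf).
have hg1 := bnd_sum N g0 (bnd_lower p0 g0 hg).
have -> : 4 * c * F * G = (2 * (c * F)) * G + 2 * G * (c * F) by ring.
apply: (@Qb_bound _ _ _ _ _ _ (fun k => c * normc (f k)) (fun k => za k ^+ p * normc (g k))
   (fun k => normc (g k)) (fun k => c * (za k ^+ p * normc (f k)))).
- by move=> k; rewrite !mulr_ge0 ?normc_ge0.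
- by move=> k; exact: term_ge0.
- by move=> k; exact: normc_ge0.
- by move=> k; rewrite !mulr_ge0 ?exprn_ge0 ?normc_ge0.
- by rewrite !mulr_ge0.
- by [].
- by rewrite !mulr_ge0.
- by rewrite !mulr_ge0.
- rewrite -mulr_sumr mulrCA ler_wpM2l//; apply: le_trans hf1.
  by apply: ler_sum => k _; rewrite expr0 mul1r.
- exact: hG.
- by apply: le_trans hg1; apply: ler_sum => k _; rewrite expr0 mul1r.
- rewrite exprMn; apply: le_trans (ler_wpM2l (sqr_ge0 c) (hF N)).
  by rewrite mulr_sumr; apply: ler_sum => k _; rewrite exprMn.
move=> i j; have := ler_wpM2r (mulr_ge0 (normc_ge0 (f i)) (normc_ge0 (g j))) (hm i j).
by congr (_ <= _); ring.
Qed.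

End Multipliers.

(** * Energy cancellations *)

Section Energy.
Context {R : realType}.
Implicit Types (f g h E V z : int -> R[i]) (r N M : nat) (s t tau : R) (i j l : int).

Local Notation za k := (`|k%:~R : R|).

(** Coefficients of a real-valued function. *)
Definition herm f : Prop := forall k, f (- k) = (f k)^*%C.

(* After l |-> - l the pairing is a sum over i + j + l = 0, hence open to
   permutations of the three frequencies. *)
Lemma pr_Qb r m f g h N : herm h ->
  pr r (Qb N m f g) h N =
  complex.Re (\sum_(i <- zrange N) \sum_(j <- zrange N) \sum_(l <- zrange N)
    (if i + j + l == 0 then ((za l ^+ r.*2)%:C)%C * m i j * f i * g j * h l else 0)).
Proof.
move=> hh; rewrite /pr sum_zrange_opp.
under [in RHS]eq_bigr do rewrite exchange_big.
rewrite exchange_big Re_sum; apply: eq_bigr => l _ /=.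
rewrite hh mulrNz normrN -ReM_real; congr complex.Re.
rewrite conjcK mulrA /Qb mulr_sumr mulr_suml; apply: eq_bigr => i _.
rewrite mulr_sumr mulr_suml; apply: eq_bigr => j _.
have -> : (- l == i + j) = (i + j + l == 0) by apply/eqP/eqP; lia.
by case: eqP => _; [rewrite !mulrA | rewrite mulr0 mul0r].
Qed.

Lemma normc_herm f k : herm f -> normc (f (- k)) = normc (f k).
Proof. by move=> ->; rewrite normcJ. Qed.

Lemma sum3_rot (T : nmodType) (u : seq int) (W : int -> int -> int -> T) :
  \sum_(i <- u) \sum_(j <- u) \sum_(l <- u) W i j l =
  \sum_(i <- u) \sum_(j <- u) \sum_(l <- u) W j l i.
Proof.
by rewrite [RHS]exchange_big; apply: eq_bigr => i _; rewrite [RHS]exchange_big.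
Qed.

Lemma sum3_swap (T : nmodType) (u : seq int) (W : int -> int -> int -> T) :
  \sum_(i <- u) \sum_(j <- u) \sum_(l <- u) W i j l =
  \sum_(i <- u) \sum_(j <- u) \sum_(l <- u) W l j i.
Proof.
rewrite [RHS]exchange_big; under [RHS]eq_bigr do rewrite exchange_big.
by rewrite [RHS]exchange_big.
Qed.

(** Written with l = - (i + j), the phase depends on the product i j l only. It is therefore
    invariant under permutations and factors out of every symmetrized sum. *)
Lemma phN s i j l : i + j + l = 0 ->
  ph s i j = expi (s * (3 * (i%:~R * j%:~R * l%:~R))).
Proof.
move=> e; rewrite /ph; have -> : i + j = - l by lia.
by congr expi; rewrite mulrNz; ring.
Qed.

Lemma mB_cyc t tau i j l : i + j + l = 0 -> i != 0 -> j != 0 -> l != 0 ->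
  mB t tau i j + mB t tau j l + mB t tau l i = 0.
Proof.
move=> e i0 j0 l0; rewrite !mBE.
rewrite !(@phN _ i j l)// !(@phN _ j l i) ?(@phN _ l i j); [|lia..].
have -> : (l%:~R * i%:~R * j%:~R : R) = i%:~R * j%:~R * l%:~R by ring.
have -> : (j%:~R * l%:~R * i%:~R : R) = i%:~R * j%:~R * l%:~R by ring.
move: (expi _ - expi _) => w.
rewrite -!mulrDl -!rmorphD/=.
suff -> : - (24 * (i%:~R * j%:~R))^-1 - (24 * (j%:~R * l%:~R))^-1 - (24 * (l%:~R * i%:~R))^-1 = 0 :> R.
  by rewrite mul0r.
have -> : - (24 * (i%:~R * j%:~R))^-1 - (24 * (j%:~R * l%:~R))^-1 - (24 * (l%:~R * i%:~R))^-1
  = - (i + j + l)%:~R / (24 * i%:~R * j%:~R * l%:~R) :> R.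
  by rewrite !intrD; field; rewrite !intr_eq0 i0 j0 l0.
by rewrite e oppr0 mul0r.
Qed.

Lemma pr0_mB_self t tau z N : herm z -> z 0 = 0 -> pr 0 (Qb N (mB t tau) z z) z N = 0.
Proof.
move=> hz z0; rewrite pr_Qb//.
set S := \sum_(i <- _) _.
(* The three copies are rotated against each other, so that each triple carries the cyclic sum of
   the multiplier. *)
suff : S + S + S = 0.
  move=> h; have : complex.Re (S + S + S) = 0 by rewrite h.
  by rewrite !ReD; lra.
rewrite {1}/S [X in _ + X + _]sum3_rot [X in _ + X]sum3_rot [X in _ + X]sum3_rot.
rewrite -!big_split big1// => i _; rewrite -!big_split big1// => j _.
rewrite -!big_split big1//= => l _.
have -> : (j + l + i == 0) = (i + j + l == 0) by congr (_ == _); ring.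
have -> : (l + i + j == 0) = (i + j + l == 0) by congr (_ == _); ring.
case: eqP => [e|_]; last by rewrite !addr0.
have [->|i0] := eqVneq i 0; first by rewrite z0 !(mulr0, mul0r, addr0).
have [->|j0] := eqVneq j 0; first by rewrite z0 !(mulr0, mul0r, addr0).
have [->|l0] := eqVneq l 0; first by rewrite z0 !(mulr0, mul0r, addr0).
rewrite !expr0.
transitivity ((mB t tau i j + mB t tau j l + mB t tau l i) * (z i * z j * z l)).
  by rewrite rmorph1; ring.
by rewrite mB_cyc ?mul0r.
Qed.

(* l^2/(ij) + i^2/(lj) = (l^3 + i^3)/(ijl) and l + i = - j: swapping the two
   copies of E gains the derivative that the product loses. *)
Lemma mB_swap t tau i j l : 0 <= tau -> i + j + l = 0 -> i != 0 -> j != 0 -> l != 0 ->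
  normc (((za l ^+ 2)%:C)%C * mB t tau i j + ((za i ^+ 2)%:C)%C * mB t tau l j) <=
  tau * (za j ^+ 3 + za i * za j * za l).
Proof.
move=> tau0 e i0 j0 l0; rewrite !mBE.
have -> : ph (t + tau) l j = ph (t + tau) i j.
  by rewrite !(@phN _ i j l)// !(@phN _ l j i); [congr expi; ring|lia].
have -> : ph t l j = ph t i j.
  by rewrite !(@phN _ i j l)// !(@phN _ l j i); [congr expi; ring|lia].
have := normc_phB (t + tau) t i j.
rewrite [t + tau - t]addrC addKr (ger0_norm tau0).
have -> : i + j = - l by lia.
rewrite mulrNz normrN.
move: (_ - _) => w hw.
rewrite !mulrA -mulrDl normcM -!realCM -realCD normcR.
rewrite !real_normK ?num_real//.
have eR : i%:~R + j%:~R + l%:~R = 0 :> R by rewrite -!intrD e.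
have xi : (i%:~R : R) != 0 by rewrite intr_eq0.
have xj : (j%:~R : R) != 0 by rewrite intr_eq0.
have xl : (l%:~R : R) != 0 by rewrite intr_eq0.
move: hw eR xi xj xl; move: (i%:~R : R) (j%:~R : R) (l%:~R : R) => x y z hw eR x0 y0 z0.
have E : z ^+ 2 * - (24 * x * y)^-1 + x ^+ 2 * - (24 * z * y)^-1 =
   (y ^+ 2 - 3 * (x * z)) / (24 * (x * z)).
  have -> : y = - (x + z) by lra.
  by field; rewrite x0 z0 -oppr_eq0 opprD; apply/andP; split=> //; apply: contra y0 => /eqP h; apply/eqP; lra.
rewrite E normrM normfV [`|24 * _|]normrM [`|24|]ger0_norm// [`|x * z|]normrM.
apply: (@le_trans _ _ ((`|y| ^+ 2 + 3 * (`|x| * `|z|)) / (24 * (`|x| * `|z|)) * (6 * tau * (`|x| * `|y| * `|z|)))).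
  apply: ler_pM => //; [exact: normc_ge0|].
  rewrite ler_wpM2r// ?invr_ge0 ?mulr_ge0//.
  by apply: le_trans (ler_normB _ _) _; rewrite normrX !normrM [`|3|]ger0_norm.
have px : 0 < `|x| by rewrite normr_gt0.
have pz : 0 < `|z| by rewrite normr_gt0.
have -> : (`|y| ^+ 2 + 3 * (`|x| * `|z|)) / (24 * (`|x| * `|z|)) * (6 * tau * (`|x| * `|y| * `|z|)) =
  tau * (`|y| ^+ 3 / 4 + 3 / 4 * (`|x| * `|y| * `|z|)) by field; rewrite !lt0r_neq0.
rewrite ler_wpM2l//; apply: lerD.
  have := exprn_ge0 3 (normr_ge0 y); lra.
by rewrite ler_piMl ?mulr_ge0//; lra.
Qed.

Lemma conv_sum_herm N (A B C : int -> R) a b c :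
  (forall k, 0 <= A k) -> (forall k, 0 <= B k) -> (forall k, 0 <= C k) ->
  0 <= b -> 0 <= c -> (forall k, C (- k) = C k) ->
  \sum_(k <- zrange N) A k <= a ->
  \sum_(k <- zrange N) B k ^+ 2 <= b ^+ 2 -> \sum_(k <- zrange N) C k ^+ 2 <= c ^+ 2 ->
  \sum_(i <- zrange N) \sum_(j <- zrange N) \sum_(l <- zrange N)
    (if i + j + l == 0 then A i * B j * C l else 0) <= a * b * c.
Proof.
move=> A0 B0 C0 b0 c0 Ce hA hB hC.
have u := zrange_uniq N.
have := conv_bound u u u b0 c0 A0 B0 C0 hA hB hC.
apply: le_trans; apply: ler_sum => i _; apply: ler_sum => j _.
rewrite sum_zrange_opp; apply: ler_sum => l _.
have -> : (i + j - l == 0) = (l == i + j) by apply/eqP/eqP; lia.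
by rewrite Ce.
Qed.

(** [mB_swap] leaves two weights. For |j|^3 all derivatives sit on V in l^2, with one copy of E in
    l^1 and one in l^2; for |i j l| each factor carries one derivative and V is the one in l^1. Each
    part gives 2 tau e^2 v for the doubled sum. *)
Lemma pr1_mB_energy t tau E V N e v : 0 <= tau -> herm E -> E 0 = 0 -> V 0 = 0 ->
  bnd 1 E e -> bnd 3 V v ->
  pr 1 (Qb N (mB t tau) E V) E N <= 2 * tau * e ^+ 2 * v.
Proof.
move=> tau0 hE E0 V0 hEe hVv; rewrite pr_Qb//.
set S := \sum_(i <- _) _.
have [e0 he] := hEe; have [v0 hv] := hVv.
have [_ he0] := bnd_lower (leq0n 1) E0 hEe.
have sE := bnd_sum N E0 hEe.
have sV := bnd_sum N V0 (bnd_lower (isT : (2 <= 3)%N) V0 hVv).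
suff : normc (S + S) <= 4 * tau * e ^+ 2 * v.
  have := Re_le_normc (S + S); have := ler_norm (complex.Re (S + S)).
  by rewrite ReD; lra.
rewrite {1}/S {1}sum3_swap -!big_split/=.
pose A1 k := tau * (za k ^+ 0 * normc (E k)).
pose B1 k := za k ^+ 3 * normc (V k).
pose C1 k := za k ^+ 0 * normc (E k).
pose B2 k := tau * (za k ^+ 1 * normc (E k)).
pose A2 k := za k ^+ 1 * normc (V k).
pose C2 k := za k ^+ 1 * normc (E k).
apply: (@le_trans _ _ (
  \sum_(i <- zrange N) \sum_(j <- zrange N) \sum_(l <- zrange N)
    (if i + j + l == 0 then A1 i * B1 j * C1 l else 0) +
  \sum_(j <- zrange N) \sum_(i <- zrange N) \sum_(l <- zrange N)
    (if j + i + l == 0 then A2 j * B2 i * C2 l else 0))).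
  rewrite [X in _ <= _ + X]exchange_big -big_split/=.
  apply: le_trans (normc_sum _ _) _; apply: ler_sum => i _.
  rewrite -!big_split/=; apply: le_trans (normc_sum _ _) _; apply: ler_sum => j _.
  rewrite -!big_split/=; apply: le_trans (normc_sum _ _) _; apply: ler_sum => l _.
  have -> : (l + j + i == 0) = (i + j + l == 0) by congr (_ == _); ring.
  have -> : (j + i + l == 0) = (i + j + l == 0) by congr (_ == _); ring.
  case: eqP => [ijl|_]; last by rewrite !addr0 normc0.
  have R0 : 0 <= A1 i * B1 j * C1 l + A2 j * B2 i * C2 l.
    by rewrite /A1 /B1 /C1 /A2 /B2 /C2 addr_ge0// !mulr_ge0// ?exprn_ge0 ?normc_ge0.
  have [i0|i0] := eqVneq i 0.
    have -> : E i = 0 by rewrite i0.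
    by rewrite !(mulr0, mul0r, addr0) normc0.
  have [j0|j0] := eqVneq j 0.
    have -> : V j = 0 by rewrite j0.
    by rewrite !(mulr0, mul0r, addr0) normc0.
  have [l0|l0] := eqVneq l 0.
    have -> : E l = 0 by rewrite l0.
    by rewrite !(mulr0, mul0r, addr0) normc0.
  have := ler_wpM2r (normc_ge0 (E i * V j * E l)) (mB_swap t tau0 ijl i0 j0 l0).
  rewrite -normcM; congr (normc _ <= _); first by ring.
  by rewrite !normcM /A1 /B1 /C1 /A2 /B2 /C2 !expr0 !expr1; ring.
have -> : 4 * tau * e ^+ 2 * v = tau * (2 * e) * v * e + 2 * v * (tau * e) * e by ring.
apply: lerD; apply: conv_sum_herm => //.
- by move=> k; rewrite mulr_ge0// term_ge0.
- by move=> k; exact: term_ge0.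
- by move=> k; exact: term_ge0.
- by move=> k; rewrite /C1 mulrNz normrN normc_herm.
- by rewrite -mulr_sumr ler_wpM2l.
- exact: hv.
- exact: he0.
- by move=> k; exact: term_ge0.
- by move=> k; rewrite mulr_ge0// term_ge0.
- by move=> k; exact: term_ge0.
- exact: mulr_ge0.
- by move=> k; rewrite /C2 mulrNz normrN normc_herm.
- rewrite /B2 exprMn; under eq_bigr do rewrite exprMn.
  by rewrite -mulr_sumr ler_wpM2l ?sqr_ge0//; exact: he.
- exact: he.
Qed.

End Energy.

(** * Fourier coefficients of square integrable functions *)

Section FourierCoefficients.
Context {R : realType}.
Implicit Types (u w c : R -> R) (k : int) (r L d : R).

Local Notation mu := (@lebesgue_measure R).
Local Notation D := (`[0, pi *+ 2]%classic : set R).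
Local Notation intD u := (mu.-integrable D (EFin \o u)).

Definition sqint u : Prop :=
  measurable_fun [set: R] u /\ mu.-integrable D (fun x => (u x ^+ 2)%:E).

Lemma twopi_gt0 : 0 < pi *+ 2 :> R.
Proof. by rewrite mulrn_wgt0// pi_gt0. Qed.

Lemma Rintegral_cstD r : \int[mu]_(x in D) r = pi *+ 2 * r.
Proof.
rewrite Rintegral_cst// /= lebesgue_measure_itv/= lte_fin twopi_gt0.
by rewrite -EFinB subr0/= mulrC.
Qed.

Lemma bounded_intD u L : measurable_fun [set: R] u -> (forall x, `|u x| <= L) -> intD u.
Proof.
move=> mu_ uL; apply: measurable_bounded_integrable => //.
- by rewrite /= lebesgue_measure_itv/= lte_fin twopi_gt0 -EFinB ltry.
- exact: measurable_funTS.
- exists L; split; first exact: num_real.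
  by move=> y Ly x _; apply: le_trans (uL x) (ltW Ly).
Qed.

Lemma bounded_sqint u L : measurable_fun [set: R] u -> (forall x, `|u x| <= L) -> sqint u.
Proof.
move=> mu_ uL; split=> //; apply: (@bounded_intD (fun x => u x ^+ 2) (L ^+ 2)).
  exact: measurable_funX.
by move=> x; rewrite normrX lerXn2r// nnegrE// (le_trans _ (uL x)).
Qed.

Lemma sqint_intD u c : sqint u -> measurable_fun [set: R] c -> (forall x, `|c x| <= 1) ->
  intD (fun x => u x * c x).
Proof.
move=> [mu_ iu] mc c1.
have i1 : mu.-integrable D (fun x => (1 + u x ^+ 2)%:E).
  have i0 : intD (cst 1 : R -> R).
    by apply: (@bounded_intD _ 1) => // x; rewrite normr1.
  have := @integrableD _ _ R mu D (measurable_itv _) _ _ i0 iu.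
  by apply: eq_integrable.
apply: le_integrable i1 => //.
- by apply/measurable_EFinP; apply: measurable_funTS; exact: measurable_funM.
move=> x _ /=; rewrite lee_fin [leRHS]ger0_norm ?addr_ge0 ?sqr_ge0// normrM.
apply: (@le_trans _ _ `|u x|); first by rewrite ler_piMr.
have := sqr_ge0 (`|u x| - 1); rewrite sqrrB real_normK ?num_real//.
have := normr_ge0 (u x); have := sqr_ge0 (u x); lra.
Qed.

Lemma sqintZ r u : sqint u -> sqint (fun x => r * u x).
Proof.
move=> [mu_ iu]; split; first exact: measurable_funM.
have := @integrableZl _ _ R mu D (measurable_itv _) (r ^+ 2) _ iu.
by apply: eq_integrable => // x _; rewrite -EFinM exprMn.
Qed.

Lemma sqintD u w : sqint u -> sqint w -> sqint (fun x => u x + w x).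
Proof.
move=> [mu_ iu] [mw iw]; split; first exact: measurable_funD.
have i1 := @integrableD _ _ R mu D (measurable_itv _) _ _ (@integrableZl _ _ R mu D (measurable_itv _) 2 _ iu)
  (@integrableZl _ _ R mu D (measurable_itv _) 2 _ iw).
apply: le_integrable i1 => //.
- apply/measurable_EFinP; apply: measurable_funTS; apply: measurable_funX.
  exact: measurable_funD.
move=> x _; rewrite /= lee_fin !ger0_norm ?sqr_ge0//.
  by have := sqr_ge0 (u x - w x); rewrite sqrrB sqrrD; lra.
by rewrite addr_ge0// mulr_ge0// sqr_ge0.
Qed.

Lemma sqintN u : sqint u -> sqint (fun x => - u x).
Proof. by move=> /(sqintZ (-1)); under eq_fun do rewrite mulN1r. Qed.

Lemma sqintB u w : sqint u -> sqint w -> sqint (fun x => u x - w x).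
Proof. by move=> hu hw; apply: sqintD => //; exact: sqintN. Qed.

Lemma continuous_coskx (a : R) : continuous (fun x => cos (a * x)).
Proof. by move=> x; apply: continuous_comp; [exact: mulrl_continuous | exact: continuous_cos]. Qed.

Lemma continuous_sinkx (a : R) : continuous (fun x => sin (a * x)).
Proof. by move=> x; apply: continuous_comp; [exact: mulrl_continuous | exact: continuous_sin]. Qed.

Lemma measurable_coskx (a : R) : measurable_fun [set: R] (fun x => cos (a * x)).
Proof. by apply: continuous_measurable_fun; exact: continuous_coskx. Qed.

Lemma measurable_sinkx (a : R) : measurable_fun [set: R] (fun x => sin (a * x)).
Proof. by apply: continuous_measurable_fun; exact: continuous_sinkx. Qed.

Hint Resolve measurable_coskx measurable_sinkx : core.
Hint Extern 0 (is_true (`|cos _| <= 1)) => exact: cos_max : core.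
Hint Extern 0 (is_true (`|sin _| <= 1)) => exact: sin_max : core.

Lemma torus_meanD u w : intD u -> intD w ->
  torus_mean (fun x => u x + w x) = torus_mean u + torus_mean w.
Proof. by move=> iu iw; rewrite /torus_mean RintegralD// mulrDr. Qed.

Lemma torus_meanZ r u : intD u -> torus_mean (fun x => r * u x) = r * torus_mean u.
Proof. by move=> iu; rewrite /torus_mean RintegralZl// mulrCA. Qed.

Lemma torus_mean_le u L : measurable_fun [set: R] u -> (forall x, `|u x| <= L) ->
  `|torus_mean u| <= L.
Proof.
move=> mu_ uL; rewrite /torus_mean normrM normfV [`|pi *+ 2|]gtr0_norm ?twopi_gt0//.
rewrite ler_pdivrMl ?twopi_gt0//.
have iu := bounded_intD mu_ uL.
apply: le_trans (@le_normr_Rintegral _ _ R mu D u (measurable_itv _) iu) _.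
have -> : pi *+ 2 * L = \int[mu]_(x in D) L.
  by rewrite Rintegral_cstD.
apply: le_Rintegral => //.
  exact: integrable_norm.
apply: (@bounded_intD (cst L) L) => // _ /=.
by rewrite ger0_norm// (le_trans _ (uL 0)).
Qed.

Lemma fourierD u w k : sqint u -> sqint w ->
  fourier (fun x => u x + w x) k = fourier u k + fourier w k.
Proof.
move=> hu hw; rewrite /fourier.
under [X in (torus_mean X -i* _)%C]eq_fun do rewrite mulrDl.
under [X in (_ -i* torus_mean X)%C]eq_fun do rewrite mulrDl.
rewrite !torus_meanD; [|by apply: sqint_intD..].
by apply/eqP; rewrite eq_complex /= opprD !eqxx.
Qed.

Lemma fourierZ r u k : sqint u -> fourier (fun x => r * u x) k = (r%:C)%C * fourier u k.
Proof.
move=> hu; rewrite /fourier.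
under [X in (torus_mean X -i* _)%C]eq_fun do rewrite -mulrA.
under [X in (_ -i* torus_mean X)%C]eq_fun do rewrite -mulrA.
rewrite !torus_meanZ; [|by apply: sqint_intD..].
by apply/eqP; rewrite eq_complex /= !mul0r subr0 addr0 mulrN !eqxx.
Qed.

Lemma fourierN u k : sqint u -> fourier (fun x => - u x) k = - fourier u k.
Proof.
move=> hu; under eq_fun do rewrite -mulN1r.
by rewrite fourierZ// rmorphN rmorph1 mulN1r.
Qed.

Lemma fourierB u w k : sqint u -> sqint w ->
  fourier (fun x => u x - w x) k = fourier u k - fourier w k.
Proof. by move=> hu hw; rewrite fourierD ?fourierN//; exact: sqintN. Qed.

Lemma fourier_herm u : sqint u -> herm (fourier u).
Proof.
move=> hu k; rewrite /fourier mulrNz.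
under [X in (torus_mean X -i* _)%C]eq_fun do rewrite mulNr cosN.
under [X in (_ -i* torus_mean X)%C]eq_fun do rewrite mulNr sinN mulrN -mulN1r.
rewrite torus_meanZ; last by apply: sqint_intD.
by apply/eqP; rewrite eq_complex /= mulN1r !eqxx.
Qed.

Lemma fourier_bounded u d k : measurable_fun [set: R] u -> (forall x, `|u x| <= d) ->
  normc (fourier u k) <= 2 * d.
Proof.
move=> mu_ ud; apply: le_trans (normc_le_ReIm _) _.
rewrite mulr_natl mulr2n normrN; apply: lerD; apply: torus_mean_le.
- exact: measurable_funM.
- by move=> x; rewrite normrM -[leRHS]mulr1; apply: ler_pM.
- exact: measurable_funM.
- by move=> x; rewrite normrM -[leRHS]mulr1; apply: ler_pM.
Qed.

Lemma fourier_lim (un : nat -> R -> R) u (e : nat -> R) k :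
  (forall n, measurable_fun [set: R] (un n)) -> (forall n, sqint (un n)) -> sqint u ->
  (forall n x, `|un n x - u x| <= e n) -> e @ \oo --> (0 : R) ->
  cvgC (fun n => fourier (un n) k) (fourier u k).
Proof.
move=> mun hun hu hue e0.
apply: (@cvgC_squeeze _ _ _ (fun n => 2 * e n)).
  move=> n; rewrite -fourierB//; apply: fourier_bounded; last exact: hue.
  by apply: measurable_funB => //; case: hu.
by rewrite -[X in _ --> X](mulr0 2); apply: cvgM => //; exact: cvg_cst.
Qed.

(** * Orthogonality of the trigonometric functions *)

Lemma sin_kperiod k : sin (k%:~R * (pi *+ 2)) = 0 :> R.
Proof.
suff h (n : nat) : sin (n%:~R * (pi *+ 2)) = 0 :> R.
  case: k => n; first exact: h.
  by rewrite NegzE mulrNz mulNr sinN h oppr0.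
by rewrite mulr_natl -[_ *+ n]add0r (periodicn (@sinD2pi R)) sin0.
Qed.

Lemma cos_kperiod k : cos (k%:~R * (pi *+ 2)) = 1 :> R.
Proof.
suff h (n : nat) : cos (n%:~R * (pi *+ 2)) = 1 :> R.
  case: k => n; first exact: h.
  by rewrite NegzE mulrNz mulNr cosN h.
by rewrite mulr_natl -[_ *+ n]add0r (periodicn (@cosD2pi R)) cos0.
Qed.

Lemma periodic_coskx k : periodic (fun x : R => cos (k%:~R * x)) (pi *+ 2).
Proof.
by move=> x; rewrite mulrDr cosD cos_kperiod sin_kperiod mulr1 mulr0 subr0.
Qed.

Lemma periodic_sinkx k : periodic (fun x : R => sin (k%:~R * x)) (pi *+ 2).
Proof.
by move=> x; rewrite mulrDr sinD cos_kperiod sin_kperiod mulr1 mulr0 addr0.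
Qed.

Lemma torus_mean_FTC (f F : R -> R) : continuous f ->
  (forall x : R, is_derive x 1 F (f x)) ->
  torus_mean f = (pi *+ 2)^-1 * (F (pi *+ 2) - F 0).
Proof.
move=> cf dF; rewrite /torus_mean; congr (_ * _).
have cF : continuous F.
  by move=> x; apply/differentiable_continuous/derivable1_diffP; have [] := dF x.
rewrite /Rintegral (@continuous_FTC2 _ f F)//.
- exact: twopi_gt0.
- exact: continuous_subspaceT.
- split.
  + by move=> x _; have [] := dF x.
  + by apply: cvg_at_right_filter; exact: cF.
  + by apply: cvg_at_left_filter; exact: cF.
- by move=> x _; rewrite derive1E; have [_] := dF x.
Qed.

Lemma is_derive_scale (a x : R) : is_derive x 1 (fun y => a * y) a.
Proof.
have -> : ( *%R a) = a \*: id :> (R -> R) by apply/funext.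
by have := is_deriveZ a (is_derive_id x (1 : R)); rewrite /GRing.scale /= mulr1.
Qed.

Lemma is_derive_sinkx (a x : R) : a != 0 ->
  is_derive x 1 (fun y => a^-1 * sin (a * y)) (cos (a * x)).
Proof.
move=> a0; have h := @is_derive1_comp _ sin ( *%R a) x (cos (a * x)) a
  (is_derive_sin _) (is_derive_scale a x).
by have := is_deriveZ a^-1 h; rewrite /GRing.scale /= mulrCA mulVf// mulr1.
Qed.

Lemma is_derive_coskx (a x : R) : a != 0 ->
  is_derive x 1 (fun y => - a^-1 * cos (a * y)) (sin (a * x)).
Proof.
move=> a0; have h := @is_derive1_comp _ cos ( *%R a) x (- sin (a * x)) a
  (is_derive_cos _) (is_derive_scale a x).
have := is_deriveZ (- a^-1) h; rewrite /GRing.scale /=.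
by have -> : - a^-1 * (- sin (a * x) * a) = sin (a * x) by field.
Qed.

Lemma torus_mean_cos k : torus_mean (fun x : R => cos (k%:~R * x)) = (k == 0)%:R.
Proof.
have [->|k0] := eqVneq k 0.
  rewrite /torus_mean; under eq_Rintegral do rewrite mul0r cos0.
  by rewrite Rintegral_cstD mulr1 mulVf// lt0r_neq0// twopi_gt0.
have kR : (k%:~R : R) != 0 by rewrite intr_eq0.
rewrite (torus_mean_FTC (@continuous_coskx _) (fun x => is_derive_sinkx x kR)).
by rewrite sin_kperiod !mulr0 sin0 mulr0 subrr mulr0.
Qed.

Lemma torus_mean_sin k : torus_mean (fun x : R => sin (k%:~R * x)) = 0.
Proof.
have [->|k0] := eqVneq k 0.
  rewrite /torus_mean; under eq_Rintegral do rewrite mul0r sin0.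
  by rewrite Rintegral_cstD !mulr0.
have kR : (k%:~R : R) != 0 by rewrite intr_eq0.
rewrite (torus_mean_FTC (@continuous_sinkx _) (fun x => is_derive_coskx x kR)).
by rewrite cos_kperiod !mulr0 cos0 subrr mulr0.
Qed.

Lemma cos_sqint k : sqint (fun x : R => cos (k%:~R * x)).
Proof. by apply: (@bounded_sqint _ 1) => // x; exact: cos_max. Qed.

Lemma sin_sqint k : sqint (fun x : R => sin (k%:~R * x)).
Proof. by apply: (@bounded_sqint _ 1) => // x; exact: sin_max. Qed.

Lemma cos_intD (a : R) : intD (fun x : R => cos (a * x)).
Proof. by apply: (@bounded_intD _ 1) => // x; exact: cos_max. Qed.

Lemma sin_intD (a : R) : intD (fun x : R => sin (a * x)).
Proof. by apply: (@bounded_intD _ 1) => // x; exact: sin_max. Qed.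

Lemma intDZ r u : intD u -> intD (fun x => r * u x).
Proof. by move=> iu; have := @integrableZl _ _ R mu D (measurable_itv _) r _ iu; exact: eq_integrable. Qed.

(** Product-to-sum formulas reduce the coefficients to means of single modes; for j = 0 both
    indicators fire at k = 0 and add up to 1. *)
Lemma fourier_cos j k : fourier (fun x : R => cos (j%:~R * x)) k =
  (((j == k)%:R + (j == - k)%:R) / 2 +i* 0)%C.
Proof.
rewrite /fourier; apply/eqP; rewrite eq_complex /=; apply/andP; split; apply/eqP.
  transitivity (torus_mean (fun x : R => 2^-1 * cos ((j - k)%:~R * x) + 2^-1 * cos ((j + k)%:~R * x))).
    congr torus_mean; apply/funext => x; rewrite intrB intrD mulrBl mulrDl cosB cosD; by field.
  rewrite torus_meanD ?torus_meanZ ?torus_mean_cos; [|exact: cos_intD|exact: cos_intD|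
    by apply: intDZ; exact: cos_intD..].
  by rewrite subr_eq0 addr_eq0 -mulrDr mulrC.
rewrite [X in - X](_ : _ = 0) ?oppr0//.
transitivity (torus_mean (fun x : R => 2^-1 * sin ((k + j)%:~R * x) + 2^-1 * sin ((k - j)%:~R * x))).
  congr torus_mean; apply/funext => x; rewrite intrB intrD mulrBl mulrDl sinB sinD; by field.
rewrite torus_meanD ?torus_meanZ ?torus_mean_sin; [|exact: sin_intD|exact: sin_intD|
    by apply: intDZ; exact: sin_intD..].
by rewrite !mulr0 addr0.
Qed.

Lemma fourier_sin j k : fourier (fun x : R => sin (j%:~R * x)) k =
  (0 +i* (((j == - k)%:R - (j == k)%:R) / 2))%C.
Proof.
rewrite /fourier; apply/eqP; rewrite eq_complex /=; apply/andP; split; apply/eqP.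
  transitivity (torus_mean (fun x : R => 2^-1 * sin ((j + k)%:~R * x) + 2^-1 * sin ((j - k)%:~R * x))).
    congr torus_mean; apply/funext => x; rewrite intrB intrD mulrBl mulrDl sinB sinD; by field.
  rewrite torus_meanD ?torus_meanZ ?torus_mean_sin; [|exact: sin_intD|exact: sin_intD|
    by apply: intDZ; exact: sin_intD..].
  by rewrite !mulr0 addr0.
transitivity (- torus_mean (fun x : R => 2^-1 * cos ((j - k)%:~R * x) + - 2^-1 * cos ((j + k)%:~R * x))).
  congr (- torus_mean _); apply/funext => x; rewrite intrB intrD mulrBl mulrDl cosB cosD; by field.
rewrite torus_meanD ?torus_meanZ ?torus_mean_cos; [|exact: cos_intD|exact: cos_intD|
    by apply: intDZ; exact: cos_intD..].
by rewrite subr_eq0 addr_eq0; field.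
Qed.

End FourierCoefficients.

(** * Absolutely convergent Fourier series *)

Section FourierSeries.
Context {R : realType}.
Implicit Types (c : int -> R[i]) (k : int) (N M : nat) (L x : R).

Definition trigpoly c N x : R :=
  complex.Re (\sum_(k <- zrange N) c k * expi (k%:~R * x)).

(** With this multiplier [Qb] is plain convolution, the coefficient form of a pointwise product. *)
Definition one_mult (i j : int) : R[i] := 1.

Lemma Qb_herm N (m : int -> int -> R[i]) f g :
  (forall i j, m (- i) (- j) = (m i j)^*%C) -> herm f -> herm g -> herm (Qb N m f g).
Proof.
move=> hm hf hg k; rewrite /Qb sum_zrange_opp conj_sum; apply: eq_bigr => i _.
rewrite sum_zrange_opp conj_sum; apply: eq_bigr => j _.
rewrite (_ : (- k == - i - j) = (k == i + j)); last by apply/eqP/eqP; lia.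
by case: eqP => _; [rewrite !conjM hm hf hg | rewrite conjc0].
Qed.

Lemma one_mult_herm i j : one_mult (- i) (- j) = (one_mult i j)^*%C.
Proof. by rewrite /one_mult conjc1. Qed.

Lemma trigpolyE c N x : trigpoly c N x = \sum_(k <- zrange N)
  (complex.Re (c k) * cos (k%:~R * x) + - complex.Im (c k) * sin (k%:~R * x)).
Proof.
rewrite /trigpoly Re_sum; apply: eq_bigr => k _.
by case: (c k) => a b /=; rewrite mulNr.
Qed.

Lemma trigpoly_real c N x : herm c ->
  ((trigpoly c N x)%:C)%C = \sum_(k <- zrange N) c k * expi (k%:~R * x).
Proof.
move=> hc; rewrite /trigpoly; set T := \sum_(k <- _) _.
have : (T^*)%C = T.
  rewrite /T conj_sum sum_zrange_opp; apply: eq_bigr => k _.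
  by rewrite conjM -hc opprK mulrNz expiJ mulNr opprK.
case: T => a b [] /eqP; rewrite eq_sym -subr_eq0 opprK -mulr2n mulrn_eq0/= => /eqP ->.
by [].
Qed.

Lemma trigpoly_bound c N x : `|trigpoly c N x| <= \sum_(k <- zrange N) normc (c k).
Proof.
apply: le_trans (Re_le_normc _) _; apply: le_trans (normc_sum _ _) _.
by apply: ler_sum => k _; rewrite normcM normc_expi mulr1.
Qed.

Lemma trigpoly_continuous c N : continuous (trigpoly c N).
Proof.
rewrite (_ : trigpoly c N = fun x => \sum_(k <- zrange N)
  (complex.Re (c k) * cos (k%:~R * x) + - complex.Im (c k) * sin (k%:~R * x))); last first.
  by apply/funext => x; exact: trigpolyE.
elim: (zrange N) => [|k s IH] x.
  by under eq_fun do rewrite big_nil; exact: cvg_cst.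
under eq_fun do rewrite big_cons.
apply: cvgD; last exact: IH.
apply: cvgD; apply: cvgM; try exact: cvg_cst.
  exact: continuous_coskx.
exact: continuous_sinkx.
Qed.

Lemma trigpoly_measurable c N : measurable_fun [set: R] (trigpoly c N).
Proof. by apply: continuous_measurable_fun; exact: trigpoly_continuous. Qed.

Lemma trigpoly_sqint c N : sqint (trigpoly c N).
Proof. exact: bounded_sqint (trigpoly_measurable c N) (trigpoly_bound c N). Qed.

Lemma trigpoly_periodic c N : periodic (trigpoly c N) (pi *+ 2).
Proof.
move=> x; rewrite !trigpolyE; apply: eq_bigr => k _.
by rewrite (periodic_coskx k x) (periodic_sinkx k x).
Qed.

Lemma fourier_sum (s : seq int) (F : int -> R -> R) k :
  (forall j, sqint (F j)) ->
  sqint (fun x => \sum_(j <- s) F j x) /\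
  fourier (fun x => \sum_(j <- s) F j x) k = \sum_(j <- s) fourier (F j) k.
Proof.
move=> hF; elim: s => [|j s [IH1 IH2]].
  (* The zero function is presented as 0 * 0 so that homogeneity yields its coefficient. *)
  have h0 : sqint (fun _ : R => 0 * 0 : R) by apply: sqintZ; apply: (@bounded_sqint _ _ 0) => // x; rewrite normr0.
  under [X in sqint X]eq_fun do rewrite big_nil -(mul0r 0); split=> //.
  under [X in fourier X]eq_fun do rewrite big_nil -(mul0r 0).
  rewrite big_nil (@fourierZ _ 0 (fun=> 0)) ?rmorph0 ?mul0r//.
  by apply: (@bounded_sqint _ _ 0) => // x; rewrite normr0.
under [X in sqint X]eq_fun do rewrite big_cons; split; first exact: sqintD.
under [X in fourier X]eq_fun do rewrite big_cons.
by rewrite fourierD// IH2 big_cons.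
Qed.

(** Taking real parts splits each mode into half of c_j at j and half of its conjugate at - j;
    hermitian symmetry reunites the halves. *)
Lemma fourier_trigpoly c N k : herm c ->
  fourier (trigpoly c N) k = if k \in zrange N then c k else 0.
Proof.
move=> hc; rewrite (_ : trigpoly c N = fun x => \sum_(k <- zrange N)
  (complex.Re (c k) * cos (k%:~R * x) + - complex.Im (c k) * sin (k%:~R * x))); last first.
  by apply/funext => x; exact: trigpolyE.
have sc a j : sqint (fun x : R => a * cos (j%:~R * x)) by apply: sqintZ; exact: cos_sqint.
have ss a j : sqint (fun x : R => a * sin (j%:~R * x)) by apply: sqintZ; exact: sin_sqint.
have [|_ ->] := @fourier_sum (zrange N) (fun j x => complex.Re (c j) * cos (j%:~R * x) +
  - complex.Im (c j) * sin (j%:~R * x)) k; first by move=> j; exact: sqintD.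
transitivity (\sum_(j <- zrange N) ((if j == k then 2^-1 * c j else 0) +
   (if j == - k then 2^-1 * (c j)^*%C else 0))).
  apply: eq_bigr => j _; rewrite fourierD// !fourierZ; [|exact: sin_sqint|exact: cos_sqint].
  rewrite fourier_cos fourier_sin; case: (c j) => a b.
  have e2 : (2^-1 : R[i]) = ((2^-1 : R)%:C)%C by rewrite fmorphV rmorph_nat.
  by rewrite e2; apply/eqP; rewrite eq_complex; case: (j == k); case: (j == - k) => /=; apply/andP; split; apply/eqP; field.
rewrite big_split/= !(@sum_uniq_delta _ _ _ _ (fun j => 2^-1 * _)) ?zrange_uniq//.
rewrite !mem_zrange abszN hc conjcK; case: ifP => _; last by rewrite addr0.
by field.
Qed.

(** The inputs are cut at N, but the outputs reach 2 N; with the doubled range the identity is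
    exact. *)
Lemma trigpoly_sqr c N x : herm c ->
  trigpoly c N x ^+ 2 = trigpoly (Qb N one_mult c c) N.*2 x.
Proof.
move=> hc; apply: complexI; rewrite trigpoly_real; last first.
  by apply: Qb_herm => //; exact: one_mult_herm.
rewrite rmorphXn /= trigpoly_real// expr2 mulr_suml.
under [RHS]eq_bigr => k _ do rewrite /Qb mulr_suml.
rewrite exchange_big/= big_seq [RHS]big_seq; apply: eq_bigr => i iN.
rewrite mulr_sumr; under [RHS]eq_bigr => k _ do rewrite mulr_suml.
rewrite exchange_big/= big_seq [RHS]big_seq; apply: eq_bigr => j jN.
transitivity (\sum_(k <- zrange N.*2) (if k == i + j then c i * c j * expi ((i + j)%:~R * x) else 0)).
  rewrite (@sum_uniq_delta _ _ _ _ (fun=> c i * c j * expi ((i + j)%:~R * x))) ?zrange_uniq//.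
  rewrite ifT; first by rewrite intrD mulrDl expiD; ring.
  by move: iN jN; rewrite !mem_zrange; lia.
apply: eq_bigr => k _; case: eqP => [->|_]; last by rewrite mul0r.
by rewrite /one_mult mul1r.
Qed.

Definition fser c x : R := lim (trigpoly c N x @[N --> \oo]).

Lemma fmultE (sigma : int -> R[i]) u : fmult sigma u = fser (fun k => sigma k * fourier u k).
Proof.
apply/funext => x; rewrite /fmult /fser; congr (lim (_ @ \oo)); apply/funext => N.
by rewrite /trigpoly /zrange big_map -(subn0 N.*2.+1) -/(index_iota 0 _) big_mkord subn0.
Qed.

Lemma fser_periodic c : periodic (fser c) (pi *+ 2).
Proof.
by move=> x; rewrite /fser; under eq_fun do rewrite trigpoly_periodic.
Qed.

Section AbsolutelySummable.
Variables (c : int -> R[i]) (L : R).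
Hypotheses (hc : herm c) (cL : forall N, \sum_(k <- zrange N) normc (c k) <= L).

Lemma fser_approx : exists2 e : nat -> R, e @ \oo --> (0 : R) &
  forall N x, `|trigpoly c N x - fser c x| <= e N.
Proof.
pose t N := \sum_(k <- zrange N) normc (c k).
have tnd : nondecreasing_seq t.
  by move=> N M; apply: le_sum_zrange => k; exact: normc_ge0.
have tub : has_ubound (range t) by exists L => _ [N _ <-]; exact: cL.
have tcv := nondecreasing_cvgn tnd tub.
have tle N : t N <= sup (range t) by apply: ub_le_sup => //; exists N.
exists (fun N => sup (range t) - t N).
  by rewrite -[X in _ --> X](subrr (sup (range t))); apply: cvgB => //; exact: cvg_cst.
have diff N M x : (N <= M)%N -> `|trigpoly c M x - trigpoly c N x| <= t M - t N.
  move=> NM; rewrite /trigpoly -ReB /t !zrange_diff//.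
  apply: le_trans (Re_le_normc _) _; rewrite -[X in normc X]big_filter -[leRHS]big_filter.
  apply: le_trans (normc_sum _ _) _.
  by apply: ler_sum => k _; rewrite normcM normc_expi mulr1.
have cv x : trigpoly c N x @[N --> \oo] --> fser c x.
  (* Increments of the partial sums are dominated by those of t, so adding t makes the sequence
     monotone, and it is bounded by L + L. *)
  have h : cvgn (fun N => trigpoly c N x + t N).
    apply: nondecreasing_is_cvgn.
      move=> N M NM; rewrite -lerBlDr -addrA -lerBrDl -opprB lerNl.
      have := diff N M x NM; rewrite ler_norml => /andP[+ _]; lra.
    exists (L + L) => _ [N _ <-]; apply: lerD; last exact: cL.
    by apply: le_trans (ler_norm _) _; apply: le_trans (trigpoly_bound _ _ _) _.
  have : cvgn (fun N => (trigpoly c N x + t N) - t N).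
    by apply: (is_cvgB h); exact: cvgP tcv.
  by under eq_fun do rewrite addrK.
move=> N x.
have c1 : `|trigpoly c N x - trigpoly c M x| @[M --> \oo] --> `|trigpoly c N x - fser c x|.
  by apply: cvg_norm; apply: cvgB => //; exact: cvg_cst.
apply: (cvgr_to_le c1); exists N => // M /= NM.
by rewrite distrC; apply: le_trans (diff N M x NM) _; rewrite lerD2r.
Qed.

Lemma fser_measurable : measurable_fun [set: R] (fser c).
Proof.
have [e e0 he] := fser_approx.
apply: (@measurable_fun_cvg _ _ _ _ (trigpoly c)) => [N|x _].
  exact: trigpoly_measurable.
apply/cvgrPdist_lt => d d0; have /cvgrPdist_lt/(_ d d0) := e0; apply: filterS => N.
rewrite sub0r normrN => h; rewrite distrC; apply: le_lt_trans (he N x) _.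
by apply: le_lt_trans (ler_norm _) h.
Qed.

Lemma fser_cvg x : trigpoly c N x @[N --> \oo] --> fser c x.
Proof.
have [e e0 he] := fser_approx.
apply/cvgrPdist_lt => d d0; have /cvgrPdist_lt/(_ d d0) := e0; apply: filterS => N.
rewrite sub0r normrN => h; rewrite distrC; apply: le_lt_trans (he N x) _.
by apply: le_lt_trans (ler_norm _) h.
Qed.

Lemma fser_bounded x : `|fser c x| <= L.
Proof.
apply: (cvgr_to_le (cvg_norm (fser_cvg (x := x)))); apply: nearW => N.
by apply: le_trans (trigpoly_bound _ _ _) _.
Qed.

Lemma fser_sqint : sqint (fser c).
Proof. exact: bounded_sqint fser_measurable fser_bounded. Qed.

Lemma fourier_fser k : fourier (fser c) k = c k.
Proof.
have [e e0 he] := fser_approx.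
have h1 := fourier_lim k (trigpoly_measurable c) (trigpoly_sqint c) fser_sqint he e0.
apply: (cvgC_unique h1); rewrite /cvgC; apply: cvg_near_cst.
exists `|k|%N => // N /= kN; rewrite fourier_trigpoly// mem_zrange kN subrr.
by rewrite normc0.
Qed.

(** The partial sums are bounded by L and converge uniformly, hence so do their squares, and
    coefficients pass to the limit. This links the square of a function to the truncated
    convolutions. *)
Lemma fourier_fser_sqr k :
  cvgC (fun N => Qb N one_mult c c k) (fourier (fun x => fser c x ^+ 2) k).
Proof.
have [e e0 he] := fser_approx.
have L0 : 0 <= L by apply: le_trans (cL 0); apply: sumr_ge0 => i _; exact: normc_ge0.
have m2 N : measurable_fun [set: R] (fun x => trigpoly c N x ^+ 2).
  by apply: measurable_funX; exact: trigpoly_measurable.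
have s2 N : sqint (fun x => trigpoly c N x ^+ 2).
  rewrite (_ : (fun x => _) = trigpoly (Qb N one_mult c c) N.*2); first exact: trigpoly_sqint.
  by apply/funext => x; exact: trigpoly_sqr.
have sf : sqint (fun x => fser c x ^+ 2).
  apply: (@bounded_sqint _ _ (L ^+ 2)); first by apply: measurable_funX; exact: fser_measurable.
  by move=> x; rewrite normrX lerXn2r// ?nnegrE//; exact: fser_bounded.
have h N x : `|trigpoly c N x ^+ 2 - fser c x ^+ 2| <= e N * (2 * L).
  rewrite subr_sqr normrM; apply: ler_pM => //.
  apply: le_trans (ler_normD _ _) _; rewrite mulr_natl mulr2n; apply: lerD.
    by apply: le_trans (trigpoly_bound _ _ _) _.
  exact: fser_bounded.
have e2 : (fun N => e N * (2 * L)) @ \oo --> (0 : R).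
  by rewrite -[X in _ --> X](mul0r (2 * L)); apply: cvgM => //; exact: cvg_cst.
have E N : (`|k| <= N)%N -> fourier (fun x => trigpoly c N x ^+ 2) k = Qb N one_mult c c k.
  move=> kN; rewrite (_ : (fun x => trigpoly c N x ^+ 2) =
    trigpoly (Qb N one_mult c c) N.*2); last by apply/funext => x; exact: trigpoly_sqr.
  rewrite fourier_trigpoly; last by apply: Qb_herm => //; exact: one_mult_herm.
  by rewrite ifT// mem_zrange; move: kN; lia.
have := fourier_lim k m2 s2 sf h e2.
rewrite /cvgC => H; apply: cvg_trans H; apply: near_eq_cvg.
by exists `|k|%N => // N kN; rewrite E.
Qed.

End AbsolutelySummable.

End FourierSeries.

(** * The Sobolev norm in terms of coefficients *)

Section HnormBnd.
Context {R : realType}.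
Implicit Types (u w : R -> R) (k : int) (n N : nat) (K : R).

(** Every finite set of integers lies in a symmetric range, so these ranges suffice for the supremum
    that defines the sum over all frequencies. *)
Lemma esum_zrangeP (F : int -> R) K : (forall k, 0 <= F k) ->
  (\esum_(k in [set: int]) (F k)%:E <= K%:E)%E <->
  (forall N, \sum_(k <- zrange N) F k <= K).
Proof.
move=> F0; split=> [h N|h].
  rewrite -lee_fin -sumEFin; apply: le_trans h; apply: esum_ge.
  exists [set` zrange N]; first by split=> //; exact: finite_seq.
  by rewrite -fsbig_seq ?zrange_uniq.
apply: ge_ereal_sup => _ [X [finX _] <-].
rewrite fsbig_finite//; set s := finmap.enum_fset _.
have us : uniq s by exact: finmap.fset_uniq.
pose N := \max_(k <- s) `|k|%N.
apply: le_trans (_ : (\sum_(k <- zrange N) F k)%:E <= _)%E; last by rewrite lee_fin.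
have p : perm_eq s [seq k <- zrange N | k \in s].
  apply: uniq_perm => //; first by rewrite filter_uniq// zrange_uniq.
  move=> k; rewrite mem_filter mem_zrange; case ks : (k \in s) => //=.
  by apply/esym; exact: (@leq_bigmax_seq _ _ _ (fun k : int => `|k|%N)).
rewrite sumEFin lee_fin (perm_big _ p) big_filter [leRHS](bigID (mem s))/=.
by rewrite lerDl sumr_ge0.
Qed.

(** The weights <k> and |k| differ at k = 0 only; there the n-th powers agree for n = 0, and
    otherwise the mean has to vanish. *)
Lemma HnormP n u K : (n == 0)%N || (fourier u 0 == 0) -> 0 <= K ->
  (Hnorm n%:R u <= K%:E)%E <-> bnd n (fourier u) K.
Proof.
move=> n0 K0; rewrite /Hnorm.
have -> : K%:E = sqrte (K ^+ 2)%:E by rewrite /= sqrtr_sqr ger0_norm.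
rewrite lee_sqrt ?lee_fin ?sqr_ge0//.
have E k : jbracket k `^ (2 * n%:R) * normc (fourier u k) ^+ 2 =
    (`|k%:~R : R| ^+ n * normc (fourier u k)) ^+ 2.
  rewrite /jbracket exprMn; case: eqP => [->|_].
    rewrite powR1 mulr0z normr0; move: n0 => /orP[/eqP ->|/eqP ->].
      by rewrite expr0 expr1n.
    by rewrite normc0 expr0n !mulr0.
  by rewrite powRrM powR_mulrn ?powR_ge0// powR_mulrn// -!exprM mulnC.
rewrite /bnd /hs; split.
  move=> h; split=> // N; move/(esum_zrangeP _ _) : h => /(_ _ N).
  under eq_bigr do rewrite E.
  by apply=> k; rewrite E sqr_ge0.
move=> [_ h]; apply/esum_zrangeP => [k|N]; first by rewrite E sqr_ge0.
by under eq_bigr do rewrite E; exact: h.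
Qed.

Lemma in_Hdot_sqint n u : in_Hdot n%:R u -> sqint u.
Proof. by case. Qed.

Lemma in_Hdot_bnd n u : in_Hdot n%:R u -> exists K, bnd n (fourier u) K.
Proof.
move=> [_ _ _ u0 fin]; exists (fine (Hnorm n%:R u)).
have H0 : (0 <= Hnorm n%:R u)%E by exact: sqrte_ge0.
apply/HnormP; rewrite ?u0 ?eqxx ?orbT ?fine_ge0//.
by rewrite fineK// ge0_fin_numE.
Qed.

Lemma in_HdotI n u K : periodic u (pi *+ 2) -> sqint u -> fourier u 0 = 0 ->
  bnd n (fourier u) K -> in_Hdot n%:R u.
Proof.
move=> pu [mu_ iu] u0 hK; split=> //; apply: le_lt_trans (ltry K).
by apply/HnormP => //; [rewrite u0 eqxx orbT | case: hK].
Qed.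

End HnormBnd.

(** * Coefficients of the scheme and of the equation *)

Section Coefficients.
Context {R : realType}.
Implicit Types (u w : R -> R) (k : int) (N : nat) (s t tau L Z : R) (sigma : int -> R[i]).

Definition asym s k : R[i] := expi (- (s * k%:~R ^+ 3)).

Lemma asym_herm s k : asym s (- k) = (asym s k)^*%C.
Proof. by rewrite /asym expiJ mulrNz; congr expi; ring. Qed.

Lemma normc_asym s k : normc (asym s k) = 1.
Proof. exact: normc_expi. Qed.

Lemma asym_ph s i j : asym s (i + j) * (asym (- s) i * asym (- s) j) = ph s i j.
Proof. by rewrite /asym /ph -!expiD intrD; congr expi; ring. Qed.

Definition isym k : R[i] := if k == 0 then 0 else (0 +i* k%:~R)^-1%C.

Lemma isymE k : isym k = (0 +i* (- k%:~R^-1))%C.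
Proof.
rewrite /isym; case: eqP => [->|/eqP k0]; first by rewrite mulr0z invr0 oppr0.
have kR : (k%:~R : R) != 0 by rewrite intr_eq0.
apply/eqP; rewrite eq_complex /= mul0r expr0n add0r; apply/andP; split=> //.
by apply/eqP; field.
Qed.

Lemma isym_herm k : isym (- k) = (isym k)^*%C.
Proof. by rewrite !isymE mulrNz invrN. Qed.

Lemma normc_isym k : normc (isym k) = `|k%:~R|^-1.
Proof. by rewrite isymE /= expr0n add0r sqrtr_sqr normrN normfV. Qed.

Lemma isymM i j : isym i * isym j = ((- (i%:~R * j%:~R)^-1)%:C)%C.
Proof. by rewrite !isymE; apply/eqP; rewrite eq_complex /= invfM; apply/andP; split; apply/eqP; ring. Qed.

Lemma herm_mul sigma f : (forall k, sigma (- k) = (sigma k)^*%C) -> herm f ->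
  herm (fun k => sigma k * f k).
Proof. by move=> hs hf k; rewrite conjM hs hf. Qed.

Lemma bnd_l1 (a : int -> R[i]) Z N : bnd 1 a Z ->
  \sum_(k <- zrange N) normc (a k) <= normc (a 0) + 2 * Z.
Proof.
move=> ha; pose a' k := if k == 0 then 0 else a k.
have ha' : bnd 1 a' Z.
  apply: bnd_le ha => k; rewrite /a'; case: eqP => // ->.
  by rewrite normc0 mulr0 term_ge0.
have a'0 : a' 0 = 0 by [].
have := bnd_sum N a'0 ha'.
have z0 : 0 \in zrange N by rewrite mem_zrange.
rewrite !(bigD1_seq 0 z0 (zrange_uniq N)) => h; rewrite lerD2l.
apply: le_trans h; rewrite a'0 normc0 mulr0 [leRHS]add0r.
by apply: ler_sum => k /negPf k0; rewrite /a' k0 expr0 mul1r.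
Qed.

(** Up to the factor 1/24, both terms of the midpoint increment are values of this map, at s = t +
    tau and s = t. *)
Definition Gpart s w : R -> R := airy s (fun y => airy (- s) (dx_inv w) y ^+ 2).

Lemma cvgC_Qb_mult k (f g : int -> R[i]) (m : int -> int -> R[i]) (b l : R[i]) :
  cvgC (fun N => Qb N one_mult f f k) l ->
  (forall i j, k = i + j -> b * (f i * f j) = m i j * g i * g j) ->
  cvgC (fun N => Qb N m g g k) (b * l).
Proof.
move=> h E; have := cvgCM b h; rewrite /cvgC.
under eq_fun => N.
  rewrite QbZ (_ : Qb _ _ _ _ _ = Qb N m g g k); last first.
    by apply: Qb_ext => i j kij; rewrite /one_mult mulr1 -mulrA E.
  over.
by [].
Qed.

(** The antiderivative takes l^2 to h^1, where coefficients are absolutely summable, and squaring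
    preserves h^1. Each multiplier of the composition thus acts on an absolutely convergent series,
    whose coefficients are the expected ones. *)
Lemma Gpart_spec s w Z : sqint w -> bnd 0 (fourier w) Z ->
  [/\ sqint (Gpart s w), periodic (Gpart s w) (pi *+ 2) &
   forall k, cvgC (fun N => Qb N (mG s) (fourier w) (fourier w) k)
     ((24^-1%:C)%C * fourier (Gpart s w) k)].
Proof.
move=> sw hZ; have hw := fourier_herm sw; set z := fourier w in hZ hw *.
pose c1 k := isym k * z k.
have hc1 : herm c1 by apply: herm_mul => //; exact: isym_herm.
have bc1 : bnd 1 c1 Z.
  apply: bnd_le hZ => k; rewrite /c1 normcM normc_isym expr1 expr0 mul1r mulrA.
  have [->|k0] := eqVneq (`|k%:~R| : R) 0; first by rewrite !mul0r normc_ge0.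
  by rewrite divff// mul1r.
have c10 : c1 0 = 0 by rewrite /c1 isymE mulr0z invr0 oppr0 mul0r.
have lc1 N := bnd_l1 N bc1.
have e1 : dx_inv w = fser c1 by rewrite /dx_inv fmultE.
pose c2 k := asym (- s) k * c1 k.
have hc2 : herm c2 by apply: herm_mul => //; exact: asym_herm.
have nc2 k : normc (c2 k) = normc (c1 k) by rewrite normcM normc_asym mul1r.
have bc2 : bnd 1 c2 Z by apply: bnd_le bc1 => k; rewrite nc2.
have lc2 N := bnd_l1 N bc2.
have e2 : airy (- s) (dx_inv w) = fser c2.
  rewrite e1 /airy fmultE; congr fser; apply/funext => k.
  by rewrite (fourier_fser hc1 lc1).
pose F k := fourier (fun x => fser c2 x ^+ 2) k.
have sF : sqint (fun x => fser c2 x ^+ 2).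
  apply: (@bounded_sqint _ _ ((normc (c2 0) + 2 * Z) ^+ 2)).
    by apply: measurable_funX; exact: fser_measurable lc2.
  move=> x; have h := fser_bounded lc2 x; rewrite normrX lerXn2r// nnegrE//.
  exact: le_trans h.
have hF : herm F by exact: fourier_herm.
have limF k := fourier_fser_sqr hc2 lc2 k.
have c20 : c2 0 = 0 by rewrite /c2 c10 mulr0.
have bF : bnd 1 F (4 * 1 * Z * Z).
  apply: (bnd_lim limF) => N; apply: (@Qb_bound_pow _ 1 1) => // i j.
  by rewrite /one_mult ComplexField.Normc.normc1 mulr1 !expr1 mul1r zaD.
pose c3 k := asym s k * F k.
have hc3 : herm c3 by apply: herm_mul => //; exact: asym_herm.
have bc3 : bnd 1 c3 (4 * 1 * Z * Z).
  by apply: bnd_le bF => k; rewrite normcM normc_asym mul1r.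
have lc3 N := bnd_l1 N bc3.
have e3 : Gpart s w = fser c3 by rewrite /Gpart e2 /airy fmultE.
rewrite e3; split; [exact: fser_sqint lc3|exact: fser_periodic|move=> k].
rewrite (fourier_fser hc3 lc3) /c3 mulrA; apply: cvgC_Qb_mult (limF k) _ => i j ->.
rewrite /c2 /c1 /mG -asym_ph.
have -> : ((- (24 * (i%:~R * j%:~R))^-1)%:C)%C = (24^-1%:C)%C * (isym i * isym j) :> R[i].
  by rewrite isymM -realCM; congr (_%:C)%C; rewrite invfM mulrN.
move: (_%:C)%C (asym _ _) (asym _ _) (asym _ _) (isym _) (isym _) (z _) (z _).
by move=> *; ring.
Qed.

Lemma midpoint_map_spec tau t vn w Z : sqint w -> sqint vn ->
  bnd 0 (fourier (w \+ vn)) Z ->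
  exists g, [/\ midpoint_map tau t vn w = (fun x => vn x + g x), sqint g,
   periodic g (pi *+ 2) &
   forall k, cvgC (fun N => Qb N (mB t tau) (fourier (w \+ vn)) (fourier (w \+ vn)) k)
     (fourier g k)].
Proof.
move=> sw sv hZ; have swv : sqint (w \+ vn) by exact: sqintD.
have [s1 p1 l1] := Gpart_spec (t + tau) swv hZ.
have [s2 p2 l2] := Gpart_spec t swv hZ.
have E : midpoint_map tau t vn w = (fun x => vn x +
    (24^-1 * Gpart (t + tau) (w \+ vn) x - 24^-1 * Gpart t (w \+ vn) x)).
  by apply/funext => x; rewrite /midpoint_map addrA.
rewrite {}E; move: (Gpart (t + tau) _) (Gpart t _) s1 p1 l1 s2 p2 l2 => g1 g2 s1 p1 l1 s2 p2 l2.
exists (fun x => 24^-1 * g1 x - 24^-1 * g2 x); split=> //.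
- by apply: sqintB; apply: sqintZ.
- by move=> x; rewrite p1 p2.
move=> k; rewrite fourierB; [|exact: sqintZ..].
rewrite (fourierZ _ _ s1) (fourierZ _ _ s2); have := cvgCB (l1 k) (l2 k); rewrite /cvgC.
by under [in X in X -> _]eq_fun do rewrite -QbBm.
Qed.

(** Two derivatives on w: the square stays in h^2, and the derivative that follows still leaves an
    h^1, hence absolutely summable, sequence. *)
Lemma twisted_rhs_spec t w Z : sqint w -> fourier w 0 = 0 -> bnd 2 (fourier w) Z ->
  sqint (twisted_rhs t w) /\
  forall k, cvgC (fun N => Qb N (mP t) (fourier w) (fourier w) k)
     (fourier (twisted_rhs t w) k).
Proof.
move=> sw w0 hZ; have hw := fourier_herm sw.
have hZ1 := bnd_lower (isT : (1 <= 2)%N) w0 hZ.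
pose c1 k := asym (- t) k * fourier w k.
have hc1 : herm c1 by apply: herm_mul => //; exact: asym_herm.
have nc1 k : normc (c1 k) = normc (fourier w k) by rewrite normcM normc_asym mul1r.
have bc1 : bnd 1 c1 Z by apply: bnd_le hZ1 => k; rewrite nc1.
have bc12 : bnd 2 c1 Z by apply: bnd_le hZ => k; rewrite nc1.
have lc1 N := bnd_l1 N bc1.
have c10 : c1 0 = 0 by rewrite /c1 w0 mulr0.
have e1 : airy (- t) w = fser c1 by rewrite /airy fmultE.
pose F k := fourier (fun x => fser c1 x ^+ 2) k.
have sF : sqint (fun x => fser c1 x ^+ 2).
  apply: (@bounded_sqint _ _ ((normc (c1 0) + 2 * Z) ^+ 2)).
    by apply: measurable_funX; exact: fser_measurable lc1.
  move=> x; have h := fser_bounded lc1 x; rewrite normrX lerXn2r// nnegrE//.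
  exact: le_trans h.
have hF : herm F by exact: fourier_herm.
have limF k := fourier_fser_sqr hc1 lc1 k.
have bF : bnd 2 F (4 * 2 * Z * Z).
  apply: (bnd_lim limF) => N; apply: (@Qb_bound_pow _ 2 2) => // i j.
  by rewrite /one_mult ComplexField.Normc.normc1 mulr1; apply: sqrD_le => //; exact: zaD.
pose c2 k := (0 +i* k%:~R)%C * F k.
have hc2 : herm c2.
  by apply: herm_mul => // k; rewrite mulrNz.
have bc2 : bnd 1 c2 (4 * 2 * Z * Z).
  apply: bnd_le bF => k; rewrite normcM mulrA expr1.
  have -> : normc (0 +i* k%:~R)%C = `|k%:~R| :> R by rewrite /= expr0n add0r sqrtr_sqr.
  by rewrite expr2.
have lc2 N := bnd_l1 N bc2.
have e2 : dx (fun y => airy (- t) w y ^+ 2) = fser c2 by rewrite e1 /dx fmultE.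
pose c3 k := asym t k * c2 k.
have hc3 : herm c3 by apply: herm_mul => //; exact: asym_herm.
have bc3 : bnd 1 c3 (4 * 2 * Z * Z).
  by apply: bnd_le bc2 => k; rewrite normcM normc_asym mul1r.
have lc3 N := bnd_l1 N bc3.
have e3 : airy t (dx (fun y => airy (- t) w y ^+ 2)) = fser c3.
  rewrite e2 /airy fmultE; congr fser; apply/funext => k.
  by rewrite (fourier_fser hc2 lc2).
have s3 := fser_sqint lc3.
rewrite /twisted_rhs e3; split; first exact: sqintZ.
move=> k; rewrite (fourierZ _ _ s3) (fourier_fser hc3 lc3) /c3 /c2 !mulrA.
apply: cvgC_Qb_mult (limF k) _ => i j ->.
rewrite /c1 /mP -asym_ph.
have -> : (0 +i* ((i + j)%:~R / 2))%C = (2^-1%:C)%C * (0 +i* (i + j)%:~R)%C :> R[i].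
  apply/eqP; rewrite eq_complex /= !(mul0r, mulr0, subr0, addr0); apply/andP; split=> //.
  by rewrite mulrC.
move: (_%:C)%C (_ +i* _)%C (asym _ _) (asym _ _) (asym _ _) (fourier _ _) (fourier _ _).
by move=> *; ring.
Qed.

End Coefficients.

(** * One step of the scheme, on coefficients *)

Section Step.
Context {R : realType}.
Implicit Types (a b d e z V E : int -> R[i]) (r N M : nat) (t tau rho K X Z eta v eps : R).

(** The error recursion needs the actual norm and not just some bound. It is meaningful when some
    [bnd r a K] holds; otherwise [sup] takes its default value. *)
Definition nrm r a : R := Num.sqrt (sup (range (hs r a))).

Lemma nrm_ge0 r a : 0 <= nrm r a.
Proof. exact: sqrtr_ge0. Qed.

Lemma nrm_sqr_le r a X : (forall M, hs r a M <= X) -> nrm r a ^+ 2 <= X.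
Proof.
move=> h; have s0 : 0 <= sup (range (hs r a)).
  apply: le_trans (hs_ge0 r a 0) _; apply: ub_le_sup; last by exists 0%N.
  by exists X => _ [M _ <-].
rewrite /nrm sqr_sqrtr//; apply: ge_sup; first by exists (hs r a 0), 0%N.
by move=> _ [M _ <-].
Qed.

Lemma bnd_nrm r a K : bnd r a K -> bnd r a (nrm r a).
Proof.
move=> [K0 h]; split=> [|M]; first exact: nrm_ge0.
have hM : hs r a M <= sup (range (hs r a)).
  by apply: ub_le_sup; [exists (K ^+ 2) => _ [n _ <-] | exists M].
by rewrite /nrm sqr_sqrtr// (le_trans (hs_ge0 r a M)).
Qed.

Lemma nrm_le r a K : bnd r a K -> nrm r a <= K.
Proof. by move=> [K0 h]; rewrite -ler_sqr ?nnegrE ?nrm_ge0//; exact: nrm_sqr_le. Qed.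

(** The increment is a coefficientwise limit, so estimates of [Qb] uniform in N carry over to it. *)
Definition incr t tau z b : Prop :=
  forall k, cvgC (fun N => Qb N (mB t tau) z z k) (b k).

Lemma incr_bnd1 t tau z b Z : incr t tau z b -> bnd 0 z Z -> bnd 1 b (4 * 1 * Z * Z).
Proof.
by move=> h hz; apply: (bnd_lim h) => N; apply: Qb_bound_inv => // i j; exact: mB_smoothing.
Qed.

Lemma incr_bnd0 t tau z b Z eps : 0 < eps -> 0 <= tau -> 2 * tau <= eps ^+ 4 ->
  incr t tau z b -> bnd 0 z Z -> bnd 0 b (4 * eps * Z * Z).
Proof.
move=> e0 tau0 te h hz; apply: (bnd_lim h) => N.
by apply: Qb_bound_inv => // [|i j]; [exact: ltW | exact: mB_small].
Qed.

Lemma incr_diff t tau z b z' b' : incr t tau z b -> incr t tau z' b' ->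
  forall k, cvgC (fun N => Qb N (mB t tau) (fun i => z i - z' i) (fun i => z i + z' i) k)
    (b k - b' k).
Proof.
move=> h h' k; have := cvgCB (h k) (h' k); rewrite /cvgC.
by under [in X in X -> _]eq_fun do rewrite (Qb_polar _ _ _ _ (mB_sym t tau)).
Qed.

(** The phase is 0 at both times and the two exponentials cancel: this is how the scheme preserves
    zero mean. *)
Lemma mB_antidiag t tau (i j : int) : i + j = 0 -> mB t tau i j = 0.
Proof. by move=> ij; rewrite mBE /ph ij mulr0z !mulr0 subrr mulr0. Qed.

Lemma incr_zero t tau z b : incr t tau z b -> b 0 = 0.
Proof.
move=> h; apply: (cvgC_unique (h 0)).
suff -> : (fun N => Qb N (mB t tau) z z 0) = (fun=> 0) by exact: cvgC_cst.
apply/funext => N; rewrite /Qb big1// => i _; rewrite big1// => j _.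
by case: eqP => // /esym /mB_antidiag ->; rewrite !mul0r.
Qed.

Lemma herm_lim (Q : nat -> int -> R[i]) b : (forall N, herm (Q N)) ->
  (forall k, cvgC (Q ^~ k) (b k)) -> herm b.
Proof.
move=> hQ h k; apply: (cvgC_unique (h (- k))).
rewrite /cvgC (_ : (fun N => _) = (fun N => normc (Q N k - b k))); first exact: h.
apply/funext => N; rewrite hQ -normcJ; congr normc.
by case: (Q N k) (b k) => [x y] [x' y']; apply/eqP; rewrite eq_complex /= opprD !opprK !eqxx.
Qed.

Lemma le_addeps (x y : R) : (forall e : R, 0 < e -> x <= y + e) -> x <= y.
Proof. by move=> h; apply/ler_addgt0Pr. Qed.

(* The l2 norm is conserved, which makes the threshold for the step size
   independent of the number of steps. *)
Lemma incr_conserve t tau a b K rho : herm a -> a 0 = 0 -> herm b ->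
  incr t tau (fun k => a k + b k + a k) b ->
  bnd 0 a rho -> bnd 0 b K -> bnd 0 (fun k => a k + b k) rho.
Proof.
move=> ha a0 hb h hrho hK; have [rho0 hr] := hrho.
have b0 := incr_zero h.
have hz : bnd 0 (fun k => a k + b k + a k) (rho + K + rho).
  by apply: bndD => //; apply: bndD.
split=> // M; apply: le_addeps => e e0.
have hh : herm (fun k => a k + b k + a k).
  by move=> k; rewrite ha hb !rmorphD.
have z0 : (fun k => a k + b k + a k) 0 = 0 by rewrite a0 b0 !addr0.
(* Only uniformity in N matters here: the constant feeds [pairing_lim] and leaves no trace in the
   conclusion. *)
have Qbd N : bnd 0 (Qb N (mB t tau) (fun k => a k + b k + a k) (fun k => a k + b k + a k))
    (4 * 1 * (rho + K + rho) * (rho + K + rho)).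
  apply: (@bnd_lower _ 0 1) => //.
    apply/eqP; rewrite /Qb big1// => i _; rewrite big1// => j _.
    by case: eqP => // /esym /mB_antidiag ->; rewrite !mul0r.
  by apply: Qb_bound_inv => // i j; exact: mB_smoothing.
have [|M0 hM0] := pairing_lim h Qbd hz (X := 0) _ e0.
  by move=> N; rewrite pr0_mB_self.
pose M' := maxn M M0.
apply: le_trans (le_hs _ _ (leq_maxl M M0)) _.
have E := hsB 0 a (fun k => a k + b k) (maxn M M0).
have := hM0 _ (leq_maxr M M0); rewrite add0r.
have -> : pr 0 b (fun k => a k + b k + a k) (maxn M M0) =
  pr 0 (fun k => a k + b k - a k) (fun k => a k + b k + a k) (maxn M M0).
  by apply: eq_pr => // k; rewrite addrC addKr.
rewrite -E; have := hr (maxn M M0); lra.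
Qed.

(** The difference of the squared norms is the pairing of d + b with E = e + e'. The term in d is a
    Cauchy-Schwarz product; in b, the part linear in V uses the energy cancellation and the part -
    Q(E, E) the crude sqrt tau bound. *)
Lemma error_step t tau e e' d b V v x x' delta eta :
  0 <= tau -> herm e -> herm e' -> e 0 = 0 -> e' 0 = 0 -> V 0 = 0 ->
  bnd 1 e x -> bnd 1 (fun k => e k + e' k) eta -> bnd 1 d delta -> bnd 3 V v ->
  (forall k, e' k = e k + d k + b k) ->
  (forall k, cvgC (fun N => Qb N (mB t tau) (fun i => e i + e' i)
     (fun i => V i - (e i + e' i)) k) (b k)) ->
  x' = nrm 1 e' ->
  x' ^+ 2 <= x ^+ 2 + (delta * eta + 2 * tau * eta ^+ 2 * v + 8 * Num.sqrt tau * eta ^+ 3).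
Proof.
move=> tau0 he he' e0 e'0 V0 hx hE hd hV ee hb ->.
pose E k := e k + e' k.
have [x0 hx1] := hx; have [eta0 _] := hE.
have E0 : E 0 = 0 by rewrite /E e0 e'0 addr0.
have hhE : herm E by move=> k; rewrite /E he he' rmorphD.
have bV1 := bnd_lower (isT : (1 <= 3)%N) V0 hV.
have T2 := fun i j => mB_le_sqrt t i j tau0.
have s0 : 0 <= 2 * Num.sqrt tau by rewrite mulr_ge0 ?sqrtr_ge0.
have Qbd N : bnd 1 (Qb N (mB t tau) E (fun i => V i - E i))
   (4 * (2 * Num.sqrt tau) * eta * (v + eta)).
  apply: (Qb_bound_pow _ s0 (isT : (0 < 1)%N) T2) => //; first by rewrite V0 E0 subr0.
  exact: bndB.
have QEE N : bnd 1 (Qb N (mB t tau) E E) (4 * (2 * Num.sqrt tau) * eta * eta).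
  exact: (Qb_bound_pow _ s0 (isT : (0 < 1)%N) T2).
apply: nrm_sqr_le => M; apply: le_addeps => eps eps0.
have [|M0 hM0] := pairing_lim hb Qbd hE
   (X := 2 * tau * eta ^+ 2 * v + 8 * Num.sqrt tau * eta ^+ 3) _ eps0.
  move=> N; rewrite (@eq_pr _ _ _ (fun k => Qb N (mB t tau) E V k - Qb N (mB t tau) E E k)
    _ E); last by []; last by move=> k; exact: QbBr.
  rewrite prBl; apply: lerD; first exact: pr1_mB_energy.
  have := pr_le N (bndN (QEE N)) hE.
  rewrite (_ : pr 1 (fun k => - Qb N (mB t tau) E E k) E N = - pr 1 (Qb N (mB t tau) E E) E N).
    by have -> : 4 * (2 * Num.sqrt tau) * eta * eta * eta = 8 * Num.sqrt tau * eta ^+ 3 by ring.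
  rewrite /pr -sumrN; apply: eq_bigr => k _; rewrite mulNr -[RHS]mulrN; congr (_ * _).
  by case: (_ * _).
pose M' := maxn M M0.
apply: le_trans (le_hs _ _ (leq_maxl M M0)) _.
have h1 := hsB 1 e e' M'; have h2 := hM0 M' (leq_maxr M M0).
have h3 := pr_le M' hd hE; have h4 := hx1 M'.
have h5 : pr 1 (fun k => e' k - e k) (fun k => e' k + e k) M' = pr 1 d E M' + pr 1 b E M'.
  rewrite -prDl; apply: eq_pr => k; last by rewrite /E addrC.
  by rewrite ee; ring.
move: h1 h2 h3 h4 h5; rewrite -/M'; lra.
Qed.

End Step.

(** * One step of the scheme, on functions *)

Section Iteration.
Context {R : realType}.
Implicit Types (u w : R -> R) (k : int) (j n N : nat) (t tau rho K Z eps : R).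

Lemma cvge0_le {T : Type} (F : set_system T) {FF : Filter F} (f : T -> \bar R) eps :
  f x @[x --> F] --> 0%E -> 0 < eps -> \forall x \near F, (f x <= eps%:E)%E.
Proof.
move=> /fine_cvgP[h1 /cvgrPdist_lt/(_ eps)] h2 /h2; apply: filterS2 h1 => x fx.
rewrite sub0r normrN /= => h; rewrite -(fineK fx) lee_fin.
by apply: le_trans (ler_norm _) (ltW h).
Qed.

Lemma fourierD_fun u w : sqint u -> sqint w ->
  fourier (w \+ u) = (fun k => fourier w k + fourier u k).
Proof. by move=> su sw; apply/funext => k; rewrite fourierD. Qed.

Lemma midpoint_map_incr tau t u w Z K : sqint w -> sqint u ->
  bnd 0 (fourier w) Z -> bnd 0 (fourier u) K ->
  exists b, [/\ sqint (midpoint_map tau t u w),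
    incr t tau (fun k => fourier w k + fourier u k) b, herm b &
    forall k, fourier (midpoint_map tau t u w) k = fourier u k + b k].
Proof.
move=> sw su hZ hK.
have h0 : bnd 0 (fourier (w \+ u)) (Z + K) by rewrite fourierD_fun//; exact: bndD.
have [g [-> sg pg lg]] := midpoint_map_spec tau t sw su h0.
exists (fourier g); split; first exact: sqintD.
- by move=> k; have := lg k; rewrite fourierD_fun.
- exact: fourier_herm.
- by move=> k; rewrite fourierD.
Qed.

Lemma iter_spec tau t u K j : sqint u -> fourier u 0 = 0 -> bnd 0 (fourier u) K ->
  let w := iter j (midpoint_map tau t u) u in
  [/\ sqint w, fourier w 0 = 0 & exists Z, bnd 0 (fourier w) Z].
Proof.
move=> su u0 hK; elim: j => [|j [sw w0 [Z hZ]]] /=; first by split=> //; exists K.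
have [b [s1 hb _ E]] := midpoint_map_incr tau t sw su hZ hK.
have b0 := incr_zero hb.
split=> //; first by rewrite E u0 b0 addr0.
have hz := bndD hZ hK.
exists (K + 4 * 1 * (Z + K) * (Z + K)).
have -> : fourier (midpoint_map tau t u (iter j (midpoint_map tau t u) u)) =
  (fun k => fourier u k + b k) by apply/funext.
by apply: bndD => //; apply: (bnd_lower (leq0n 1) b0); exact: incr_bnd1 hb hz.
Qed.

(* The limit of the iteration solves the implicit equation, by the continuity
   of the increment from l2 to h1. *)
Lemma limit_step tau t u w K : sqint u -> fourier u 0 = 0 -> bnd 0 (fourier u) K ->
  in_Hdot 1 w ->
  (fun j => Hnorm 1 (iter j (midpoint_map tau t u) u \- w)) @ \oo --> 0%E ->
  exists b, [/\ incr t tau (fun k => fourier w k + fourier u k) b, herm b &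
    forall k, fourier w k = fourier u k + b k].
Proof.
move=> su u0 hK hw cv; have sw := in_Hdot_sqint (n := 1) hw.
have [W hW1] := in_Hdot_bnd (n := 1) hw; have w0 : fourier w 0 = 0 by case: hw.
have hW := bnd_lower (leq0n 1) w0 hW1.
have [b [_ hb herb _]] := midpoint_map_incr tau t sw su hW hK.
exists b; split=> // k; apply/eqP; rewrite -subr_eq0; apply/eqP/normc_eq0.
apply/eqP; rewrite eq_le normc_ge0 andbT.
have [W0 _] := hW; have [K0 _] := hK.
(* For a late iterate J, w - (u + b) splits into b' - b, with Lipschitz factor 4 (1 + 2 W + 2 K),
   minus a_{J+1} - w, with factor 1; C adds the two. *)
pose C := 1 + 4 * (1 + (W + W + (K + K))).
have C0 : 0 < C by rewrite /C; lra.
apply: le_addeps => d d0; rewrite add0r.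
pose eps := Num.min 1 (d / C).
have e0 : 0 < eps by rewrite lt_min ltr01 divr_gt0.
have e1 : eps <= 1 by rewrite ge_min lexx.
have ed : eps * C <= d by rewrite -ler_pdivlMr// ge_min lexx orbT.
have [J _ hJ] := cvge0_le cv e0.
pose a j := fourier (iter j (midpoint_map tau t u) u).
have hd j : (J <= j)%N -> bnd 1 (fun k => a j k - fourier w k) eps.
  move=> /hJ /= h; have [sj j0 _] := iter_spec tau t j su u0 hK.
  have -> : (fun k => a j k - fourier w k) =
     fourier (iter j (midpoint_map tau t u) u \- w).
    by apply/funext => i; rewrite fourierB.
  by apply/(HnormP (n := 1)) => //; [rewrite fourierB// j0 w0 subrr eqxx|exact: ltW].
have [sJ J0 [Z hZ]] := iter_spec tau t J su u0 hK.
have [b' [_ hb' _ E]] := midpoint_map_incr tau t sJ su hZ hK.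
have hd0 : bnd 0 (fun k => a J k - fourier w k) eps.
  by apply: (bnd_lower (leq0n 1)); [rewrite /a J0 w0 subrr | exact: hd].
have hs : bnd 0 (fun i => a J i + fourier u i + (fourier w i + fourier u i))
    (1 + (W + W + (K + K))).
  apply: (@bnd_ext _ _ (fun i => (a J i - fourier w i) + ((fourier w i + fourier w i) + (fourier u i + fourier u i)))).
    by move=> i; ring.
  apply: bndD; first exact: bndW hd0.
  by apply: bndD; apply: bndD.
have hbb : bnd 1 (fun k => b' k - b k) (4 * 1 * eps * (1 + (W + W + (K + K)))).
  apply: (bnd_lim (incr_diff hb' hb)) => N.
  apply: Qb_bound_inv => // [i j|]; first exact: mB_smoothing.
  by apply: (bnd_ext _ hd0) => i; rewrite /a; ring.
have hbb0 : bnd 0 (fun k => b' k - b k) (4 * 1 * eps * (1 + (W + W + (K + K)))).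
  by apply: (bnd_lower (leq0n 1)) hbb; rewrite (incr_zero hb) (incr_zero hb') subrr.
have hdS : bnd 0 (fun k => a J.+1 k - fourier w k) eps.
  have [_ S0 _] := iter_spec tau t J.+1 su u0 hK.
  by apply: (bnd_lower (leq0n 1)); [rewrite /a S0 w0 subrr | apply: hd].
have -> : fourier w k - (fourier u k + b k) =
    (b' k - b k) - (a J.+1 k - fourier w k).
  by rewrite /a /= E; ring.
apply: le_trans ed; apply: le_trans (normcB _ _) _.
have := bnd0_normc k hbb0; have := bnd0_normc k hdS.
rewrite /C; lra.
Qed.

Lemma geometric_limit (x : nat -> R[i]) K : (forall j, normc (x j.+1 - x j) <= K / 2 ^+ j) ->
  exists l, cvgC x l.
Proof.
have half j : K / 2 ^+ j = 2 * (K / 2 ^+ j.+1).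
  rewrite exprS; field; exact: expf_neq0.
suff h (y : nat -> R) : (forall j, `|y j.+1 - y j| <= K / 2 ^+ j) ->
    exists l : R, y @ \oo --> l.
  move=> hx; have [|p hp] := h (fun j => complex.Re (x j)).
    by move=> j; rewrite -ReB; apply: le_trans (Re_le_normc _) (hx j).
  have [|q hq] := h (fun j => complex.Im (x j)).
    move=> j; have := hx j; have := Im_le_normc (x j.+1 - x j).
    by case: (x j.+1) (x j) => [a b] [a' b'] /=; exact: le_trans.
  exists (p +i* q)%C.
  apply: (@cvgC_squeeze _ _ _ (fun n => `|complex.Re (x n) - p| + `|complex.Im (x n) - q|)).
    by move=> n; apply: le_trans (normc_le_ReIm _) _; case: (x n).
  rewrite -[X in _ --> X](addr0 0); apply: cvgD; rewrite -[X in _ --> X](normr0 R).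
    by apply: cvg_norm; rewrite -[X in _ --> X](subrr p); apply: cvgB => //; exact: cvg_cst.
  by apply: cvg_norm; rewrite -[X in _ --> X](subrr q); apply: cvgB => //; exact: cvg_cst.
(* g bounds the remaining geometric tail, so y + g decreases, y - g increases, and g tends to 0. *)
move=> hy; pose g j := 2 * (K / 2 ^+ j).
have gS j : g j = K / 2 ^+ j + g j.+1 by rewrite /g -half; rewrite mulr_natl mulr2n.
have K0 : 0 <= K by have := hy 0%N; rewrite expr0 divr1; apply: le_trans.
have g0 : g @ \oo --> (0 : R).
  have -> : g = (fun j => (2 * K) * (2^-1) ^+ j).
    by apply/funext => j; rewrite /g exprVn mulrA.
  rewrite -[X in _ --> X](mulr0 (2 * K)); apply: cvgM; first exact: cvg_cst.
  by apply: cvg_expr; rewrite ger0_norm ?invf_lt1// ltr1n.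
have h1 : nonincreasing_seq (fun j => y j + g j).
  apply/nonincreasing_seqP => j; rewrite (gS j).
  have := hy j; rewrite ler_norml => /andP[_]; lra.
have h2 : nondecreasing_seq (fun j => y j - g j).
  apply/nondecreasing_seqP => j; rewrite (gS j).
  have := hy j; rewrite ler_norml => /andP[+ _]; lra.
have cv : cvgn (fun j => y j - g j).
  apply: nondecreasing_is_cvgn => //; exists (y 0%N + g 0%N) => _ [j _ <-].
  apply: le_trans (h1 _ _ (leq0n j)); rewrite lerD2l -subr_ge0 opprK.
  by rewrite addr_ge0// mulr_ge0// divr_ge0// exprn_ge0.
move/cvg_ex : cv => [l hl]; exists l.
have -> : y = (fun j => (y j - g j) + g j) by apply/funext => j; rewrite subrK.
by rewrite -[l]addr0; apply: cvgD.
Qed.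

(** The iterates stay in the l^2 ball of radius 2 rho, where increments have size at most 36 eps
    rho^2 <= rho. Differences contract by 4 eps (6 rho) = 24 eps rho <= 1/2, whence the 48.
    Smoothing then turns the l^2 Cauchy property into an h^1 one. *)
Lemma exists_step tau t u rho K eps : 0 <= tau -> 0 < rho -> 0 < eps ->
  48 * eps * rho <= 1 -> 2 * tau <= eps ^+ 4 ->
  sqint u -> periodic u (pi *+ 2) -> fourier u 0 = 0 ->
  bnd 0 (fourier u) rho -> bnd 1 (fourier u) K ->
  exists w, in_Hdot 1 w /\
    (fun j => Hnorm 1 (iter j (midpoint_map tau t u) u \- w)) @ \oo --> 0%E.
Proof.
move=> tau0 rho0 eps0 er te su pu u0 hrho hK1.
pose W j := iter j (midpoint_map tau t u) u.
pose a j := fourier (W j).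
have spec j := iter_spec tau t j su u0 hrho.
have sW j : sqint (W j) by have [] := spec j.
have WE j : iter j (midpoint_map tau t u) u = W j by [].
have a0 j : a j 0 = 0 by have [] := spec j.
have stepb j : {b | [/\ incr t tau (fun k => a j k + fourier u k) b &
    forall k, a j.+1 k = fourier u k + b k]}.
  apply: cid; have [_ _ [Z hZ]] := spec j.
  by have [b [_ h1 _ h2]] := midpoint_map_incr tau t (sW j) su hZ hrho; exists b.
pose b j := sval (stepb j).
have hb j : incr t tau (fun k => a j k + fourier u k) (b j) by have [] := svalP (stepb j).
have aS j k : a j.+1 k = fourier u k + b j k by have [] := svalP (stepb j).
have aE j : a j = fourier (W j) by [].
have au : a 0%N = fourier u by [].
clearbody b; clear stepb; clearbody a; clearbody W.
have small : 4 * eps * (3 * rho) * (3 * rho) <= rho.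
  have -> : 4 * eps * (3 * rho) * (3 * rho) = 36 * eps * rho * rho by ring.
  rewrite ler_piMl ?(ltW rho0)//; apply: le_trans er; rewrite ler_wpM2r ?(ltW rho0)//.
  by rewrite ler_wpM2r ?(ltW eps0)// ler_nat.
have key j : bnd 0 (a j) (2 * rho) -> bnd 0 (b j) rho.
  move=> h; apply: bndW small _; apply: incr_bnd0 (hb j) _ => //.
  by apply: bndW (bndD h hrho); lra.
have ha2 j : bnd 0 (a j) (2 * rho).
  elim: j => [|j IH]; first by rewrite au; apply: bndW hrho; lra.
  have -> : 2 * rho = rho + rho by rewrite mulr_natl.
  by apply: (bnd_ext _ (bndD hrho (key j IH))) => k; rewrite aS.
have ba j : bnd 0 (a j) (2 * rho) /\ bnd 0 (b j) rho by split=> //; exact: key.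
pose dl j k := a j.+1 k - a j k.
have bs j : bnd 0 (fun k => a j.+1 k + fourier u k + (a j k + fourier u k)) (6 * rho).
  apply: bndW (bndD (bndD (ba j.+1).1 hrho) (bndD (ba j).1 hrho)); lra.
have E j k : a j.+2 k - a j.+1 k = b j.+1 k - b j k by rewrite !aS; ring.
have bdl j : bnd 0 (dl j) (rho / 2 ^+ j).
  elim: j => [|j IH].
    rewrite expr0 divr1; apply: (bnd_ext _ (ba 0%N).2) => k.
    by rewrite /dl aS au addrC addKr.
  apply: (@bnd_ext _ _ (fun k => b j.+1 k - b j k)); first by move=> k; rewrite /dl E.
  apply: (@bndW _ _ _ (4 * eps * (rho / 2 ^+ j) * (6 * rho))).
    rewrite exprS invfM.
    have -> : 4 * eps * (rho / 2 ^+ j) * (6 * rho) = (48 * eps * rho) * (rho * (2^-1 / 2 ^+ j)) by field; exact: expf_neq0.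
    by rewrite ler_piMl// mulr_ge0 ?ltW// divr_gt0// ?invr_gt0// exprn_gt0.
  apply: (bnd_lim (incr_diff (hb j.+1) (hb j))) => N.
  apply: (Qb_bound_inv N (ltW eps0) _ _ (bs j)) => [i l|]; first exact: mB_small.
  by apply: (bnd_ext _ IH) => k; rewrite /dl; ring.
pose C := 4 * 1 * rho * (6 * rho).
(* The h^1 norm of a difference is controlled by the l^2 norm of the preceding one, hence the shift
   of the index. *)
have bdl1 j : bnd 1 (dl j.+1) (C / 2 ^+ j).
  apply: (@bnd_ext _ _ (fun k => b j.+1 k - b j k)); first by move=> k; rewrite /dl E.
  have -> : C / 2 ^+ j = 4 * 1 * (rho / 2 ^+ j) * (6 * rho) by rewrite /C; ring.
  apply: (bnd_lim (incr_diff (hb j.+1) (hb j))) => N.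
  apply: (Qb_bound_inv N ler01 _ _ (bs j)) => [i l|]; first exact: mB_smoothing.
  by apply: (bnd_ext _ (bdl j)) => k; rewrite /dl; ring.
have lim k : {l | cvgC (a ^~ k) l}.
  apply: cid; apply: (@geometric_limit _ rho) => j.
  exact: bnd0_normc (bdl j).
pose l k := sval (lim k).
have al k : cvgC (a ^~ k) (l k) by exact: svalP (lim k).
have C0 : 0 <= C by rewrite /C !mulr_ge0// ltW.
have tel j m : bnd 1 (fun k => a (m + j.+1)%N k - a j.+1 k) (2 * (C / 2 ^+ j)).
  (* The induction on m requires the exact partial geometric sum, not only its limit. *)
  suff h : bnd 1 (fun k => a (m + j.+1)%N k - a j.+1 k) (2 * (C / 2 ^+ j) - 2 * (C / 2 ^+ (m + j))).
    apply: bndW h; rewrite lerBlDr lerDl mulr_ge0// divr_ge0// exprn_ge0//.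
  elim: m => [|m IH].
    rewrite !add0n subrr; split=> // M; rewrite /hs big1 ?expr0n// => k _.
    by rewrite subrr normc0 mulr0 expr0n.
  have h := bndD IH (bdl1 (m + j)%N); move: h.
  have -> : 2 * (C / 2 ^+ j) - 2 * (C / 2 ^+ (m + j)) + C / 2 ^+ (m + j) =
     2 * (C / 2 ^+ j) - 2 * (C / 2 ^+ (m.+1 + j)).
    by rewrite addSn [2 ^+ (m + j).+1]exprS; field; rewrite !expf_neq0.
  move=> h; apply: (bnd_ext _ h) => k; rewrite /dl addSn addnS; ring.
have limb j : bnd 1 (fun k => l k - a j.+1 k) (2 * (C / 2 ^+ j)).
  apply: (@bnd_lim _ _ (fun m k => a (m + j.+1)%N k - a j.+1 k)); last exact: tel.
  move=> k; apply: cvgCB; last exact: cvgC_cst.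
  by have h := al k; rewrite /cvgC -(cvg_shiftn j.+1) in h.
have l0 : l 0 = 0.
  apply: (cvgC_unique (al 0)).
  by under eq_fun do rewrite a0; exact: cvgC_cst.
have hl : herm l by apply: (herm_lim (Q := a)) => // j; rewrite aE; exact: fourier_herm.
have hu := fourier_herm su.
pose c k := l k - fourier u k.
have hc : herm c by move=> k; rewrite /c hl hu rmorphB.
have bb0 : bnd 1 (b 0%N) (4 * 1 * (3 * rho) * (3 * rho)).
  apply: (incr_bnd1 (hb 0%N)); apply: bndW (bndD (ba 0%N).1 hrho); lra.
have bc : bnd 1 c (2 * (C / 2 ^+ 0) + 4 * 1 * (3 * rho) * (3 * rho)).
  apply: (bnd_ext _ (bndD (limb 0%N) bb0)) => k; rewrite /c aS; ring.
have lc N := bnd_l1 N bc.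
have sc := fser_sqint lc.
exists (fun x => u x + fser c x).
have fE : fourier (fun x => u x + fser c x) = l.
  by apply/funext => k; rewrite fourierD// (fourier_fser hc lc) /c addrC subrK.
split.
  apply: (@in_HdotI _ 1 _ (K + (2 * (C / 2 ^+ 0) + 4 * 1 * (3 * rho) * (3 * rho)))).
  - by move=> x; rewrite pu fser_periodic.
  - exact: sqintD.
  - by rewrite fE.
  - by rewrite fE; apply: (bnd_ext _ (bndD hK1 bc)) => k; rewrite /c addrC subrK.
have up j : (Hnorm 1 (W j.+1 \- (fun x => u x + fser c x))%R <= (2 * (C / 2 ^+ j))%:E)%E.
  have s1 : sqint (fun x => u x + fser c x) by exact: sqintD.
  apply/(HnormP (n := 1)).
  - by rewrite fourierB// fE l0 -aE a0 subrr eqxx.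
  - by rewrite mulr_ge0// divr_ge0// exprn_ge0.
  apply: (bnd_ext _ (bndN (limb j))) => k.
  by rewrite fourierB// fE opprB aE.
rewrite (_ : (fun j => _) = (fun j => Hnorm 1 (W j \- (fun x => u x + fser c x)))); last first.
  by apply/funext => j; rewrite WE.
rewrite -cvg_shiftS.
have c2 : (fun j => (2 * (C / 2 ^+ j))%:E) @ \oo --> 0%E.
  apply: cvg_EFin; first exact: nearW.
  have -> : fine \o (fun j => (2 * (C / 2 ^+ j))%:E) = (fun j => (2 * C) * (2^-1) ^+ j).
    by apply/funext => j; rewrite /= exprVn mulrA.
  rewrite -[X in _ --> X](mulr0 (2 * C)); apply: cvgM; first exact: cvg_cst.
  by apply: cvg_expr; rewrite ger0_norm ?invf_lt1// ltr1n.
apply: (squeeze_cvge _ (cvg_cst 0%E) c2).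
by apply: nearW => j; rewrite sqrte_ge0 up.
Qed.

End Iteration.

(** * The local error *)

Section LocalError.
Context {R : realType}.
Implicit Types (p q s t tau rho K Z e : R) (k : int) (r N M : nat) (D : R -> int -> R[i]).

(** Continuation argument: the supremum c of the points where the bound with slope K + e holds
    satisfies it too, and differentiability at c extends it beyond c unless c = q. Derivatives are
    relative to [p, q], one-sided at the end points. *)
Lemma mean_value_le (f g : R -> R) p q K : p <= q ->
  (forall t, p <= t <= q -> forall e, 0 < e -> exists2 d, 0 < d &
    forall s, p <= s <= q -> `|s - t| < d -> `|f s - f t - (s - t) * g t| <= e * `|s - t|) ->
  (forall t, p <= t <= q -> g t <= K) ->
  f q - f p <= K * (q - p).
Proof.
move=> pq hd hK; apply: le_addeps => e' e'0.
pose e := e' / (q - p + 1).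
have qp1 : 0 < q - p + 1 by rewrite ltr_wpDl// subr_ge0.
have e0 : 0 < e by rewrite divr_gt0.
suff h : f q - f p <= (K + e) * (q - p).
  apply: le_trans h _; rewrite mulrDl lerD2l /e mulrAC ler_pdivrMr//.
  by rewrite ler_wpM2l ?(ltW e'0)// lerDl.
pose S := [set x | p <= x <= q /\ f x - f p <= (K + e) * (x - p)].
have Sp : S p by split; rewrite ?lexx// !subrr mulr0.
have Sub : has_sup S by split; [exists p | exists q => x [/andP[]]].
pose c := sup S.
have pc : p <= c by apply: ub_le_sup => //; case: Sub.
have cq : c <= q by apply: ge_sup; [exists p | move=> x [/andP[]]].
have [d d0 hdd] := hd c (introT andP (conj pc cq)) e e0.
have gc := hK c (introT andP (conj pc cq)).
have Sc : f c - f p <= (K + e) * (c - p).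
  have [s Ss hs] := sup_adherent d0 Sub; have [/andP[ps sq] fs] := Ss.
  have sc : s <= c by apply: ub_le_sup => //; case: Sub.
  have := hdd s (introT andP (conj ps sq)); rewrite distrC ger0_norm ?subr_ge0//.
  have -> : (c - s < d) = true by move: hs; rewrite -/c; lra.
  move=> /(_ isT); rewrite ler_norml => /andP[+ _].
  have : (c - s) * g c <= (c - s) * K by rewrite ler_wpM2l// subr_ge0.
  lra.
have [->|cq'] := eqVneq q c; first exact: Sc.
have cltq : c < q by rewrite lt_neqAle eq_sym cq' cq.
pose s := Num.min q (c + d / 2).
have cs : c < s by rewrite lt_min cltq/=; lra.
have sq : s <= q by rewrite ge_min lexx.
have sd : s <= c + d / 2 by rewrite ge_min lexx orbT.
have ps : p <= s by apply: le_trans pc (ltW cs).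
have Ss : S s.
  split; first by rewrite ps.
  have := hdd s (introT andP (conj ps sq)); rewrite ger0_norm ?subr_ge0 ?(ltW cs)//.
  have -> : (s - c < d) = true by lra.
  move=> /(_ isT); rewrite ler_norml => /andP[_].
  have : (s - c) * g c <= (s - c) * K by rewrite ler_wpM2l// subr_ge0 ltW.
  lra.
have : s <= c by apply: ub_le_sup => //; case: Sub.
by rewrite leNgt cs.
Qed.

(** Differentiability frequency by frequency, with no uniformity in k; norm bounds on the
    derivatives restore a norm estimate in [mean_value_bnd]. *)
Definition hasD p q D t (D' : int -> R[i]) : Prop :=
  forall k e, 0 < e -> exists2 d, 0 < d & forall s, p <= s <= q -> `|s - t| < d ->
    normc (D s k - D t k - ((s - t)%:C)%C * D' k) <= e * `|s - t|.

Lemma hasDB p q (D E : R -> int -> R[i]) t (D' E' : int -> R[i]) : hasD p q D t D' -> hasD p q E t E' ->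
  hasD p q (fun s k => D s k - E s k) t (fun k => D' k - E' k).
Proof.
move=> hD hE k e e0; have e20 : 0 < e / 2 by rewrite divr_gt0.
have [d1 d10 h1] := hD k _ e20; have [d2 d20 h2] := hE k _ e20.
exists (Num.min d1 d2); first by rewrite lt_min d10.
move=> s ps; rewrite lt_min => /andP[s1 s2].
have -> : D s k - E s k - (D t k - E t k) - ((s - t)%:C)%C * (D' k - E' k) =
  (D s k - D t k - ((s - t)%:C)%C * D' k) - (E s k - E t k - ((s - t)%:C)%C * E' k) by ring.
apply: le_trans (normcB _ _) _; have := h1 s ps s1; have := h2 s ps s2; lra.
Qed.

Lemma hasD_sub p q p' q' D t (D' : int -> R[i]) : p <= p' -> q' <= q -> hasD p q D t D' -> hasD p' q' D t D'.
Proof.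
move=> pp qq h k e e0; have [d d0 hd] := h k e e0; exists d => // s /andP[ps sq].
by apply: hd; rewrite (le_trans pp ps) (le_trans sq qq).
Qed.

Lemma pr_deriv r p q D t (D' h : int -> R[i]) M e : hasD p q D t D' -> 0 < e ->
  exists2 d, 0 < d & forall s, p <= s <= q -> `|s - t| < d ->
   `|pr r (D s) h M - pr r (D t) h M - (s - t) * pr r D' h M| <= e * `|s - t|.
Proof.
move=> hD e0.
have L (f : int -> R[i]) s : (forall k, f k = D s k - D t k - ((s - t)%:C)%C * D' k) ->
   pr r (D s) h M - pr r (D t) h M - (s - t) * pr r D' h M = pr r f h M.
  move=> hf; rewrite /pr mulr_sumr -!sumrB; apply: eq_bigr => k _.
  by rewrite hf !mulrBl !ReB -mulrA ReM_real; ring.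
suff H (u : seq int) : exists2 d, 0 < d & forall s, p <= s <= q -> `|s - t| < d ->
   `|\sum_(k <- u) `|k%:~R| ^+ r.*2 *
      complex.Re ((D s k - D t k - ((s - t)%:C)%C * D' k) * (h k)^*%C)| <= e * `|s - t|.
  have [d d0 hd] := H (zrange M); exists d => // s ps st.
  by rewrite (L (fun k => D s k - D t k - ((s - t)%:C)%C * D' k))//; exact: hd.
elim: u e e0 => [|k u IH] e e0.
  by exists 1 => // s _ _; rewrite big_nil normr0 mulr_ge0// ltW.
have e20 : 0 < e / 2 by rewrite divr_gt0.
have [d1 d10 h1] := IH _ e20.
pose C := `|k%:~R : R| ^+ r.*2 * normc (h k).
have C0 : 0 <= C by exact: term_ge0.
have e30 : 0 < e / 2 / (C + 1) by rewrite divr_gt0// ltr_wpDl.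
have [d2 d20 h2] := hD k _ e30.
exists (Num.min d1 d2); first by rewrite lt_min d10.
move=> s ps; rewrite lt_min => /andP[s1 s2]; rewrite big_cons.
apply: le_trans (ler_normD _ _) _.
have -> : e * `|s - t| = e / 2 * `|s - t| + e / 2 * `|s - t| by field.
apply: lerD (h1 s ps s1); rewrite normrM ger0_norm ?exprn_ge0//.
apply: le_trans (ler_wpM2l (exprn_ge0 _ (normr_ge0 _)) (Re_le_normc _)) _.
rewrite normcM normcJ mulrCA mulrC -/C.
apply: le_trans (ler_wpM2l C0 (h2 s ps s2)) _.
rewrite mulrA; apply: ler_wpM2r => //.
rewrite mulrCA ler_piMr ?(ltW e20)//.
by rewrite ler_pdivrMr ?mul1r ?ltr_wpDl// lerDl.
Qed.

(** The increment is paired with itself, frozen as the fixed vector h; this reduces the claim to the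
    scalar inequality for each truncation. *)
Lemma mean_value_bnd r p q D (D' : R -> int -> R[i]) K : p <= q ->
  (forall t, p <= t <= q -> hasD p q D t (D' t)) ->
  (forall t, p <= t <= q -> bnd r (D' t) K) ->
  bnd r (fun k => D q k - D p k) (K * (q - p)).
Proof.
move=> pq hD hK.
have K0 : 0 <= K by have [] := hK p; rewrite ?lexx.
apply: bnd_dual => [|M]; first by rewrite mulr_ge0// subr_ge0.
pose h k := D q k - D p k.
have E : hs r h M = pr r (D q) h M - pr r (D p) h M by rewrite -prBl pr_self.
rewrite -/h [leLHS]E.
have -> : K * (q - p) * Num.sqrt (hs r h M) = (K * Num.sqrt (hs r h M)) * (q - p) by ring.
apply: (@mean_value_le (fun s => pr r (D s) h M) (fun s => pr r (D' s) h M)) => //.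
  by move=> t pt e e0; exact: pr_deriv (hD t pt) e0.
move=> t pt; have [_ hKt] := hK t pt.
apply: (pr_le_seq K0 (sqrtr_ge0 _) (hKt M)).
by rewrite sqr_sqrtr ?hs_ge0.
Qed.

Lemma Qb_pt (m : int -> int -> R[i]) (f g : int -> R[i]) k N (A B : int -> R) (a b : R) :
  0 <= b -> (forall i, 0 <= A i) -> (forall i, 0 <= B i) ->
  \sum_(i <- zrange N) A i <= a -> \sum_(i <- zrange N) B i ^+ 2 <= b ^+ 2 ->
  (forall i j, k = i + j -> normc (m i j * f i * g j) <= A i * B j) ->
  normc (Qb N m f g k) <= a * b.
Proof.
move=> b0 A0 B0 hA hB H.
have u := zrange_uniq N.
(* The third sequence of [conv_bound] is the indicator of the single frequency k. *)
have one1 : \sum_(l <- [:: k]) (fun=> 1 : R) l ^+ 2 <= 1 ^+ 2 by rewrite big_seq1.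
have := conv_bound u u (isT : uniq [:: k]) b0 ler01 A0 B0 (fun=> ler01) hA hB one1.
rewrite mulr1; apply: le_trans.
apply: le_trans (normc_sum _ _) _; apply: ler_sum => i _.
apply: le_trans (normc_sum _ _) _; apply: ler_sum => j _.
by rewrite big_seq1 mulr1; case: eqP => [/H//|_]; rewrite normc0.
Qed.

(** Differentiating the phase brings down 3 i j (i + j), which cancels the denominator 24 i j and
    leaves (i + j) / 8, a quarter of the factor in [mP]. The remainder constant is 2 * 9 / 24 = 3 /
    4. *)
Lemma mG_taylor s t (i j : int) : i != 0 -> j != 0 ->
  normc (mG s i j - mG t i j - ((s - t)%:C)%C * ((4^-1%:C)%C * mP t i j)) <=
  (s - t) ^+ 2 * (`|i%:~R| * `|j%:~R| * `|(i + j)%:~R| ^+ 2).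
Proof.
move=> i0 j0.
pose th : R := 3 * (i%:~R * j%:~R * (i + j)%:~R).
have xi : (i%:~R : R) != 0 by rewrite intr_eq0.
have xj : (j%:~R : R) != 0 by rewrite intr_eq0.
have e1 : ph s i j = ph t i j * expi (- ((s - t) * th)).
  by rewrite /ph -/th -expiD; congr expi; ring.
have e2 : ((s - t)%:C)%C * ((4^-1%:C)%C * mP t i j) =
   ((- (24 * (i%:~R * j%:~R))^-1)%:C)%C * ph t i j * (0 +i* (- ((s - t) * th)))%C.
  rewrite /mP mulrA mulrA -realCM [RHS]mulrAC; congr (_ * _).
  apply/eqP; rewrite eq_complex /= !(mul0r, mulr0, subr0, addr0) eqxx/=; apply/eqP.
  by rewrite /th; field; rewrite xi xj.
have -> : mG s i j - mG t i j - ((s - t)%:C)%C * ((4^-1%:C)%C * mP t i j) =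
  ((- (24 * (i%:~R * j%:~R))^-1)%:C)%C * ph t i j *
   (expi (- ((s - t) * th)) - 1 - (0 +i* (- ((s - t) * th)))%C).
  by rewrite e2 /mG e1; ring.
rewrite !normcM normc_expi mulr1 normcR normrN normfV normrM ger0_norm// normrM.
have x0 : 0 < `|i%:~R : R| by rewrite normr_gt0.
have y0 : 0 < `|j%:~R : R| by rewrite normr_gt0.
apply: (@le_trans _ _ ((24 * (`|i%:~R| * `|j%:~R|))^-1 * (2 * (- ((s - t) * th)) ^+ 2))).
  by rewrite ler_wpM2l ?expi_taylor// invr_ge0 !mulr_ge0.
have -> : (- ((s - t) * th)) ^+ 2 = (s - t) ^+ 2 * (9 * (`|i%:~R| ^+ 2 * `|j%:~R| ^+ 2 * `|(i + j)%:~R| ^+ 2)).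
  by rewrite !real_normK ?num_real// /th; ring.
have -> : (24 * (`|i%:~R| * `|j%:~R|))^-1 * (2 * ((s - t) ^+ 2 * (9 * (`|i%:~R| ^+ 2 * `|j%:~R| ^+ 2 * `|(i + j)%:~R| ^+ 2))))
  = 3 / 4 * ((s - t) ^+ 2 * (`|i%:~R| * `|j%:~R| * `|(i + j)%:~R| ^+ 2)) :> R.
  by field; rewrite !lt0r_neq0.
rewrite ler_piMl//; last by lra.
by rewrite mulr_ge0 ?sqr_ge0// !mulr_ge0 ?sqr_ge0.
Qed.

(* Fixing w, the numerical flow s |-> G_s(w) integrates the equation with the
   solution frozen at w / 2. *)
Lemma hasD_Gpart p q t (w : R -> R) Z : sqint w -> fourier w 0 = 0 -> bnd 2 (fourier w) Z ->
  hasD p q (fun s k => (24^-1%:C)%C * fourier (Gpart s w) k) t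
    (fourier (twisted_rhs t (fun x => 2^-1 * w x))).
Proof.
move=> sw w0 hZ.
have hZ1 := bnd_lower (isT : (1 <= 2)%N) w0 hZ.
have hZ0 := bnd_lower (isT : (0 <= 2)%N) w0 hZ.
have [Z0 hZM] := hZ1.
have sw2 : sqint (fun x => 2^-1 * w x) by exact: sqintZ.
have fw2 k : fourier (fun x => 2^-1 * w x) k = (2^-1%:C)%C * fourier w k by exact: fourierZ.
have hw2 : bnd 2 (fourier (fun x => 2^-1 * w x)) (normc (2^-1%:C)%C * Z).
  by apply: (bnd_ext _ (bndZ _ hZ)) => k; rewrite fw2.
have [|_ lP] := twisted_rhs_spec t sw2 _ hw2; first by rewrite fw2 w0 mulr0.
move=> k e e0.
(* Size of the Taylor remainder at frequency k: the derivative of w has l^1 norm at most 2 Z and l^2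
   norm at most Z. Growth in k is harmless for a coefficientwise derivative. *)
pose C := `|k%:~R : R| ^+ 2 * (2 * Z) * Z.
have C0 : 0 <= C by rewrite !mulr_ge0// sqr_ge0.
exists (e / (C + 1)); first by rewrite divr_gt0// ltr_wpDl.
move=> s _ st.
have [_ _ l1] := Gpart_spec s sw hZ0; have [_ _ l2] := Gpart_spec t sw hZ0.
have l3 := cvgCB (cvgCB (l1 k) (l2 k)) (cvgCM ((s - t)%:C)%C (lP k)).
apply: (@le_trans _ _ ((s - t) ^+ 2 * C)); last first.
  rewrite -[(s - t) ^+ 2]real_normK ?num_real// expr2 -mulrA mulrC ler_wpM2r//.
  rewrite mulrC; apply: le_trans (ler_wpM2l C0 (ltW st)) _.
  by rewrite mulrCA ler_piMr ?ltW// ltr_pdivrMr ?ltr_wpDl// mul1r ltr_pwDr.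
apply: (cvgr_to_le (cvgC_normc l3)); apply: nearW => N.
rewrite QbZ.
have -> : Qb N (fun i j => ((s - t)%:C)%C * mP t i j) (fourier (fun x => 2^-1 * w x))
    (fourier (fun x => 2^-1 * w x)) k =
  Qb N (fun i j => ((s - t)%:C)%C * ((4^-1%:C)%C * mP t i j)) (fourier w) (fourier w) k.
  apply: Qb_ext => i j _; rewrite !fw2.
  have -> : (4^-1%:C)%C = (2^-1%:C)%C * (2^-1%:C)%C :> R[i].
    by rewrite -realCM; congr (_%:C)%C; field.
  move: (_%:C)%C (_%:C)%C (mP _ _ _) (fourier _ _) (fourier _ _) => x1 x2 x3 x4 x5.
  by ring.
rewrite -!QbBm.
have -> : (s - t) ^+ 2 * C = (2 * ((s - t) ^+ 2 * `|k%:~R| ^+ 2 * Z)) * Z by rewrite /C; ring.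
apply: (@Qb_pt _ _ _ _ _ (fun i => (s - t) ^+ 2 * `|k%:~R| ^+ 2 * (`|i%:~R| ^+ 1 * normc (fourier w i)))
   (fun i => `|i%:~R| ^+ 1 * normc (fourier w i))) => //.
- by move=> i; apply: mulr_ge0 (term_ge0 _ _ _); rewrite mulr_ge0 ?sqr_ge0.
- by move=> i; exact: term_ge0.
- rewrite -mulr_sumr [leRHS]mulrCA; apply: ler_wpM2l; first by rewrite mulr_ge0 ?sqr_ge0.
  exact: bnd_sum N w0 hZ.
- exact: hZM.
move=> i j kij.
have [i0|i0] := eqVneq i 0; first by rewrite i0 w0 mulr0 mul0r !normc0 !(mulr0, mul0r).
have [j0|j0] := eqVneq j 0; first by rewrite j0 w0 mulr0 !normc0 !(mulr0, mul0r).
rewrite !normcM kij !expr1.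
have := ler_wpM2r (mulr_ge0 (normc_ge0 (fourier w i)) (normc_ge0 (fourier w j))) (mG_taylor s t i0 j0).
move: (normc (_ - _)) => x; congr (_ <= _); ring.
Qed.

(** A coefficient is at most the L^2 norm, so the limit of difference quotients in H^0 holds at each
    frequency. *)
Lemma solution_hasD (T : R) u0 v t : twisted_kdv_solution T u0 v -> 0 <= t <= T ->
  hasD 0 T (fun s => fourier (v s)) t (fourier (twisted_rhs t (v t))).
Proof.
move=> [hv _ hd] tT k e e0; have {hd} hd := hd t tT.
have sv s : 0 <= s <= T -> sqint (v s) by move=> /hv; exact: (@in_Hdot_sqint _ 3).
have [K hK] := in_Hdot_bnd (n := 3) (hv t tT).
have v0 : fourier (v t) 0 = 0 by case: (hv t tT).
have hK2 := bnd_lower (isT : (2 <= 3)%N) v0 hK.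
have [srhs _] := twisted_rhs_spec t (sv t tT) v0 hK2.
have := cvge0_le hd e0; rewrite near_withinE => -[d d0 h].
exists d => // s sT st; cbv beta.
have [->|nst] := eqVneq s t.
  have z (x y : R[i]) : x - x - ((t - t)%:C)%C * y = 0.
    by rewrite !subrr (_ : (0%:C)%C = 0) ?mul0r ?subr0.
  by rewrite z normc0 (subrr t) normr0 mulr0.
have st0 : s - t != 0 by rewrite subr_eq0.
have hs : (Hnorm 0 (fun x => (s - t)^-1 * (v s x - v t x) - twisted_rhs t (v t) x)%R <= e%:E)%E.
  by apply: h => //=; rewrite distrC.
have {hs} /(HnormP (n := 0)) := hs; move=> /(_ isT (ltW e0)).
move=> /(bnd0_normc k).
rewrite fourierB//; last by apply: sqintZ; apply: sqintB => //; exact: sv.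
rewrite fourierZ; last by apply: sqintB => //; exact: sv.
rewrite fourierB//; [|exact: sv..].
move=> hle; rewrite [leRHS]mulrC; apply: le_trans (ler_wpM2l (normr_ge0 (s - t)) hle).
rewrite -normcR -normcM le_eqVlt; apply/orP; left; apply/eqP; congr normc.
by rewrite mulrBr mulrA -realCM divff// rmorph1 mul1r.
Qed.

(** With w = v(p + tau) + v(p) frozen, the defect has as time derivative the difference of the
    right-hand sides at v(t) and w / 2. It is bilinear in v(t) - w / 2, of size 8 rho^2 tau in H^2,
    and in v(t) + w / 2, of size 2 rho; this gives 4 * 8 * 2 = 64, and integration in time the
    second factor tau. *)
Lemma local_error (T : R) u0 v p tau rho : twisted_kdv_solution T u0 v ->
  (forall t, 0 <= t <= T -> bnd 3 (fourier (v t)) rho) ->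
  0 <= p -> 0 <= tau -> p + tau <= T ->
  exists b, incr p tau (fun k => fourier (v (p + tau)) k + fourier (v p) k) b /\
   bnd 1 (fun k => fourier (v (p + tau)) k - fourier (v p) k - b k) (64 * rho ^+ 3 * tau ^+ 2).
Proof.
move=> hsol hrho p0 tau0 pT; have [hv _ _] := hsol.
set q := p + tau.
have pq : p <= q by rewrite lerDl.
have inT t : p <= t <= q -> 0 <= t <= T.
  by move=> /andP[pt tq]; rewrite (le_trans p0 pt) (le_trans tq pT).
have rho0 : 0 <= rho by have [] := hrho p; rewrite // p0 (le_trans pq pT).
have sv t : p <= t <= q -> sqint (v t) by move=> /inT /hv; exact: (@in_Hdot_sqint _ 3).
have v0 t : p <= t <= q -> fourier (v t) 0 = 0 by move=> /inT /hv; case.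
have pp : p <= p <= q by rewrite lexx.
have qq : p <= q <= q by rewrite lexx andbT.
have b3 t : p <= t <= q -> bnd 3 (fourier (v t)) rho by move=> /inT /hrho.
have b2 t : p <= t <= q -> bnd 2 (fourier (v t)) rho.
  by move=> pt; apply: (bnd_lower (isT : (2 <= 3)%N)); [exact: v0 | exact: b3].
have lP t : p <= t <= q -> forall k, cvgC (fun N => Qb N (mP t) (fourier (v t)) (fourier (v t)) k)
   (fourier (twisted_rhs t (v t)) k).
  by move=> pt; have [] := twisted_rhs_spec t (sv t pt) (v0 t pt) (b2 t pt).
have hD t : p <= t <= q -> hasD p q (fun s => fourier (v s)) t (fourier (twisted_rhs t (v t))).
  by move=> pt; apply: (hasD_sub p0 pT); exact: solution_hasD hsol (inT t pt).
have lip s t : p <= s -> s <= t -> t <= q ->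
    bnd 2 (fun k => fourier (v t) k - fourier (v s) k) (8 * rho ^+ 2 * tau).
  move=> ps st tq.
  apply: (@bndW _ _ _ (8 * rho ^+ 2 * (t - s))).
    by rewrite ler_wpM2l ?mulr_ge0 ?sqr_ge0// lerBlDr; move: tq; rewrite /q; lra.
  apply: (@mean_value_bnd 2 s t (fun s => fourier (v s)) (fun t => fourier (twisted_rhs t (v t)))) => //.
    move=> x /andP[sx xt]; apply: (hasD_sub ps tq); apply: hD.
    by rewrite (le_trans ps sx) (le_trans xt tq).
  move=> x /andP[sx xt]; have px : p <= x <= q by rewrite (le_trans ps sx) (le_trans xt tq).
  have -> : 8 * rho ^+ 2 = 4 * 2 * rho * rho by ring.
  apply: (bnd_lim (lP x px)) => N.
  by apply: (@Qb_bound_pow _ 2 3); rewrite ?v0//; [move=> i j; exact: mP_loss2|exact: b3..].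
pose w x := v q x + v p x.
have sw : sqint w by apply: sqintD; exact: sv.
have fw k : fourier w k = fourier (v q) k + fourier (v p) k by apply: fourierD; exact: sv.
have w0 : fourier w 0 = 0 by rewrite fw !v0// addr0.
have bw : bnd 2 (fourier w) (rho + rho).
  by apply: (bnd_ext _ (bndD (b2 q qq) (b2 p pp))) => k; rewrite fw.
have bw0 := bnd_lower (isT : (0 <= 2)%N) w0 bw.
have [_ _ l1] := Gpart_spec q sw bw0; have [_ _ l2] := Gpart_spec p sw bw0.
have hDG t : hasD p q (fun s k => (24^-1%:C)%C * fourier (Gpart s w) k) t
    (fourier (twisted_rhs t (fun x => 2^-1 * w x))) by exact: hasD_Gpart bw.
have sw2 : sqint (fun x => 2^-1 * w x) by exact: sqintZ.
have fw2 k : fourier (fun x => 2^-1 * w x) k = (2^-1%:C)%C * fourier w k by exact: fourierZ.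
have n2 : normc (2^-1%:C)%C = 2^-1 :> R by rewrite normcR ger0_norm.
have bw2 : bnd 2 (fourier (fun x => 2^-1 * w x)) rho.
  have := bndZ (2^-1%:C)%C bw; rewrite n2 (_ : 2^-1 * (rho + rho) = rho); last by field.
  by move=> h; apply: (bnd_ext _ h) => k; rewrite fw2.
have lPw t k : cvgC (fun N => Qb N (mP t) (fourier (fun x => 2^-1 * w x)) (fourier (fun x => 2^-1 * w x)) k)
   (fourier (twisted_rhs t (fun x => 2^-1 * w x)) k).
  by have [|_] := twisted_rhs_spec t sw2 _ bw2; [rewrite fw2 w0 mulr0|].
pose b k := (24^-1%:C)%C * fourier (Gpart q w) k - (24^-1%:C)%C * fourier (Gpart p w) k.
have sw4 (x y z x' : R[i]) : x - y - (z - x') = x - z - (y - x') by ring.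
exists b; split.
  move=> k; have := cvgCB (l1 k) (l2 k); rewrite /cvgC.
  have -> : (fun k => fourier (v q) k + fourier (v p) k) = fourier w by apply/funext => i; rewrite fw.
  by under [in X in X -> _]eq_fun do rewrite -QbBm.
have := @mean_value_bnd 1 p q (fun s k => fourier (v s) k - (24^-1%:C)%C * fourier (Gpart s w) k)
   (fun t k => fourier (twisted_rhs t (v t)) k - fourier (twisted_rhs t (fun x => 2^-1 * w x)) k)
   (64 * rho ^+ 3 * tau) pq.
have -> : 64 * rho ^+ 3 * tau * (q - p) = 64 * rho ^+ 3 * tau ^+ 2 by rewrite /q; ring.
move=> H; apply: (bnd_ext _ (H _ _)); first by move=> k; rewrite /b sw4.
  by move=> t pt; apply: hasDB; [exact: hD | exact: hDG].
move=> t pt; have /andP[pt1 tq1] := pt.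
have lD k : cvgC (fun N => Qb N (mP t)
    (fun i => fourier (v t) i - fourier (fun x => 2^-1 * w x) i)
    (fun i => fourier (v t) i + fourier (fun x => 2^-1 * w x) i) k)
  (fourier (twisted_rhs t (v t)) k - fourier (twisted_rhs t (fun x => 2^-1 * w x)) k).
  have := cvgCB (lP t pt k) (lPw t k); rewrite /cvgC.
  by under [in X in X -> _]eq_fun do rewrite (Qb_polar _ _ _ _ (mP_sym t)).
apply: (bnd_lim lD) => N.
have -> : 64 * rho ^+ 3 * tau = 4 * 1 * (8 * rho ^+ 2 * tau) * (rho + rho) by ring.
apply: (@Qb_bound_pow _ 1 2) => //.
- by move=> i j; exact: mP_loss1.
- by rewrite v0// fw2 w0 mulr0 subrr.
- by rewrite v0// fw2 w0 mulr0 addr0.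
(* v(t) - w / 2 is half of (v(t) - v(p)) - (v(q) - v(t)), two increments over times at most tau. *)
- have h := bndZ (2^-1%:C)%C (bndB (lip p t (lexx p) pt1 tq1) (lip t q pt1 tq1 (lexx q))).
  rewrite n2 (_ : 2^-1 * (8 * rho ^+ 2 * tau + 8 * rho ^+ 2 * tau) = 8 * rho ^+ 2 * tau) in h; last by field.
  have half (x y z : R[i]) : (2^-1%:C)%C * (x - z - (y - x)) = x - (2^-1%:C)%C * (y + z).
    have {3}-> : x = (2^-1%:C)%C * x + (2^-1%:C)%C * x; last by ring.
    by rewrite -mulrDl -realCD (_ : 2^-1 + 2^-1 = 1) ?rmorph1 ?mul1r//; field.
  by apply: (bnd_ext _ h) => k; rewrite fw2 fw half.
- apply: bndD bw2; exact: b2.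
Qed.

End LocalError.

(** * Convergence *)

Section Convergence.
Context {R : realType}.
Implicit Types (u w : R -> R) (t tau rho K eps T : R) (n j : nat).

Definition iterates_to tau t u w : Prop := in_Hdot 1 w /\
  (fun j => Hnorm 1 (iter j (midpoint_map tau t u) u \- w)) @ \oo --> 0%E.

(** The invariant carried along the scheme: the l^2 radius is fixed, while the h^1 bound is
    existential because it may grow with n. *)
Definition admissible rho u : Prop :=
  [/\ sqint u, periodic u (pi *+ 2), fourier u 0 = 0, bnd 0 (fourier u) rho
    & exists K, bnd 1 (fourier u) K].

(** Conservation keeps the l^2 radius, and smoothing then bounds the increment in h^1 by rho alone,
    whatever the h^1 size of u. *)
Lemma step_invariants tau t rho u w : admissible rho u -> iterates_to tau t u w ->
  exists b, [/\ admissible rho w,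
    incr t tau (fun k => fourier w k + fourier u k) b,
    forall k, fourier w k = fourier u k + b k &
    bnd 1 b (4 * 1 * (rho + rho) * (rho + rho))].
Proof.
move=> [su pu u0 hrho _] [hw cv].
have [b [hb herb E]] := limit_step su u0 hrho hw cv.
have sw := in_Hdot_sqint (n := 1) hw.
have [W hW] := in_Hdot_bnd (n := 1) hw.
have w0 : fourier w 0 = 0 by case: hw.
have hE : fourier w = (fun k => fourier u k + b k) by apply/funext.
have b0 := incr_zero hb.
have hW0 := bnd_lower (leq0n 1) w0 hW.
have hbK : bnd 0 b (W + rho).
  by apply: (bnd_ext _ (bndB hW0 hrho)) => k; rewrite E addrC addKr.
have hb' : incr t tau (fun k => fourier u k + b k + fourier u k) b by rewrite hE in hb.
have hw0 : bnd 0 (fourier w) rho.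
  by rewrite hE; exact: incr_conserve (fourier_herm su) u0 herb hb' hrho hbK.
exists b; split=> //.
  by split=> //; [case: hw | exists W].
by apply: incr_bnd1 hb _; exact: bndD.
Qed.

Lemma exists_iterates tau rho eps u0 : 0 <= tau -> 0 < rho -> 0 < eps ->
  48 * eps * rho <= 1 -> 2 * tau <= eps ^+ 4 -> admissible rho u0 ->
  exists vn, midpoint_iterates tau u0 vn.
Proof.
move=> tau0 rho0 eps0 er te hu0.
have next n (u : {u | admissible rho u}) :
    {w : {w | admissible rho w} | iterates_to tau (n%:R * tau) (sval u) (sval w)}.
  apply: cid; case: u => u hu /=; have [su pu z hr [K hK]] := hu.
  have [w hw] := exists_step (n%:R * tau) tau0 rho0 eps0 er te su pu z hr hK.
  have [b [hwa _ _ _]] := step_invariants hu hw.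
  by exists (exist _ w hwa).
(* Each iterate travels with its proof of admissibility, which the next step consumes. *)
pose V := fix V n : {u | admissible rho u} :=
  if n is n'.+1 then sval (next n' (V n')) else exist _ u0 hu0.
exists (fun n => sval (V n)); split=> // n.
exact: svalP (next n (V n)).
Qed.

Lemma iterates_invariants tau rho u0 vn : admissible rho u0 -> bnd 1 (fourier u0) rho ->
  midpoint_iterates tau u0 vn ->
  forall n, admissible rho (vn n) /\
    bnd 1 (fourier (vn n)) (rho + n%:R * (4 * 1 * (rho + rho) * (rho + rho))).
Proof.
move=> hu0 hr [v0 hv]; elim=> [|n [IH1 IH2]]; first by rewrite v0 mul0r addr0.
have [b [h1 _ E hb]] := step_invariants IH1 (hv n); split=> //.
rewrite -natr1 mulrDl mul1r addrA.
by apply: (bnd_ext _ (bndD IH2 hb)) => k; rewrite E.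
Qed.

(** Division by x + x' leaves (1 - u) x' <= (1 + u) x + delta; for u <= 1/2 one has (1 + u) / (1 -
    u) <= 1 + 4 u and 1 / (1 - u) <= 2. *)
Lemma gronwall_step (x x' delta u : R) : 0 <= x -> 0 <= x' -> 0 <= delta -> 0 <= u -> u <= 2^-1 ->
  x' ^+ 2 <= x ^+ 2 + (x + x') * (delta + u * (x + x')) ->
  x' <= (1 + 4 * u) * x + 2 * delta.
Proof.
move=> x0 x'0 d0 u0 u12 h.
have h1 : x' - x <= delta + u * (x + x').
  have [s0|s0] := eqVneq (x + x') 0.
    have -> : x' = 0 by lra.
    have -> : x = 0 by lra.
    by rewrite !addr0 mulr0 subrr addr0.
  have sp : 0 < x + x' by rewrite lt_def s0 addr_ge0.
  rewrite -(ler_pM2l sp).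
  have -> : (x + x') * (x' - x) = x' ^+ 2 - x ^+ 2 by ring.
  lra.
have u1 : 0 < 1 - u by lra.
rewrite -(ler_pM2l u1).
have h2 : 0 <= u * x * (1 - 2 * u) by rewrite mulr_ge0 ?mulr_ge0//; lra.
have h3 : 0 <= delta * (1 - 2 * u) by rewrite mulr_ge0//; lra.
have -> : (1 - u) * ((1 + 4 * u) * x + 2 * delta) =
  x + u * x + delta + 2 * (u * x * (1 - 2 * u)) + delta * (1 - 2 * u) by ring.
have -> : (1 - u) * x' = x' - u * x' by ring.
rewrite mulrDr in h1; lra.
Qed.

(** The recursion is assumed only where the bound already holds at n, which the induction provides:
    this builds in the bootstrap for the smallness of the error. *)
Lemma gronwall (y : nat -> R) (a d : R) N : 0 <= a -> 0 <= d -> y 0%N <= 0 ->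
  (forall n, (n < N)%N -> y n <= n%:R * d * expR (a * n%:R) -> y n.+1 <= (1 + a) * y n + d) ->
  forall n, (n <= N)%N -> y n <= n%:R * d * expR (a * n%:R).
Proof.
move=> a0 d0 y0 h; elim=> [|n IH] nN; first by rewrite !mul0r.
have {}IH := IH (ltnW nN); apply: le_trans (h n nN IH) _.
have e1 : 1 <= expR (a * n.+1%:R) by rewrite -expR0 ler_expR mulr_ge0.
have e2 : expR (a * n.+1%:R) = expR a * expR (a * n%:R).
  by rewrite -expRD -natr1; congr expR; ring.
have e3 : 1 + a <= expR a := expR_ge1Dx a.
apply: (@le_trans _ _ (expR a * (n%:R * d * expR (a * n%:R)) + d * expR (a * n.+1%:R))).
  apply: lerD; last by rewrite ler_peMr.
  apply: (@le_trans _ _ ((1 + a) * (n%:R * d * expR (a * n%:R)))).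
    by rewrite ler_wpM2l// addr_ge0.
  by rewrite ler_wpM2r// !mulr_ge0// expR_ge0.
rewrite e2 -natr1 le_eqVlt; apply/orP; left; apply/eqP; ring.
Qed.

(* A first crude bound shows that the error is O(sqrt tau) after one step; this
   makes the cubic term of the energy estimate O(tau) times a quadratic one. *)
Lemma small_step_error tau t rho (a a' : int -> R[i]) u w (bl : int -> R[i]) :
  let X := 2 * rho + 2 + 4 * 1 * (rho + rho) * (rho + rho) in
  let beta := 2 + 64 * rho ^+ 3 + 8 * X * (4 * rho + X) in
  let C := 8 * rho + 8 * beta in
  0 <= tau -> tau <= 1 -> C * tau <= 2^-1 ->
  herm a -> herm a' -> a 0 = 0 -> a' 0 = 0 ->
  bnd 3 a rho -> bnd 3 a' rho ->
  admissible rho u -> iterates_to tau t u w ->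
  incr t tau (fun k => a' k + a k) bl ->
  bnd 1 (fun k => a' k - a k - bl k) (64 * rho ^+ 3 * tau ^+ 2) ->
  nrm 1 (fun k => a k - fourier u k) <= Num.sqrt tau ->
  nrm 1 (fun k => a' k - fourier w k) <=
    (1 + 4 * C * tau) * nrm 1 (fun k => a k - fourier u k) + 128 * rho ^+ 3 * tau ^+ 2.
Proof.
move=> X beta C.
have XE : X = 2 * rho + 2 + 4 * 1 * (rho + rho) * (rho + rho) by [].
have betaE : beta = 2 + 64 * rho ^+ 3 + 8 * X * (4 * rho + X) by [].
have CE : C = 8 * rho + 8 * beta by [].
clearbody C; clearbody beta; clearbody X.
move=> tau0 tau1 Ct ha ha' a0 a'0 ba ba' hu hw hbl hd hx.
have [bn [hwa hbn E bbn]] := step_invariants hu hw.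
have [su _ u0 hru [Ku hKu]] := hu; have [sw _ w0 hrw [Kw hKw]] := hwa.
have rho0 : 0 <= rho by case: ba.
set e := fun k => a k - fourier u k; set e' := fun k => a' k - fourier w k.
have he : herm e by move=> k; rewrite /e ha (fourier_herm su) rmorphB.
have he' : herm e' by move=> k; rewrite /e' ha' (fourier_herm sw) rmorphB.
have e0 : e 0 = 0 by rewrite /e a0 u0 subrr.
have e'0 : e' 0 = 0 by rewrite /e' a'0 w0 subrr.
have ba1 := bnd_lower (isT : (1 <= 3)%N) a0 ba.
have ba'1 := bnd_lower (isT : (1 <= 3)%N) a'0 ba'.
have be := bnd_nrm (bndB ba1 hKu); have be' := bnd_nrm (bndB ba'1 hKw).
rewrite -/e -/e' in hx be be' *.
set x := nrm 1 e in hx be *; set x' := nrm 1 e' in be' *.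
have x0 : 0 <= x by exact: nrm_ge0.
have x'0 : 0 <= x' by exact: nrm_ge0.
set s := Num.sqrt tau in hx *.
have s0 : 0 <= s by exact: sqrtr_ge0.
have ss : s ^+ 2 = tau by rewrite sqr_sqrtr.
have s1 : s <= 1 by rewrite -[1]sqrtr1 ler_sqrt.
pose d k := a' k - a k - bl k.
pose b k := bl k - bn k.
have ee k : e' k = e k + d k + b k by rewrite /e' /e /d /b E; ring.
(* For z = a' + a and z' = fourier w + fourier u one has z - z' = E, so z + z' = 2 z - E = V - E. *)
pose V k := (a' k + a k) + (a' k + a k).
have hV : bnd 3 V (4 * rho).
  by apply: bndW (bndD (bndD ba' ba) (bndD ba' ba)); lra.
have V0 : V 0 = 0 by rewrite /V a0 a'0 !addr0.
have hb k : cvgC (fun N => Qb N (mB t tau) (fun i => e i + e' i)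
    (fun i => V i - (e i + e' i)) k) (b k).
  have := incr_diff hbl hbn k; rewrite /cvgC.
  under [in X in X -> _]eq_fun => N.
    rewrite (@Qb_ext _ N _ (mB t tau) _ (fun i => e i + e' i) _ (fun i => V i - (e i + e' i))); last first.
      move=> i l _; congr (_ * _ * _); first by rewrite /e /e'; ring.
      by rewrite /V /e /e'; ring.
    over.
  by [].
have B0 : 0 <= 4 * 1 * (rho + rho) * (rho + rho) by rewrite !mulr_ge0// addr_ge0.
have X0 : 0 <= X by rewrite XE; lra.
have x'E : x' = nrm 1 e' by [].
have sE : s = Num.sqrt tau by [].
clearbody x x' s.
have bw1 : bnd 1 (fourier w) (rho + x + 4 * 1 * (rho + rho) * (rho + rho)).
  apply: (bnd_ext _ (bndD (bndB ba1 be) bbn)) => k; rewrite E /e; ring.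
(* X adds up x for e and rho + (rho + x + B) for e', with x <= 1 and B the smoothing bound of one
   increment. *)
have bE1 : bnd 1 (fun k => e k + e' k) X.
  apply: bndW (bndD be (bndB ba'1 bw1)); rewrite XE; lra.
have V1 := bnd_lower (isT : (1 <= 3)%N) V0 hV.
have bb : bnd 1 b (4 * (2 * s) * X * (4 * rho + X)).
  apply: (bnd_lim hb) => N; apply: (@Qb_bound_pow _ 1 1) => //.
  - exact: mulr_ge0.
  - by move=> i j; rewrite sE; exact: mB_le_sqrt.
  - by rewrite e0 e'0 addr0.
  - by rewrite V0 e0 e'0 !addr0 subr0.
  - exact: bndB.
have hx' : x' <= x + 64 * rho ^+ 3 * tau ^+ 2 + 4 * (2 * s) * X * (4 * rho + X).
  by rewrite x'E; apply: nrm_le; apply: (bnd_ext _ (bndD (bndD be hd) bb)) => k; rewrite ee.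
have ts : tau ^+ 2 <= s.
  rewrite -ss -exprM; apply: (@le_trans _ _ (s ^+ 1)); last by rewrite expr1.
  by apply: ler_wiXn2l.
have r3 : 0 <= 64 * rho ^+ 3 by rewrite mulr_ge0// exprn_ge0.
have XX : 0 <= 8 * X * (4 * rho + X) by rewrite !mulr_ge0// addr_ge0// mulr_ge0.
have beta0 : 0 <= beta by rewrite betaE addr_ge0// addr_ge0.
(* The terms 2 x, 64 rho^3 tau^2 and the bound of b are all multiples of s = sqrt tau, because x <=
   s and tau^2 <= s; beta collects the factors. *)
have eta : x + x' <= beta * s.
  have -> : beta * s = 2 * s + 64 * rho ^+ 3 * s + 8 * X * (4 * rho + X) * s.
    by rewrite betaE; ring.
  move: hx'; have -> : 4 * (2 * s) * X * (4 * rho + X) = 8 * X * (4 * rho + X) * s by ring.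
  have := ler_wpM2l r3 ts; move: (64 * rho ^+ 3 * tau ^+ 2) (64 * rho ^+ 3 * s) (_ * (_ + _) * s) => p q r.
  lra.
have C0 : 0 <= C by rewrite CE addr_ge0// mulr_ge0.
have d0 : 0 <= 64 * rho ^+ 3 * tau ^+ 2 by rewrite mulr_ge0// sqr_ge0.
have -> : 4 * C * tau = 4 * (C * tau) by ring.
have -> : 128 * rho ^+ 3 * tau ^+ 2 = 2 * (64 * rho ^+ 3 * tau ^+ 2) by ring.
apply: gronwall_step => //; first exact: mulr_ge0.
have := error_step tau0 he he' e0 e'0 V0 be (bndD be be') hd hV ee hb x'E.
rewrite -sE => /le_trans; apply; rewrite lerD2l.
have eta0 : 0 <= x + x' by rewrite addr_ge0.
move: (x + x') eta eta0 => eta_ eta eta0.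
have h3 : 8 * s * eta_ ^+ 3 <= 8 * beta * tau * eta_ ^+ 2.
  have -> : 8 * s * eta_ ^+ 3 = (8 * s * eta_ ^+ 2) * eta_ by ring.
  have -> : 8 * beta * tau * eta_ ^+ 2 = (8 * s * eta_ ^+ 2) * (beta * s) by rewrite -ss; ring.
  by apply: ler_wpM2l => //; rewrite !mulr_ge0// sqr_ge0.
(* C is 8 rho from the linear term, V having size 4 rho, plus 8 beta from the cubic term. *)
have -> : eta_ * (64 * rho ^+ 3 * tau ^+ 2 + C * tau * eta_) =
  64 * rho ^+ 3 * tau ^+ 2 * eta_ + 8 * rho * tau * eta_ ^+ 2 + 8 * beta * tau * eta_ ^+ 2.
  by rewrite CE; ring.
have -> : 2 * tau * eta_ ^+ 2 * (4 * rho) = 8 * rho * tau * eta_ ^+ 2 by ring.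
lra.
Qed.

End Convergence.

Theorem theorem4p1 (R : realType) (rad : R) (rad_gt0 : 0 < rad) :
  exists tauR : R, 0 < tauR /\
  forall T : R, 0 < T ->
  exists c : R, 0 < c /\
  forall tau : R, 0 < tau < tauR ->
  forall (u0 : R -> R) (v : R -> R -> R),
    twisted_kdv_solution T u0 v ->
    (ereal_sup [set Hnorm 3%R (v t) | t in `[0%R, T]%classic] < (rad / 2)%:E)%E ->
    (exists vn : nat -> R -> R, midpoint_iterates tau u0 vn) /\
    (forall vn : nat -> R -> R, midpoint_iterates tau u0 vn ->
     forall n : nat, n%:Z <= Num.floor (T / tau) ->
       (Hnorm 1%R (v (n%:R * tau) \- vn n)%R <= (c * tau)%:E)%E).
Proof.
pose rho := rad / 2.
have rho0 : 0 < rho by rewrite divr_gt0.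
pose eps := (48 * rho)^-1.
have r48 : 0 < 48 * rho by rewrite mulr_gt0.
have eps0 : 0 < eps by rewrite invr_gt0.
have er : 48 * eps * rho <= 1 by rewrite /eps mulrAC divff// lt0r_neq0.
(* Chosen before T: it only has to make the fixed-point map contract, through the condition 2 tau <=
   eps^4 of [mB_small]. *)
exists (eps ^+ 4 / 2); split; first by rewrite divr_gt0// exprn_gt0.
move=> T T0.
pose B := 4 * 1 * (rho + rho) * (rho + rho).
have B0 : 0 <= B by rewrite !mulr_ge0 ?addr_ge0 ?(ltW rho0).
pose X := 2 * rho + 2 + B.
pose beta := 2 + 64 * rho ^+ 3 + 8 * X * (4 * rho + X).
pose C := 8 * rho + 8 * beta.
have X0 : 0 <= X by rewrite /X; lra.
have r3 : 0 <= rho ^+ 3 by rewrite exprn_ge0 ?ltW.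
have beta0 : 0 < beta.
  have : 0 <= 8 * X * (4 * rho + X) by rewrite !mulr_ge0// addr_ge0// mulr_ge0// ltW.
  rewrite /beta; lra.
have C0 : 0 < C by rewrite /C; lra.
have r128 : 0 <= 128 * rho ^+ 3 by exact: mulr_ge0.
(* The discrete Gronwall bound with rate 4 C tau and source 128 rho^3 tau^2, summed over n tau <=
   T. *)
pose c1 := T * (128 * rho ^+ 3) * expR (4 * C * T).
have c10 : 0 <= c1 by rewrite mulr_ge0 ?expR_ge0// mulr_ge0// ltW.
(* Below tauT three things hold: tau <= 1, C tau <= 1/2, and c1 tau <= sqrt tau, the last one
   closing the bootstrap. *)
pose tauT := Num.min 1 (Num.min (2 * C)^-1 ((1 + c1) ^+ 2)^-1).
have C20 : 0 < 2 * C by rewrite mulr_gt0.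
have c1p : 0 < 1 + c1 by rewrite ltr_pwDl.
have tauT0 : 0 < tauT by rewrite !lt_min ltr01 !invr_gt0 C20 exprn_gt0.
(* For tau >= tauT there are at most T / tauT steps, each adding at most B in h^1; dividing by tauT
   turns this O(1) error into a multiple of tau. *)
pose c2 := (rho + (rho + T / tauT * B)) / tauT.
have TB0 : 0 <= T / tauT * B by rewrite mulr_ge0// divr_ge0// ltW.
have c20 : 0 <= c2 by rewrite divr_ge0 ?(ltW tauT0)// !addr_ge0// ltW.
exists (c1 + c2 + 1); split; first by rewrite ltr_wpDl// addr_ge0.
move=> tau /andP[tau0 tauR] u0 v hsol hsup.
have [hv v0 _] := hsol.
have te : 2 * tau <= eps ^+ 4 by rewrite mulrC -ler_pdivlMr// ltW.
have b3 t : 0 <= t <= T -> bnd 3 (fourier (v t)) rho.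
  move=> tT; apply/(HnormP (n := 3)); [|exact: ltW|].
    by have [_ _ _ -> _] := hv t tT; rewrite eqxx.
  by apply: le_trans (ltW hsup); apply: ereal_sup_ubound; exists t.
have T00 : 0 <= (0 : R) <= T by rewrite lexx ltW.
have z0 t : 0 <= t <= T -> fourier (v t) 0 = 0 by move=> /hv; case.
have sv t : 0 <= t <= T -> sqint (v t) by move=> /hv; exact: (@in_Hdot_sqint _ 3).
have b1 t : 0 <= t <= T -> bnd 1 (fourier (v t)) rho.
  by move=> tT; apply: (bnd_lower (isT : (1 <= 3)%N)); [exact: z0 | exact: b3].
have hu0 : admissible rho u0.
  rewrite -v0; split; [exact: sv | by case: (hv 0 T00) | exact: z0 | | by exists rho; exact: b1].
  by apply: (bnd_lower (isT : (0 <= 3)%N)); [exact: z0 | exact: b3].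
split; first exact: exists_iterates (ltW tau0) rho0 eps0 er te hu0.
move=> vn hvn n; rewrite floor_ge_int -pmulrn ler_pdivlMr// => nT.
have inv := iterates_invariants hu0 _ hvn.
have {}inv m : admissible rho (vn m) /\ bnd 1 (fourier (vn m)) (rho + m%:R * B).
  by apply: inv; rewrite -v0; exact: b1.
have inT m : (m <= n)%N -> 0 <= m%:R * tau <= T.
  move=> mn; rewrite mulr_ge0 ?(ltW tau0)//=; apply: le_trans nT.
  by rewrite ler_wpM2r ?(ltW tau0)// ler_nat.
have [[sn _ n0 _ _] bn] := inv n.
apply/(HnormP (n := 1)).
- by rewrite fourierB ?n0 ?z0 ?subrr ?eqxx//; [exact: inT | apply: sv; exact: inT].
- by rewrite mulr_ge0 ?addr_ge0// ltW.
have eE : fourier (v (n%:R * tau) \- vn n) = (fun k => fourier (v (n%:R * tau)) k - fourier (vn n) k).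
  by apply/funext => k; rewrite fourierB//; apply: sv; exact: inT.
rewrite eE; have [tl|ts] := leP tauT tau.
  apply: bndW (bndB (b1 _ (inT n (leqnn n))) bn).
  apply: (@le_trans _ _ (c2 * tau)); last first.
    by rewrite ler_wpM2r ?(ltW tau0)//; lra.
  apply: (@le_trans _ _ (c2 * tauT)); last by rewrite ler_wpM2l.
  rewrite /c2 divfK ?lt0r_neq0// lerD2l lerD2l ler_wpM2r//.
  rewrite ler_pdivlMr//; apply: le_trans nT; by rewrite ler_wpM2l.
have [t1 t2 t3] : [/\ tau <= 1, C * tau <= 2^-1 & c1 * tau <= Num.sqrt tau].
  move: ts; rewrite !lt_min => /and3P[t1 t2 t3]; split; first exact: ltW.
    move: t2; rewrite -[X in _ < X]mul1r ltr_pdivlMr// => t2; lra.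
  have s0 : 0 <= Num.sqrt tau by exact: sqrtr_ge0.
  have ss : Num.sqrt tau ^+ 2 = tau by rewrite sqr_sqrtr// ltW.
  have h : (1 + c1) * Num.sqrt tau <= 1.
    rewrite -ler_sqr ?nnegrE ?mulr_ge0 ?(ltW c1p)// exprMn ss expr1n.
    by move: t3; rewrite -[X in _ < X]mul1r ltr_pdivlMr ?exprn_gt0// mulrC => /ltW.
  rewrite -{1}ss expr2 mulrA ler_piMl//; apply: le_trans h.
  by rewrite ler_wpM2r// lerDr.
pose y m := nrm 1 (fun k => fourier (v (m%:R * tau)) k - fourier (vn m) k).
have gm m : (m <= n)%N -> m%:R * (128 * rho ^+ 3 * tau ^+ 2) * expR (4 * C * tau * m%:R) <= c1 * tau.
  move=> /inT /andP[_ mT].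
  have -> : m%:R * (128 * rho ^+ 3 * tau ^+ 2) * expR (4 * C * tau * m%:R) =
     (m%:R * tau) * (128 * rho ^+ 3) * expR (4 * C * (m%:R * tau)) * tau.
    by rewrite (_ : 4 * C * tau * m%:R = 4 * C * (m%:R * tau)); ring.
  rewrite ler_wpM2r ?(ltW tau0)//; apply: ler_pM.
  - by apply: mulr_ge0 => //; apply: mulr_ge0 => //; exact: ltW.
  - exact: expR_ge0.
  - by rewrite ler_wpM2r.
  - by rewrite ler_expR ler_wpM2l// mulr_ge0// ltW.
have key : forall m, (m <= n)%N ->
    y m <= m%:R * (128 * rho ^+ 3 * tau ^+ 2) * expR (4 * C * tau * m%:R).
  apply: gronwall.
  - by apply: mulr_ge0 (ltW tau0); apply: mulr_ge0 => //; exact: ltW.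
  - by apply: mulr_ge0 => //; exact: sqr_ge0.
  - apply: nrm_le; rewrite mul0r; have [vn0 _] := hvn; rewrite vn0 v0.
    by split=> // M; rewrite /hs big1 ?expr0n// => k _; rewrite subrr normc0 mulr0 expr0n.
  move=> m mn hm.
  have Sm : m.+1%:R * tau = m%:R * tau + tau by rewrite -natr1 mulrDl mul1r.
  have i1 := inT m (ltnW mn); have i2 := inT m.+1 mn.
  have /andP[p0 _] := i1; have /andP[_ pT] := i2; rewrite Sm in pT.
  have [bl [hbl hd]] := local_error hsol b3 p0 (ltW tau0) pT.
  rewrite -Sm in hbl hd.
  have [hum _] := inv m; have hw : iterates_to tau (m%:R * tau) (vn m) (vn m.+1).
    by have [_ hh] := hvn; exact: hh.
  have := small_step_error (ltW tau0) t1 t2 (fourier_herm (sv _ i1)) (fourier_herm (sv _ i2))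
    (z0 _ i1) (z0 _ i2) (b3 _ i1) (b3 _ i2) hum hw hbl hd.
  (* The bound at step m gives an error of at most c1 tau <= sqrt tau, the smallness that
     [small_step_error] asks for. *)
  apply; apply: le_trans t3; apply: le_trans hm _; apply: gm; exact: ltnW.
have bK : bnd 1 (fun k => fourier (v (n%:R * tau)) k - fourier (vn n) k) (y n).
  exact: bnd_nrm (bndB (b1 _ (inT n (leqnn n))) bn).
apply: bndW bK; apply: le_trans (key n (leqnn n)) _; apply: le_trans (gm n (leqnn n)) _.
by rewrite ler_wpM2r ?(ltW tau0)//; lra.
Qed.
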